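(* Let $d\ge2$ and let $\varphi^\varepsilon$, $\lambda^\varepsilon$, $\mu_t^\varepsilon$ and $\tilde\rho=\tilde\rho_{(y,s)}$ be as in the context. There exists $c_5>0$ depending only on $d$ such that $$\int_{\mathbb{R}^d}\tilde\rho_{(y,s)}(x,t)\,d\mu_t^\varepsilon(x)\Big|_{t=t_2}\le\Big(\int_{\mathbb{R}^d}\tilde\rho_{(y,s)}(x,t)\,d\mu_t^\varepsilon(x)\Big|_{t=t_1}+c_5\int_{t_1}^{t_2}e^{-\frac{1}{128(s-t)}}\mu_t^\varepsilon(B_{\frac12}(y))\,dt\Big)e^{\int_{t_1}^{t_2}|\lambda^\varepsilon(t)|^2\,dt}$$ for all $y\in\mathbb{R}^d$, all $0\le t_1<t_2<s$, and all $\varepsilon$ in the sequence $\{\varepsilon_i\}$.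
   Context: Basic notation. $\Omega=\mathbb{T}^d=(\mathbb{R}/\mathbb{Z})^d$, also identified with $[0,1)^d\subset\mathbb{R}^d$; functions, sets and measures on $\Omega$ are extended $\Omega$-periodically to $\mathbb{R}^d$. $W(s)=\frac{(1-s^2)^2}{2}$, $\sigma=\int_{-1}^1\sqrt{2W(s)}\,ds$, $q^\varepsilon(r)=\tanh(r/\varepsilon)$. $B_R(x)$ is the open ball, $\omega_{d-1}$ the volume of the unit ball of $\mathbb{R}^{d-1}$; $\|\nabla\chi_A\|$ is the total variation measure of the distributional gradient of $\chi_A$. Initial set. $U_0\subset\subset(0,1)^d$ is a bounded open set, $M_0=\partial U_0$, such that: (1) there is $D_0>0$ with $\sup_{x\in\mathbb{R}^d,R>0}\frac{\mathcal{H}^{d-1}(M_0\cap B_R(x))}{\omega_{d-1}R^{d-1}}\le D_0$; (2) there are open sets $U_0^i\subset(0,1)^d$, $i\ge1$, with $C^3$ boundaries $M_0^i$, such that $\mathcal{L}^d(U_0\triangle U_0^i)\to0$ and $\|\nabla\chi_{U_0^i}\|\to\|\nabla\chi_{U_0}\|$ as measures. $U_0^i$, $M_0^i$ are extended periodically to $\mathbb{R}^d$. Initial data. Let $\varepsilon_i\in(0,1)$, $\varepsilon_i\downarrow0$. Let $r_{\varepsilon_i}(x)=\mathrm{dist}(x,M_0^i)$ for $x\in U_0^i$ and $-\mathrm{dist}(x,M_0^i)$ for $x\notin U_0^i$; let $\overline{r_{\varepsilon_i}}$ be a periodic smoothing of $r_{\varepsilon_i}$ with $|\nabla\overline{r_{\varepsilon_i}}|\le1$,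 $|\nabla^2\overline{r_{\varepsilon_i}}|\le\varepsilon_i^{-1}$ on $\mathbb{R}^d$ and $\overline{r_{\varepsilon_i}}=r_{\varepsilon_i}$ near $M_0^i$. Put $\varphi_0^{\varepsilon_i}=q^{\varepsilon_i}(\overline{r_{\varepsilon_i}})$. Throughout, $\varepsilon$ stands for elements $\varepsilon_i$ of this sequence. Equation. $\varphi^\varepsilon$ is the (periodic, global in time) solution of $$\varepsilon\varphi_t^\varepsilon=\varepsilon\Delta\varphi^\varepsilon-\frac{W'(\varphi^\varepsilon)}{\varepsilon}+\lambda^\varepsilon\sqrt{2W(\varphi^\varepsilon)}\ \text{ in }\Omega\times(0,\infty),\qquad\varphi^\varepsilon(\cdot,0)=\varphi_0^\varepsilon,$$ $$\lambda^\varepsilon(t)=\frac{-\int_\Omega\sqrt{2W(\varphi^\varepsilon)}\,\big(\varepsilon\Delta\varphi^\varepsilon-W'(\varphi^\varepsilon)/\varepsilon\big)\,dx}{2\int_\Omega W(\varphi^\varepsilon)\,dx}.$$ Measures. $\mu_t^\varepsilon(\phi)=\frac1\sigma\int_{\mathbb{R}^d}\phi\big(\frac{\varepsilon|\nabla\varphi^\varepsilon|^2}{2}+\frac{W(\varphi^\varepsilon)}{\varepsilon}\big)dx$ for $\phi\in C_c(\mathbb{R}^d)$. Localized backward heat kernel. Fix (once and for all, for each $d$) a radially symmetric cut-off function $\eta\in C_c^\infty(B_{\frac12}(0))$ with $\eta=1$ on $B_{\frac14}(0)$ and $0\le\eta\le1$. For $t<s$ and $x,y\in\mathbb{R}^d$,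 $$\tilde\rho_{(y,s)}(x,t)=\frac{1}{(4\pi(s-t))^{\frac{d-1}{2}}}e^{-\frac{|x-y|^2}{4(s-t)}}\,\eta(x-y).$$ *)

(* Defs.v *)
From HB Require Import structures.
From mathcomp Require Import all_boot all_order all_algebra.
From mathcomp Require Import all_classical all_reals all_analysis.

Set Implicit Arguments.
Unset Strict Implicit.
Unset Printing Implicit Defensive.

Import Order.TTheory GRing.Theory Num.Theory.
Import numFieldNormedType.Exports.

Local Open Scope classical_set_scope.
Local Open Scope ring_scope.

(* R^n is 'rV[R]_n, with the sigma-algebra generated by the coordinates
   (which is the Borel sigma-algebra). The norm `|x| that the library puts on
   'rV[R]_n is the sup norm; the Euclidean norm is [enorm] below. *)

Section measurable_rV.
Variables (R : realType) (n : nat).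

Definition rV_coord (i : 'I_n) (x : 'rV[R]_n) : measurableTypeR R := x 0 i.

Let rV_set0 : g_sigma_preimage rV_coord set0.
Proof. exact: sigma_algebra0. Qed.

Let rV_setC A : g_sigma_preimage rV_coord A -> g_sigma_preimage rV_coord (~` A).
Proof. exact: sigma_algebraC. Qed.

Let rV_bigcup (F : (set 'rV[R]_n)^nat) :
  (forall i, g_sigma_preimage rV_coord (F i)) ->
  g_sigma_preimage rV_coord (\bigcup_i (F i)).
Proof. exact: sigma_algebra_bigcup. Qed.

HB.instance Definition _ := @isMeasurable.Build default_measure_display
  'rV[R]_n (g_sigma_preimage rV_coord) rV_set0 rV_setC rV_bigcup.

Lemma measurable_rV_coord (i : 'I_n) : measurable_fun setT (rV_coord i).
Proof.
move=> _ Y mY; rewrite setTI; apply: sub_sigma_algebra => /=.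
rewrite -bigcup_seq/=; exists i => /=; first by rewrite mem_index_enum.
by exists Y => //; rewrite setTI.
Qed.

Lemma measurable_fun_rVP d (T : measurableType d) (f : T -> 'rV[R]_n) :
  (forall i, measurable_fun setT (rV_coord i \o f)) -> measurable_fun setT f.
Proof.
move=> mf.
have sub : g_sigma_preimage (fun i => rV_coord i \o f) `<=` measurable.
  apply: smallest_sub; first exact: sigma_algebra_measurable.
  rewrite -bigcup_seq; apply: bigcup_sub => i _ _ [B mB <-].
  exact: mf.
rewrite g_sigma_preimage_comp in sub.
by move=> _ A mA; apply: sub; exists A.
Qed.

End measurable_rV.

Lemma product_sigma_finite (R : realType) d1 d2 (T1 : measurableType d1)
    (T2 : measurableType d2) (m1 : {sigma_finite_measure set T1 -> \bar R})
    (m2 : {sigma_finite_measure set T2 -> \bar R}) :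
  sigma_finite setT (m1 \x m2)%E.
Proof.
have /sigma_finiteP[F [TF ndF Foo]] := sigma_finiteT m1.
have /sigma_finiteP[G [TG ndG Goo]] := sigma_finiteT m2.
exists (fun n => F n `*` G n).
  rewrite -setXTT TF TG predeqE => -[x y]; split.
    move=> [/= [n _ Fnx] [k _ Gky]]; exists (maxn n k) => //; split.
    - by move: x Fnx; exact/subsetPset/ndF/leq_maxl.
    - by move: y Gky; exact/subsetPset/ndG/leq_maxr.
  by move=> [n _ []/= ? ?]; split; exists n.
move=> k; have [? ?] := Foo k; have [? ?] := Goo k.
split; first exact: measurableX.
by rewrite product_measure1E// lte_mul_pinfty// ge0_fin_numE.
Qed.

Section lebesgue_rV.
Variable R : realType.

Definition rV_cons n (p : measurableTypeR R * 'rV[R]_n) : 'rV[R]_n.+1 :=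
  row_mx (p.1 : R)%:M p.2.

Lemma measurable_rV_cons n : measurable_fun setT (@rV_cons n).
Proof.
apply: measurable_fun_rVP => i.
have [j ->|j ->] := @split_ordP 1 n i.
  rewrite (_ : _ \o _ = fst); first exact: measurable_fst.
  apply/funext => p /=; rewrite /rV_coord /rV_cons.
  by rewrite (row_mxEl (p.1 : R)%:M) !ord1 mxE eqxx mulr1n.
rewrite (_ : _ \o _ = rV_coord j \o snd).
  by apply: measurableT_comp; [exact: measurable_rV_coord|exact: measurable_snd].
by apply/funext => p /=; rewrite /rV_coord /rV_cons (row_mxEr (p.1 : R)%:M).
Qed.

HB.instance Definition _ n :=
  isMeasurableFun.Build _ _ _ _ (@rV_cons n) (@measurable_rV_cons n).

Section step.
Local Open Scope ereal_scope.
Variables (n : nat) (m : {sigma_finite_measure set 'rV[R]_n -> \bar R}).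

Definition leb_step : set 'rV[R]_n.+1 -> \bar R :=
  pushforward (lebesgue_measure \x m) (@rV_cons n).

Let leb_step0 : leb_step set0 = 0. Proof. exact: measure0. Qed.

Let leb_step_ge0 A : 0 <= leb_step A. Proof. exact: measure_ge0. Qed.

Let leb_step_sigma_additive : semi_sigma_additive leb_step.
Proof. exact: measure_semi_sigma_additive. Qed.

HB.instance Definition _ := isMeasure.Build _ _ _ leb_step
  leb_step0 leb_step_ge0 leb_step_sigma_additive.

Definition rV_uncons (x : 'rV[R]_n.+1) : measurableTypeR R * 'rV[R]_n :=
  (rV_coord ord0 x, \row_j x ord0 (lift ord0 j)).

Let rV_consK : cancel (@rV_cons n) rV_uncons.
Proof.
move=> [a v]; rewrite /rV_uncons /rV_cons /rV_coord /=; congr pair.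
  have -> : ord0 = lshift n ord0 :> 'I_(1 + n) by exact/val_inj.
  by rewrite (row_mxEl (a : R)%:M) mxE eqxx mulr1n.
apply/rowP => j; rewrite mxE.
have -> : lift ord0 j = rshift 1 j :> 'I_(1 + n) by exact/val_inj.
by rewrite (row_mxEr (a : R)%:M).
Qed.

Let measurable_rV_uncons : measurable_fun setT rV_uncons.
Proof.
apply/measurable_fun_pair; first exact: measurable_rV_coord.
apply: measurable_fun_rVP => i.
rewrite (_ : _ \o _ = rV_coord (lift ord0 i)); first exact: measurable_rV_coord.
by apply/funext => x; rewrite /rV_coord /= mxE.
Qed.

Let leb_step_sigma_finite : sigma_finite setT leb_step.
Proof.
have [F UF mF] := product_sigma_finite lebesgue_measure m.
exists (fun i => rV_uncons @^-1` F i).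
  by rewrite -preimage_bigcup -UF preimage_setT.
move=> i; split.
  by rewrite -[X in measurable X]setTI; apply: measurable_rV_uncons; case: (mF i).
rewrite /leb_step /pushforward -comp_preimage.
rewrite (_ : _ @^-1` _ = F i); first by case: (mF i).
by apply/seteqP; split => p /=; rewrite rV_consK.
Qed.

HB.instance Definition _ := Measure_isSigmaFinite.Build _ _ _ leb_step
  leb_step_sigma_finite.

End step.

Definition leb0 : set 'rV[R]_0 -> \bar R := dirac (0 : 'rV[R]_0).
HB.instance Definition _ := Measure.on leb0.

Let leb0_sigma_finite : sigma_finite setT leb0.
Proof.
apply: fin_num_fun_sigma_finite; first by rewrite measure0.
by move=> A _; rewrite /leb0 diracE.
Qed.

HB.instance Definition _ := Measure_isSigmaFinite.Build _ _ _ leb0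
  leb0_sigma_finite.

Fixpoint leb (n : nat) : {sigma_finite_measure set 'rV[R]_n -> \bar R} :=
  match n with
  | 0 => leb0
  | n'.+1 => leb_step (leb n')
  end.

End lebesgue_rV.

Section euclidean.
Variables (R : realType) (n : nat).
Implicit Types (x y v : 'rV[R]_n) (A : set 'rV[R]_n) (f : 'rV[R]_n -> R).

Definition enorm x : R := Num.sqrt (\sum_i x 0 i ^+ 2).

Definition eball x (r : R) : set 'rV[R]_n := [set y | enorm (y - x) < r].

Definition dist_to x A : R := inf [set enorm (x - y) | y in A].

(* The supremum is taken in \bar R and over A `*` A extended by 0, so that
   the diameter of the empty set is 0. *)
Definition ediam A : \bar R :=
  ereal_sup (0%E |` [set (enorm (p.1 - p.2))%:E | p in A `*` A]).

Definition boundary A : set 'rV[R]_n := closure A `\` interior A.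

Definition partial (i : 'I_n) f x : R := 'D_(delta_mx 0 i) f x.

Definition grad f x : 'rV[R]_n := \row_i partial i f x.

Definition hessian f x : 'M[R]_n := \matrix_(i, j) partial i (partial j f) x.

Definition laplacian f x : R := \sum_i partial i (partial i f) x.

Definition divergence (g : 'rV[R]_n -> 'rV[R]_n) x : R :=
  \sum_i partial i (fun y => g y 0 i) x.

Fixpoint Ck (k : nat) f : Prop :=
  match k with
  | 0 => continuous f
  | k'.+1 => continuous f /\
      forall i, (forall x, derivable f x (delta_mx 0 i)) /\ Ck k' (partial i f)
  end.

Definition smooth f : Prop := forall k, Ck k f.

Definition tsupport (V : zmodType) (f : 'rV[R]_n -> V) : set 'rV[R]_n :=
  closure [set x | f x != 0].

Definition periodic f : Prop := forall i x, f (x + delta_mx 0 i) = f x.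

Definition periodic_ext A : set 'rV[R]_n :=
  [set x | exists k : 'rV[int]_n, A (x + map_mx intr k)].

(* The half-open unit cube represents the torus, the open one is (0,1)^n. *)
Definition torus : set 'rV[R]_n := [set x | forall i, 0 <= x 0 i < 1].

Definition open_cube : set 'rV[R]_n := [set x | forall i, 0 < x 0 i < 1].

End euclidean.

Arguments torus {R n}.
Arguments open_cube {R n}.

Section geometric_measure_theory.
Variable R : realType.

Definition unit_ball_vol (k : nat) : R := fine (leb R k (eball 0 1)).

(* The k-dimensional Hausdorff measure, for k >= 1 (for k = 0 the empty set
   would be counted), normalized so that it agrees with Lebesgue measure on
   R^k. *)
Definition hausdorff_pre n (k : nat) (delta : R) (A : set 'rV[R]_n) : \bar R :=
  ereal_inf [set (\sum_(0 <= j <oo)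
                    (unit_ball_vol k * (fine (ediam (C j)) / 2) ^+ k)%:E)%E |
    C in [set C : (set 'rV[R]_n)^nat |
            A `<=` \bigcup_j C j /\
            forall j, (ediam (C j) <= delta%:E)%E]].

Definition hausdorff n (k : nat) (A : set 'rV[R]_n) : \bar R :=
  ereal_sup [set hausdorff_pre k delta A | delta in [set delta : R | 0 < delta]].

(* The variation of the distributional gradient of the indicator of A in V. *)
Definition variation n (A V : set 'rV[R]_n) : \bar R :=
  ereal_sup [set (\int[leb R n]_(x in A) divergence g x)%:E |
    g in [set g : 'rV[R]_n -> 'rV[R]_n |
      [/\ forall i, Ck 1 (fun x => g x 0 i),
          compact (tsupport g),
          tsupport g `<=` V &
          forall x, enorm (g x) <= 1]]].

(* nu is the Radon measure ||grad chi_A||; a Radon measure is determined by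
   its values on open sets. *)
Definition is_total_variation n (A : set 'rV[R]_n)
    (nu : {measure set 'rV[R]_n -> \bar R}) : Prop :=
  (forall K, compact K -> (nu K < +oo)%E) /\
  (forall V, open V -> nu V = variation A V).

Definition total_variation_cvg n (A_ : (set 'rV[R]_n)^nat) (A : set 'rV[R]_n) :
    Prop :=
  exists (nu_ : nat -> {measure set 'rV[R]_n -> \bar R})
         (nu : {measure set 'rV[R]_n -> \bar R}),
    [/\ forall i, is_total_variation (A_ i) (nu_ i),
        is_total_variation A nu &
        forall f : 'rV[R]_n -> R, continuous f -> compact (tsupport f) ->
          (fun i => \int[nu_ i]_x f x) @ \oo --> \int[nu]_x f x].

(* Near each boundary point A is the region on one side of the graph of a C^3
   function of the other coordinates, over or under one of the axes. *)
Definition C3_boundary n (A : set 'rV[R]_n) : Prop :=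
  forall p, boundary A p ->
    exists (k : 'I_n) (b : bool) (r : R) (g : 'rV[R]_n.-1 -> R),
      [/\ 0 < r, Ck 3 g &
          forall x, eball p r x ->
            (A x <-> 0 < (-1) ^+ b * (x 0 k - g (col' k x)))].

End geometric_measure_theory.

Section phase_field.
Variables (R : realType) (d : nat).
Implicit Types (eps t s : R) (x y : 'rV[R]_d).
Implicit Types (u : 'rV[R]_d -> R) (phi : R -> 'rV[R]_d -> R).

Definition W (s : R) : R := (1 - s ^+ 2) ^+ 2 / 2.

Definition sigma : R :=
  \int[lebesgue_measure]_(s in `[-1, 1]) Num.sqrt (2 * W s).

Definition tanh (r : R) : R :=
  (expR r - expR (- r)) / (expR r + expR (- r)).

Definition profile eps (r : R) : R := tanh (r / eps).

(* U0 and M0 in the density bound are not extended periodically: for a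
   periodic M0 the ratio is unbounded as r grows. *)
Definition initial_set (U0 : set 'rV[R]_d) (D0 : R) (U : (set 'rV[R]_d)^nat) :
    Prop :=
  [/\ [/\ open U0, compact (closure U0) & closure U0 `<=` open_cube],
      0 < D0,
      forall x (r : R), 0 < r ->
        (hausdorff d.-1 (boundary U0 `&` eball x r) *
          ((unit_ball_vol R d.-1 * r ^+ d.-1)^-1)%:E <= D0%:E)%E,
      forall i, [/\ open (U i), U i `<=` open_cube & C3_boundary (U i)] &
      (fun i => leb R d ((U0 `\` U i) `|` (U i `\` U0))) @ \oo --> 0%E /\
      total_variation_cvg (fun i => periodic_ext (U i)) (periodic_ext U0)].

(* Here U and M are the periodic extensions of the approximating set and of
   its boundary. *)
Definition signed_dist (U M : set 'rV[R]_d) x : R :=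
  if `[< U x >] then dist_to x M else - dist_to x M.

Definition scale_sequence (eps : nat -> R) : Prop :=
  [/\ forall i, 0 < eps i < 1,
      nonincreasing_seq eps &
      eps @ \oo --> (0 : R)].

(* rbar is a smoothing of the signed distance to the boundary of U; the bound
   on its Hessian is in operator norm. It is only C^2, since it has to agree
   with the signed distance to a C^3 hypersurface near that hypersurface. *)
Definition smoothed_dist (U : set 'rV[R]_d) eps (rbar : 'rV[R]_d -> R) : Prop :=
  [/\ Ck 2 rbar /\ periodic rbar,
      forall x, enorm (grad rbar x) <= 1,
      forall x v, enorm (v *m hessian rbar x) <= eps^-1 * enorm v &
      exists N : set 'rV[R]_d,
        [/\ open N, periodic_ext (boundary U) `<=` N &
            forall x, N x -> rbar x =
              signed_dist (periodic_ext U) (periodic_ext (boundary U)) x]].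

Definition lambda eps u : R :=
  (- \int[leb R d]_(x in torus)
       (Num.sqrt (2 * W (u x)) * (eps * laplacian u x - derive1 W (u x) / eps))) /
  (2 * \int[leb R d]_(x in torus) W (u x)).

(* Classical regularity: C^{2,1} for t > 0, and C^1 in space up to t = 0. *)
Definition classical_regularity phi : Prop :=
  let closed_halfspace := [set p : R * 'rV[R]_d | 0 <= p.1] in
  let open_halfspace := [set p : R * 'rV[R]_d | 0 < p.1] in
  [/\ {within closed_halfspace, continuous (fun p => phi p.1 p.2)},
      forall i,
        (forall t x, 0 <= t -> derivable (phi t) x (delta_mx 0 i)) /\
        {within closed_halfspace,
          continuous (fun p => partial i (phi p.1) p.2)},
      forall i j,
        (forall t x, 0 < t ->
          derivable (partial j (phi t)) x (delta_mx 0 i)) /\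
        {within open_halfspace,
          continuous (fun p => partial i (partial j (phi p.1)) p.2)} &
      (forall t x, 0 < t -> derivable (fun r => phi r x) t 1) /\
      {within open_halfspace,
        continuous (fun p => derive1 (fun r => phi r p.2) p.1)}].

Definition allen_cahn_solution eps (u0 : 'rV[R]_d -> R) phi : Prop :=
  [/\ classical_regularity phi,
      forall t, 0 <= t -> periodic (phi t),
      forall x, phi 0 x = u0 x &
      forall t x, 0 < t ->
        eps * derive1 (fun r => phi r x) t =
          eps * laplacian (phi t) x - derive1 W (phi t x) / eps
          + lambda eps (phi t) * Num.sqrt (2 * W (phi t x))].

Definition energy_measure eps u (A : set 'rV[R]_d) : \bar R :=
  ((sigma^-1)%:E * \int[leb R d]_(x in A)
     (eps * enorm (grad u x) ^+ 2 / 2 + W (u x) / eps)%:E)%E.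

Definition is_cutoff (eta : 'rV[R]_d -> R) : Prop :=
  [/\ smooth eta,
      compact (tsupport eta) /\ tsupport eta `<=` eball 0 2^-1,
      forall x y, enorm x = enorm y -> eta x = eta y,
      forall x, eball 0 4^-1 x -> eta x = 1 &
      forall x, 0 <= eta x <= 1].

Definition heat_kernel (eta : 'rV[R]_d -> R) y s x t : R :=
  ((4 * pi * (s - t)) `^ ((d%:R - 1) / 2))^-1 *
  expR (- (enorm (x - y) ^+ 2 / (4 * (s - t)))) * eta (x - y).

End phase_field.

(* Main.v *)
Require Import Defs.
From HB Require Import structures.
From mathcomp Require Import all_boot all_order all_algebra.
From mathcomp Require Import all_classical all_reals all_analysis.
From mathcomp Require Import measurable_realfun ring lra.

Set Implicit Arguments.
Unset Strict Implicit.
Unset Printing Implicit Defensive.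

Import Order.TTheory GRing.Theory Num.Theory.
Import numFieldNormedType.Exports.

Local Open Scope classical_set_scope.
Local Open Scope ring_scope.

(* Write [u = tanh (r / eps)] and let [e] be the energy density. The inequality
   [eps |grad u|^2 <= (1 - u^2)^2 / eps] says that [r(t, .)] is 1-Lipschitz. This holds at
   [t = 0] and is propagated by doubling variables: [lambda] depends on time only, so it
   cancels from the equation of [r(t, x) - r(t, y)]. The bound [|u| < 1] needed to define [r]
   cannot be lost, since at the first time of failure the Lipschitz bound would force
   [u = 1] or [u = -1] everywhere, whereas the integral of [u - u^3 / 3] is conserved.

   The energy [int rho e] is differentiated through difference quotients, as only two space
   derivatives of [u] are available. After subtracting an exact divergence and completing a
   square in [u_t], its derivative is at most [lambda^2 / 2 int rho e], plus a multiple of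
   [eps |grad u|^2 - (1 - u^2)^2 / eps <= 0], plus terms containing derivatives of the cut-off.
   These live where [1/4 <= |x - y| < 1/2], where the Gaussian is at most a constant times
   [exp (- 1 / (128 (s - t)))]. Gronwall's inequality is applied on [[a, t2]] with [a -> t1],
   because [lambda] is only known to be continuous for [t > 0]. *)

(** * Directional derivatives and pointwise continuity *)

(** The power (d - 1) / 2 in the kernel is one half short of that of the d-dimensional heat kernel.
    When its time derivative meets the Hessian terms of the subtracted divergence, the dimensional
    terms cancel up to - rho / (2 (s - t)) times (1 - u^2)^2 / (2 eps) - eps |grad u|^2 / 2; this is
    why the sign of that quantity is needed at every point. Completing the square costs lambda^2 (1
    - u^2)^2 / (4 eps), which is part of lambda^2 / 2 times the energy density. The square also
    produces |grad eta|^2 / eta. Since eta is nonnegative with bounded second derivatives, |grad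
    eta|^2 is at most a constant times eta, so this quotient stays bounded where the cut-off is
    small. At distance 1/4 the Gaussian exponent is 1 / (64 (s - t)). One half of it absorbs all
    powers of 1 / (s - t), the other half is the 1 / (128 (s - t)) of the statement. What remains is
    proportional to the energy density with factors that involve only the dimension and eta, so the
    constant can be fixed before eps and the solution. *)

Section directional.
Variables (R : realType) (V : normedModType R).
Implicit Types (f : V -> R) (x v : V).

(** Both difference quotients are the same function of the increment, so one-variable calculus along
    a line transfers to directional derivatives. *)
Lemma derivable_line f x v t :
  derivable f (x + t *: v) v <-> derivable (fun h : R => f (x + h *: v)) t 1.
Proof.
rewrite /derivable; split; (set F := (X in cvg (X @ _)); set G := (X in _ -> cvg (X @ _)));
  suff -> : F = G by [].
all: by apply/funext => h; rewrite /F /G /= addrCA -scalerDl [_%:A]mulr1.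
Qed.

Lemma derive_line f x v t :
  'D_v f (x + t *: v) = 'D_1 (fun h : R => f (x + h *: v)) t.
Proof.
rewrite /derive; set F := (X in lim (X @ _)); set G := (X in _ = lim (X @ _)).
suff -> : F = G by [].
by apply/funext => h; rewrite /F /G /= addrCA -scalerDl [_%:A]mulr1.
Qed.

Lemma is_derive_line f x v t df :
  is_derive (x + t *: v) v f df <-> is_derive t 1 (fun h : R => f (x + h *: v)) df.
Proof.
split=> -[d e]; split.
- exact/derivable_line.
- by rewrite -derive_line.
- exact/derivable_line.
- by rewrite derive_line.
Qed.

Lemma is_derive_line0 f x v df :
  is_derive x v f df <-> is_derive (0 : R) 1 (fun h : R => f (x + h *: v)) df.
Proof. by rewrite -is_derive_line scale0r addr0. Qed.

Lemma is_derive_chain f (g : R -> R) x v df dg :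
  is_derive x v f df -> is_derive (f x) 1 g dg ->
  is_derive x v (fun y => g (f y)) (dg * df).
Proof.
move=> /is_derive_line0 Df Dg; apply/is_derive_line0.
apply: (@is_derive1_comp _ g (fun h => f (x + h *: v))) => //.
by rewrite scale0r addr0.
Qed.

End directional.

Section pointwise_continuity.
Variables (R : realType) (T : topologicalType).
Implicit Types (f g : T -> R) (x : T).

Lemma continuous_cstf (c : R) x : {for x, continuous (fun _ : T => c)}.
Proof. exact: cst_continuous. Qed.

Lemma continuous_addf f g x : {for x, continuous f} -> {for x, continuous g} ->
  {for x, continuous (fun z => f z + g z)}.
Proof. by move=> cf cg; exact: continuousD. Qed.

Lemma continuous_oppf f x : {for x, continuous f} -> {for x, continuous (fun z => - f z)}.
Proof. by move=> cf; exact: continuousN. Qed.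

Lemma continuous_mulf f g x : {for x, continuous f} -> {for x, continuous g} ->
  {for x, continuous (fun z => f z * g z)}.
Proof. by move=> cf cg; exact: continuousM. Qed.

Lemma continuous_invf f x : f x != 0 -> {for x, continuous f} ->
  {for x, continuous (fun z => (f z)^-1)}.
Proof. by move=> fx0 cf; exact: cvgV. Qed.

Lemma continuous_sqrf f x : {for x, continuous f} -> {for x, continuous (fun z => f z ^+ 2)}.
Proof.
move=> cf; rewrite (_ : (fun z => _) = fun z => f z * f z); first exact: continuous_mulf.
by apply/funext => z; rewrite expr2.
Qed.

Lemma continuous_sumf (I : Type) (s : seq I) (F : I -> T -> R) x :
  (forall i, {for x, continuous (F i)}) -> {for x, continuous (fun z => \sum_(i <- s) F i z)}.
Proof.
move=> cF; elim: s => [|i s IHs].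
  rewrite (_ : (fun z => _) = fun=> 0); first exact: continuous_cstf.
  by apply/funext => z; rewrite big_nil.
rewrite (_ : (fun z => _) = fun z => F i z + \sum_(j <- s) F j z); last first.
  by apply/funext => z; rewrite big_cons.
exact: continuous_addf.
Qed.

Lemma continuous_at_points f : (forall x, {for x, continuous f}) -> continuous f.
Proof. by []. Qed.

End pointwise_continuity.

(** Follows the syntax of the function body, closes constants, and leaves the remaining leaves to
    the caller in their order of occurrence. Inverses of non-constant functions count as leaves,
    since they need a nonvanishing argument. *)
Ltac prove_continuous :=
  repeat lazymatch goal with
  | |- prop_for _ (inPhantom (forall x, continuous_at x ?F)) =>
    lazymatch F with
    | (fun _ => ?c) => exact: (@continuous_cstf _ _ c _)
    | (fun z => @?f z + @?g z) => apply: (@continuous_addf _ _ f g)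
    | (fun z => - @?f z) => apply: (@continuous_oppf _ _ f)
    | (fun z => @?f z * @?g z) => apply: (@continuous_mulf _ _ f g)
    | (fun z => @?f z ^+ 2) => apply: (@continuous_sqrf _ _ f)
    | (fun z => bigop.body _ _ _) => apply: continuous_sumf => ?
    end
  end.

Section pointwise_rules.
Variables (R : realType) (V : normedModType R).
Implicit Types (f g : V -> R) (x v : V) (df dg : R).

Lemma is_derive_addf f g x v df dg : is_derive x v f df -> is_derive x v g dg ->
  is_derive x v (fun z => f z + g z) (df + dg).
Proof. by move=> Df Dg; exact: is_deriveD. Qed.

Lemma is_derive_subf f g x v df dg : is_derive x v f df -> is_derive x v g dg ->
  is_derive x v (fun z => f z - g z) (df - dg).
Proof. by move=> Df Dg; exact: is_deriveB. Qed.

Lemma is_derive_oppf f x v df : is_derive x v f df ->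
  is_derive x v (fun z => - f z) (- df).
Proof. by move=> Df; exact: is_deriveN. Qed.

Lemma is_derive_mulf f g x v df dg : is_derive x v f df -> is_derive x v g dg ->
  is_derive x v (fun z => f z * g z) (df * g x + f x * dg).
Proof.
move=> Df Dg; rewrite addrC [df * _]mulrC; exact: is_deriveM.
Qed.

Lemma is_derive_cmulf (c : R) f x v df : is_derive x v f df ->
  is_derive x v (fun z => c * f z) (c * df).
Proof. by move=> Df; exact: is_deriveZ. Qed.

Lemma is_derive_sqrf f x v df : is_derive x v f df ->
  is_derive x v (fun z => f z ^+ 2) (2 * f x * df).
Proof.
move=> Df; rewrite (_ : (fun z => _) = fun z => f z * f z); last first.
  by apply/funext => z; rewrite expr2.
by rewrite (_ : _ * df = df * f x + f x * df); [exact: is_derive_mulf|ring].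
Qed.

Lemma is_derive_invf f x v df : f x != 0 -> is_derive x v f df ->
  is_derive x v (fun z => (f z)^-1) (- df / f x ^+ 2).
Proof.
move=> fx0 [d e]; split; first exact: derivableV.
by rewrite deriveV// e /GRing.scale /= mulNr mulNr mulrC.
Qed.

Lemma is_derive_sumf (I : Type) (s : seq I) (F : I -> V -> R) x v (dF : I -> R) :
  (forall i, is_derive x v (F i) (dF i)) ->
  is_derive x v (fun z => \sum_(i <- s) F i z) (\sum_(i <- s) dF i).
Proof.
move=> H; elim: s => [|i s IHs].
  rewrite big_nil (_ : (fun z => _) = cst 0); first exact: is_derive_cst.
  by apply/funext => z; rewrite big_nil.
rewrite big_cons (_ : (fun z => _) = fun z => F i z + \sum_(j <- s) F j z).
  exact: is_derive_addf.
by apply/funext => z; rewrite big_cons.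
Qed.

End pointwise_rules.

Section one_variable.
Variable R : realType.

(** Allowing either order of the endpoints treats both sides of a base time at once in the
    difference quotients. *)
Lemma MVT_between (g g' : R -> R) (a b : R) :
  (forall t, Num.min a b <= t <= Num.max a b -> is_derive t 1 g (g' t)) ->
  exists c, Num.min a b <= c <= Num.max a b /\ g b - g a = g' c * (b - a).
Proof.
have base (u v : R) : u <= v -> (forall t, u <= t <= v -> is_derive t 1 g (g' t)) ->
    exists c, u <= c <= v /\ g v - g u = g' c * (v - u).
  move=> uv dg.
  have [||c cI e] := @MVT_segment _ g g' u v uv.
  - by move=> t /subset_itv_oo_cc; rewrite in_itv; exact: dg.
  - apply: derivable_within_continuous => t; rewrite in_itv /= => tI.
    by have [] := dg t tI.
  by exists c; rewrite in_itv in cI.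
case: (leP a b) => ab dg.
  by have [c ?] := base a b ab dg; exists c.
have [c [cI e]] := base b a (ltW ab) dg; exists c; split=> //.
by rewrite -opprB e -mulrN opprB.
Qed.

Lemma MVT0 (g g' : R -> R) (s : R) : (forall t : R, is_derive t 1 g (g' t)) ->
  exists c, `|c| <= `|s| /\ g s - g 0 = g' c * s.
Proof.
move=> dg; have [c [/andP[c1 c2] e]] := @MVT_between g g' 0 s (fun t _ => dg t).
exists c; rewrite subr0 in e; split=> //.
rewrite ler_norml; apply/andP; split.
  by apply: le_trans c1; rewrite le_min oppr_le0 normr_ge0 /= lerNl ler_normr lexx orbT.
by apply: le_trans c2 _; rewrite ge_max normr_ge0 /= ler_normr lexx.
Qed.

(** If [c] were positive, [g'] would vanish at 0 and be positive just to the right of it, and the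
    mean value theorem would lift [g] above its maximum. *)
Lemma second_derivative_at_max (g g' : R -> R) (c : R) :
  (forall t : R, is_derive t 1 g (g' t)) -> is_derive (0 : R) 1 g' c ->
  (forall t, g t <= g 0) -> g' 0 = 0 /\ c <= 0.
Proof.
move=> dg dg' gmax.
have g'0 : g' 0 = 0.
  have d0 : is_derive (0 : R) 1 g 0.
    apply: (@derive1_at_max _ g (-1) 1 0).
    - by lra.
    - by move=> t _; have [] := dg t.
    - by rewrite in_itv /=; apply/andP; split; lra.
    - by move=> t _; exact: gmax.
  by have [_ <-] := dg 0; have [_ ->] := d0.
split=> //; rewrite leNgt; apply/negP => c0.
have [/cvg_ex[/= l Hl] e] := dg'.
have lc : l = c by rewrite -e; apply/esym/cvg_lim.
rewrite {}lc in Hl.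
move/cvgrPdist_lt : Hl => /(_ _ c0) -[r /= r0 Hr].
have [||k kr e2] := @MVT _ g g' 0 (r/2) _ (fun t _ => dg t).
- by rewrite divr_gt0.
- by apply: derivable_within_continuous => t _; have [] := dg t.
move: kr; rewrite in_itv /= => /andP[k0 kr].
have := Hr k; rewrite /ball_ /= sub0r normrN gtr0_norm// gt_eqF// => Hk.
have {}Hk : `|c - k^-1 *: (g' (k%:A + 0) - g' 0)| < c by apply: Hk => //; lra.
move: Hk; rewrite addr0 g'0 subr0 [k%:A]mulr1 => Hk.
have g'k : 0 < g' k.
  have : 0 < k^-1 * g' k by move: Hk; rewrite ltr_norml => /andP[_]; rewrite /GRing.scale /=; lra.
  by rewrite pmulr_rgt0// invr_gt0.
have : 0 < g (r / 2) - g 0 by rewrite e2 subr0 mulr_gt0// divr_gt0.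
by rewrite subr_gt0 ltNge gmax.
Qed.

(** Only earlier times are compared, so the lemma applies when the maximum sits at the end of a time
    interval. *)
Lemma left_derivative_at_max (g : R -> R) (a t0 c : R) : a < t0 -> is_derive t0 1 g c ->
  (forall t, a <= t <= t0 -> g t <= g t0) -> 0 <= c.
Proof.
move=> at0 [/cvg_ex[/= l Hl] e] gmax.
have lc : l = c by rewrite -e; apply/esym/cvg_lim.
rewrite {}lc in Hl; rewrite leNgt; apply/negP => c0.
move/cvgrPdist_lt : Hl => /(_ (- c)); rewrite oppr_gt0 => /(_ c0) -[r /= r0 Hr].
pose h := Num.min (r / 2) (t0 - a).
have h0 : 0 < h by rewrite lt_min divr_gt0//= subr_gt0.
have hr : h <= r / 2 by rewrite ge_min lexx.
have ha : h <= t0 - a by rewrite ge_min lexx orbT.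
have := Hr (- h); rewrite /ball_ /= sub0r opprK gtr0_norm// oppr_eq0 gt_eqF// => Hh.
have {}Hh : `|c - (- h)^-1 *: (g ((- h)%:A + t0) - g t0)| < - c by apply: Hh => //; lra.
move: Hh; rewrite [_%:A]mulr1 /GRing.scale /= ltr_norml => /andP[Hh _].
have : (- h)^-1 * (g (- h + t0) - g t0) < 0 by lra.
rewrite invrN mulNr oppr_lt0 pmulr_rgt0 ?invr_gt0// subr_gt0 ltNge gmax//.
by apply/andP; split; lra.
Qed.

(** Two applications of the mean value theorem bound [g h] by g(0) + g'(0) h + M h^2. At the
    minimizing [h] this parabola equals g(0) - g'(0)^2 / (4 M), which nonnegativity of [g] keeps
    above 0. *)
Lemma nonneg_gradient_bound (g g' g'' : R -> R) (M : R) : 0 < M ->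
  (forall t : R, is_derive t 1 g (g' t)) -> (forall t : R, is_derive t 1 g' (g'' t)) ->
  (forall t : R, `|g'' t| <= M) -> (forall t, 0 <= g t) ->
  g' 0 ^+ 2 <= 4 * M * g 0.
Proof.
move=> M0 dg dg' bg g0.
have [h hE] : exists h, h = - g' 0 / (2 * M) by eexists.
have [c [ch e]] := MVT0 h dg.
have [k [kc e']] := MVT0 c dg'.
have : g h <= g 0 + g' 0 * h + M * h ^+ 2.
  have -> : g h = g 0 + g' 0 * h + g'' k * c * h.
    by rewrite -[LHS](subrK (g 0)) e -e'; ring.
  rewrite lerD2l (le_trans (ler_norm _))// !normrM -(real_normK (num_real h)) expr2.
  by rewrite mulrA ler_wpM2r// ler_pM.
move=> H; have := le_trans (g0 h) H.
have -> : g 0 + g' 0 * h + M * h ^+ 2 = g 0 - g' 0 ^+ 2 / (4 * M).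
  by rewrite hE; field; rewrite gt_eqF.
by rewrite subr_ge0 ler_pdivrMr ?mulr_gt0// mulrC.
Qed.

End one_variable.

Lemma scale_invK {R : fieldType} (h p c : R) : h != 0 ->
  h^-1 *: (p * (h * c) : R^o) = c * p.
Proof. by move=> h0; rewrite /GRing.scale /=; field. Qed.

Lemma close_to_common_value {R : realFieldType} (A B c r : R) :
  `|A - c| < r / 2 -> `|B - c| < r / 2 -> `|A - B| < r.
Proof.
rewrite !ltr_norml => /andP[a1 a2] /andP[b1 b2].
by apply/andP; split; lra.
Qed.

Section coordinates.
Variables (R : realType) (n : nat).
Implicit Types (f : 'rV[R]_n -> R) (x v : 'rV[R]_n).
Local Notation e_ i := (@delta_mx R 1 n 0 i).

Lemma is_derive_partial f x i : derivable f x (e_ i) ->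
  is_derive x (e_ i) f (partial i f x).
Proof. by move=> ?; split. Qed.

Lemma is_derive_line_partial f x i : (forall z : 'rV[R]_n, derivable f z (e_ i)) ->
  forall t : R, is_derive t 1 (fun s : R => f (x + s *: e_ i)) (partial i f (x + t *: e_ i)).
Proof.
move=> df t; apply: (iffLR (is_derive_line f x (e_ i) t _)).
by apply: is_derive_partial; exact: df.
Qed.

(** The increment is split into a move along [u] and a move along one coordinate. The mean value
    theorem and continuity of the partial derivative handle the second move. Adding the coordinates
    one at a time gives the chain rule for C^1 functions. *)
Lemma is_derive_step f x u (c du : R) i :
  is_derive x u f du -> (forall z : 'rV[R]_n, derivable f z (e_ i)) ->
  {for x, continuous (partial i f)} ->
  is_derive x (u + c *: e_ i) f (du + c * partial i f x).
Proof.
move=> [/cvg_ex[/= l Hl] e] df cf.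
have lc : l = du by rewrite -e; apply/esym/cvg_lim.
rewrite {}lc {e} in Hl.
suff H : h^-1 *: (f (h *: (u + c *: e_ i) + x) - f x) @[h --> (0:R)^'] --> du + c * partial i f x.
  split; first by apply/cvg_ex; eexists; exact: H.
  by apply/cvg_lim.
have -> : (fun h : R => h^-1 *: (f (h *: (u + c *: e_ i) + x) - f x)) =
  (fun h => h^-1 *: (f (h *: u + x) - f x)) \+
  (fun h => h^-1 *: (f (h *: u + x + (h * c) *: e_ i) - f (h *: u + x))).
  apply/funext => h /=; rewrite -scalerDr; congr (_ *: _).
  by rewrite scalerDr scalerA [X in f X - _]addrAC [RHS]addrC addrA subrK.
apply: cvgD => //.
apply/cvgrPdist_lt => r r0.
pose r' := r / (`|c| + 1).
have c1 : 0 < `|c| + 1 by rewrite ltr_wpDl.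
have r'0 : 0 < r' by rewrite divr_gt0.
move/cvgrPdist_lt : cf => /(_ _ r'0) /nbhs_ballP[d /= d0 Hd].
pose K := `|u| + `|c| * `|e_ i| + 1.
have K0 : 0 < K by rewrite ltr_wpDl// addr_ge0// mulr_ge0.
near=> h.
have h0 : h != 0 by near: h; exact: nbhs_dnbhs_neq.
have hK : `|h| * K < d.
  rewrite -ltr_pdivlMr//; near: h; apply: dnbhs0_lt; exact: divr_gt0.
have dline (t : R) : is_derive t 1 (fun s : R => f ((h *: u + x) + s *: e_ i))
    (partial i f ((h *: u + x) + t *: e_ i)).
  exact: is_derive_line_partial.
have [t [tb]] := MVT0 (h * c) dline.
rewrite scale0r addr0 => ->.
rewrite scale_invK// -mulrBr normrM.
have : `|partial i f x - partial i f (h *: u + x + t *: e_ i)| < r'.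
  apply: Hd; rewrite -ball_normE /ball_ /=.
  rewrite addrAC opprD addrCA subrr addr0 normrN.
  apply: le_lt_trans hK; rewrite (le_trans (ler_normD _ _))// !normrZ /K.
  rewrite mulrDr mulrDr mulr1 -addrA lerD2l ler_wpDr// mulrA -normrM ler_wpM2r//.
move=> H; apply: le_lt_trans (_ : `|c| * r' < r).
  by rewrite ler_wpM2l// ltW.
rewrite /r' mulrCA -[ltRHS]mulr1 ltr_pM2l// ltr_pdivrMr// mul1r ltrDl//.
Unshelve. all: by end_near. Qed.

Lemma C1_is_derive f x v :
  (forall i (z : 'rV[R]_n), derivable f z (e_ i)) -> (forall i, continuous (partial i f)) ->
  is_derive x v f (\sum_i v 0 i * partial i f x).
Proof.
move=> df cf; rewrite {1}[v]row_sum_delta.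
elim: (index_enum _) => [|j s IHs].
  by rewrite !big_nil; exact: is_derive0.
rewrite !big_cons addrC [X in is_derive _ _ _ X]addrC.
by apply: is_derive_step => //; exact: cf.
Qed.

Lemma second_difference f x i j (h : R) :
  (forall z : 'rV[R]_n, derivable f z (e_ i)) ->
  (forall z : 'rV[R]_n, derivable (partial i f) z (e_ j)) ->
  exists z, `|z - x| <= `|h| * (`|e_ i| + `|e_ j|) /\
    f (x + h *: e_ i + h *: e_ j) - f (x + h *: e_ i) - f (x + h *: e_ j) + f x =
    partial j (partial i f) z * h ^+ 2.
Proof.
move=> df ddf.
have dG (t : R) : is_derive t 1
  (fun s : R => f (x + h *: e_ j + s *: e_ i) - f (x + s *: e_ i))
  (partial i f (x + h *: e_ j + t *: e_ i) - partial i f (x + t *: e_ i)).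
  by apply: is_deriveB; exact: is_derive_line_partial.
have [t [th]] := MVT0 h dG; rewrite scale0r !addr0 => e.
have dH := is_derive_line_partial (x + t *: e_ i) ddf.
have [s [sh]] := MVT0 h dH; rewrite scale0r addr0 => e'.
exists (x + t *: e_ i + s *: e_ j); split.
  rewrite -(addrA x) addrAC subrr add0r (le_trans (ler_normD _ _))// !normrZ mulrDr.
  by rewrite lerD// ler_wpM2r.
rewrite expr2 mulrA -e' addrAC [in RHS]addrAC -e.
rewrite [x + h *: e_ i + h *: e_ j]addrAC.
by rewrite opprB addrA addrAC -!addrA; congr (_ + _); rewrite addrCA.
Qed.

(** The second difference with equal steps is symmetric in the two directions, so it is h^2 times
    either mixed derivative, each at some point within a multiple of h of [x]. Continuity moves both
    points to [x]. *)
Lemma partial_comm f x i j :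
  (forall (z : 'rV[R]_n) k, derivable f z (e_ k)) ->
  (forall (z : 'rV[R]_n) k l, derivable (partial l f) z (e_ k)) ->
  (forall k l, continuous (partial k (partial l f))) ->
  partial i (partial j f) x = partial j (partial i f) x.
Proof.
move=> df ddf cf; apply/eqP; rewrite -subr_eq0 -normr_le0; apply/ler_addgt0Pl => r r0.
rewrite addr0.
have r2 : 0 < r / 2 by rewrite divr_gt0.
move/cvgrPdist_lt : (cf i j x) => /(_ _ r2) /nbhs_ballP[d1 /= d10 Hd1].
move/cvgrPdist_lt : (cf j i x) => /(_ _ r2) /nbhs_ballP[d2 /= d20 Hd2].
pose d := Num.min d1 d2.
have d0 : 0 < d by rewrite lt_min d10.
pose K := `|e_ i| + `|e_ j| + 1.
have K0 : 0 < K by rewrite ltr_wpDl// addr_ge0.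
pose h := d / (2 * K).
have h0 : 0 < h by rewrite divr_gt0// mulr_gt0.
have hK : `|h| * (`|e_ i| + `|e_ j|) < d.
  apply: le_lt_trans (_ : h * K < d).
    by rewrite gtr0_norm// ler_wpM2l ?ltW// ltrDl.
  have -> : h * K = d / 2 by rewrite /h; field; rewrite gt_eqF.
  lra.
have [z [zb ez]] := second_difference x h (df^~ i) (ddf^~ j^~ i).
have [w [wb ew]] := second_difference x h (df^~ j) (ddf^~ i^~ j).
have E := addrAC x (h *: e_ i) (h *: e_ j).
rewrite E in ez.
have : partial j (partial i f) z = partial i (partial j f) w.
  apply: (@mulIf _ (h ^+ 2)); first by rewrite expf_neq0// gt_eqF.
  apply: (etrans (esym ez)); apply: (etrans _ ew).
  apply: (congr1 (fun r => r + f x)); exact: addrAC.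
have Hz : `|partial j (partial i f) x - partial j (partial i f) z| < r / 2.
  apply: Hd2; rewrite -ball_normE /ball_ /= distrC (le_lt_trans zb)//.
  by rewrite (lt_le_trans hK)// ge_min lexx orbT.
have Hw : `|partial i (partial j f) x - partial i (partial j f) w| < r / 2.
  apply: Hd1; rewrite -ball_normE /ball_ /= distrC (le_lt_trans wb)//.
  by rewrite addrC (lt_le_trans hK)// ge_min lexx.
move=> ee; rewrite ee in Hz.
exact/ltW/(close_to_common_value Hw Hz).
Qed.

Lemma gradient_bound f x i (M : R) : 0 < M ->
  (forall z : 'rV[R]_n, derivable f z (e_ i)) -> (forall z : 'rV[R]_n, derivable (partial i f) z (e_ i)) ->
  (forall z, `|partial i (partial i f) z| <= M) -> (forall z, 0 <= f z) ->
  partial i f x ^+ 2 <= 4 * M * f x.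
Proof.
move=> M0 df ddf bf f0.
have := nonneg_gradient_bound M0 (is_derive_line_partial x df)
  (is_derive_line_partial x ddf).
by rewrite scale0r !addr0; apply.
Qed.

Lemma partial_at_max f x i :
  (forall z : 'rV[R]_n, derivable f z (e_ i)) -> derivable (partial i f) x (e_ i) ->
  (forall z, f z <= f x) -> partial i f x = 0 /\ partial i (partial i f) x <= 0.
Proof.
move=> df ddf fmax.
have := second_derivative_at_max (is_derive_line_partial x df).
rewrite scale0r addr0; apply; last by move=> t; exact: fmax.
apply: (iffLR (is_derive_line0 _ _ _ _)).
exact: is_derive_partial.
Qed.

End coordinates.

Lemma cvg_uncurry {T : Type} {U V W : topologicalType} (F : set_system T)
  {FF : Filter F} (f : T -> U) (g : T -> V) (h : U * V -> W) a b :
  f @ F --> a -> g @ F --> b -> {for (a, b), continuous h} ->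
  h (f x, g x) @[x --> F] --> h (a, b).
Proof. by move=> fa gb; apply: cvg_comp; exact: cvg_pair. Qed.

Section difference_quotient.
Variables (R : realType) (V : normedModType R) (u : R -> V -> R) (a b : R).
Hypothesis cu : forall t x, a < t < b -> {for (t, x), continuous (fun p : R * V => u p.1 p.2)}.
Hypothesis du : forall t x, a < t < b -> derivable (u^~ x) t 1.
Hypothesis cdu : forall t x, a < t < b ->
  {for (t, x), continuous (fun p : R * V => derive1 (u^~ p.2) p.1)}.

(** The value at [t0] is filled in so that the increment of [u] is t - t0 times a function that is
    jointly continuous in time and space. *)
Definition diff_quotient (t0 t : R) (x : V) : R :=
  if t == t0 then derive1 (u^~ x) t0 else (u t x - u t0 x) / (t - t0).

Lemma diff_quotientE t0 t x : (t - t0) * diff_quotient t0 t x = u t x - u t0 x.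
Proof.
rewrite /diff_quotient; case: eqP => [->|/eqP tt0]; first by rewrite !subrr mul0r.
by rewrite mulrC divfK// subr_eq0.
Qed.

(** Near [t0] the mean value theorem replaces the quotient by the time derivative at an intermediate
    time, where joint continuity of that derivative applies; away from [t0] it is an ordinary
    quotient. *)
Lemma continuous_diff_quotient t0 t x : a < t0 < b -> a < t < b ->
  {for (t, x), continuous (fun p : R * V => diff_quotient t0 p.1 p.2)}.
Proof.
move=> t0I tI.
have [->|tt0] := eqVneq t t0.
  move/cvgrPdist_lt : (@cdu t0 x t0I) => H.
  apply/cvgrPdist_lt => r r0; have := H _ r0 => -[[/= A B] [[d /= d0 HA] HB] HAB].
  pose d' := Num.min d (Num.min (t0 - a) (b - t0)).
  have [ta tb] := andP t0I.
  have d'0 : 0 < d' by rewrite !lt_min d0 !subr_gt0 ta tb.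
  exists (ball t0 d', B); first by split => //=; exact: nbhsx_ballx.
  move=> [s z] /= [sb Bz].
  rewrite /diff_quotient eqxx; have [_|st0] := eqVneq s t0.
    by apply: (HAB (t0, z)); split => //=; apply: HA; rewrite /ball_/= subrr normr0.
  move: sb; rewrite -ball_normE /ball_ /= !lt_min => /and3P[sd sa sb].
  have inI c : Num.min t0 s <= c <= Num.max t0 s -> (a < c < b) /\ `|t0 - c| < d.
    move: sd sa sb; rewrite !ltr_norml; case: (leP t0 s) => ? ? ? ? ?; split; last apply/andP; lra.
  have [|c [cI ->]] := @MVT_between _ (u^~ z) (derive1 (u^~ z)) t0 s.
    by move=> c /inI[cI _]; rewrite derive1E; apply: derivableP; exact: du.
  rewrite mulfK ?subr_eq0//; apply: (HAB (c, z)); split => //=; apply: HA.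
  by have [] := inI c cI.
have H : {near (t, x), (fun p : R * V => (u p.1 p.2 - u t0 p.2) / (p.1 - t0)) =1
    (fun p : R * V => diff_quotient t0 p.1 p.2)}.
  exists ([set s | s != t0], setT) => /=.
    by split; [exact: open_nbhs_nbhs|exact: filterT].
  by move=> [s z] /= [st0 _]; rewrite /diff_quotient (negbTE st0).
have E : diff_quotient t0 t x = (u t x - u t0 x) / (t - t0).
  by rewrite /diff_quotient (negbTE tt0).
change ((fun p : R * V => diff_quotient t0 p.1 p.2) p @[p --> (t, x)] --> diff_quotient t0 t x).
rewrite E; apply: cvg_trans (near_eq_cvg H) _.
apply: cvgM; first apply: cvgB.
- exact: (@cu t x tI).
- apply: (cvg_uncurry (h := fun p => u p.1 p.2) (cvg_cst t0) cvg_snd).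
  exact: (@cu t0 x t0I).
- apply: cvgV; first by rewrite subr_eq0.
  by apply: cvgB; [exact: cvg_fst|exact: cvg_cst].
Qed.

End difference_quotient.

(** * Lebesgue measure on row vectors *)

Section borel_rV.
Variables (R : realType) (n : nat).
Implicit Types (x : 'rV[R]_n) (q : 'rV[rat]_n).

Lemma rV_ballP x (y : 'rV[R]_n) (e : R) : 0 < e -> (forall i, `|x 0 i - y 0 i| < e) -> ball x e y.
Proof.
move=> e0 H; split=> // i j; rewrite ord1 -ball_normE /ball_ /=; exact: H.
Qed.

Let rational_box (p : 'rV[rat]_n * nat) : set 'rV[R]_n :=
  [set x | forall i, `|x 0 i - ratr (p.1 0 i)| < p.2.+1%:R^-1].

Let measurable_rational_box p : measurable (rational_box p).
Proof.
rewrite (_ : rational_box p = \bigcap_(i in [set: 'I_n])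
   (rV_coord i @^-1` `]ratr (p.1 0 i) - p.2.+1%:R^-1, ratr (p.1 0 i) + p.2.+1%:R^-1[)).
  apply: fin_bigcap_measurable => // i _.
  by rewrite -[X in measurable X]setTI; exact: measurable_rV_coord.
apply/seteqP; split=> [x Hx i _|x Hx i] /=.
  by have := Hx i; rewrite /rV_coord in_itv/= ltr_distl.
by have := Hx i Logic.I; rewrite /= /rV_coord in_itv/= ltr_distl.
Qed.

(** The sigma-algebra is generated by the coordinates, so an open set is written as the countable
    union of the boxes with rational centre and radius 1 / (k + 1) that it contains. *)
Lemma open_measurable_rV (A : set 'rV[R]_n) : open A -> measurable A.
Proof.
move=> oA.
have -> : A = \bigcup_p (if `[< rational_box p `<=` A >] then rational_box p else set0).
  apply/seteqP; split=> [x Ax|x [p _]]; last by case: asboolP => // pA; exact: pA.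
  have /nbhs_ballP[e /= e0 He] : nbhs x A by exact: open_nbhs_nbhs.
  have e2 : 0 < e / 2 by rewrite divr_gt0.
  (* The radius is below e / 2 because both [x] and an arbitrary point of the box lie within it of
     the rational centre. *)
  pose k := Num.truncn (e / 2)^-1.
  have ke : k.+1%:R^-1 < e / 2 :> R.
    rewrite -[ltRHS]invrK ltf_pV2 ?posrE ?invr_gt0//.
    exact: truncnS_gt.
  have k0 : 0 < k.+1%:R^-1 :> R by rewrite invr_gt0.
  have /choice[q Hq] : forall i, exists q : rat, `|x 0 i - ratr q| < k.+1%:R^-1.
    move=> i; have [|q] := @rat_in_itvoo R (x 0 i - k.+1%:R^-1) (x 0 i + k.+1%:R^-1); first by move: (k.+1%:R^-1) k0 => c c0; lra.
    by rewrite in_itv/= -ltr_distl distrC => ?; exists q.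
  have Bx : rational_box (\row_i q i, k) x by move=> i /=; rewrite mxE.
  exists (\row_i q i, k) => //; case: asboolP => // -[] z Bz; apply: He.
  apply: rV_ballP => // i; have := Bz i; rewrite /= mxE => zi.
  exact: close_to_common_value (lt_trans (Hq i) ke) (lt_trans zi ke).
apply: countable_bigcupT_measurable; first exact: countableP.
by move=> p; case: ifP => _ //; exact: measurable0.
Qed.

Lemma continuous_measurable_rV (f : 'rV[R]_n -> R) : continuous f ->
  measurable_fun setT f.
Proof.
move=> /continuousP cf; apply: (measurability _ (RGenOpens.measurableE R)).
move=> _ [_ [a [b ->]] <-]; rewrite setTI; apply: open_measurable_rV.
by apply: cf; exact: interval_open.
Qed.

End borel_rV.

Section lebesgue_box.
Variable R : realType.

Lemma measurable_box n (A : 'I_n -> set R) : (forall i, measurable (A i)) ->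
  measurable [set x : 'rV[R]_n | forall i, A i (x 0 i)].
Proof.
move=> mA; rewrite (_ : mkset _ = \bigcap_(i in [set: 'I_n]) (rV_coord i @^-1` A i)).
  apply: fin_bigcap_measurable => // i _.
  by rewrite -[X in measurable X]setTI; apply: measurable_rV_coord => //; exact: mA.
by apply/seteqP; split=> [x Hx i _|x Hx i]; exact: Hx.
Qed.

Lemma rV_consE0 n (p : R * 'rV[R]_n) : rV_cons p 0 ord0 = p.1.
Proof.
rewrite /rV_cons (_ : ord0 = lshift n ord0 :> 'I_(1 + n)); last exact/val_inj.
by rewrite (row_mxEl (p.1 : R)%:M) mxE eqxx mulr1n.
Qed.

Lemma rV_consES n (p : R * 'rV[R]_n) i : rV_cons p 0 (lift ord0 i) = p.2 0 i.
Proof.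
rewrite /rV_cons (_ : lift ord0 i = rshift 1 i :> 'I_(1 + n)); last exact/val_inj.
by rewrite (row_mxEr (p.1 : R)%:M).
Qed.

(** Follows the recursion of [leb]: the preimage of a box under [rV_cons] is a rectangle, whose
    product measure is known. *)
Lemma leb_box n (A : 'I_n -> set R) : (forall i, measurable (A i)) ->
  leb R n [set x | forall i, A i (x 0 i)] = (\prod_i lebesgue_measure (A i))%E.
Proof.
elim: n A => [|n IHn] A mA.
  rewrite big_ord0 /= /leb0 diracE mem_set//= => -[].
  by case.
have mB : measurable [set x : 'rV[R]_n | forall i, A (lift ord0 i) (x 0 i)].
  by apply: (measurable_box (A := fun i => A (lift ord0 i))) => i; exact: mA.
rewrite big_ord_recl -IHn// -product_measure1E//; last exact: mA.
rewrite /= /leb_step /pushforward; congr (_ _).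
apply/seteqP; split=> [p Hp|p [/= H1 H2] i].
  split=> /= [|i]; first by have := Hp ord0; rewrite rV_consE0.
  by have := Hp (lift ord0 i); rewrite rV_consES.
have [j ->|->] := unliftP ord0 i; first by rewrite rV_consES; exact: H2.
by rewrite rV_consE0.
Qed.

Definition bbox n (M : R) : set 'rV[R]_n := [set x | forall i, `|x 0 i| <= M].

Lemma bboxE n M : @bbox n M = [set x | forall i, `[- M, M]%classic (x 0 i)].
Proof.
by apply/seteqP; split=> x H i; have := H i; rewrite /= in_itv/= ler_norml.
Qed.

Lemma measurable_bbox n M : measurable (@bbox n M).
Proof.
by rewrite bboxE; apply: (measurable_box (A := fun=> `[- M, M]%classic)) => i; exact: measurable_itv.
Qed.

Lemma leb_bbox_lty n M : (leb R n (@bbox n M) < +oo)%E.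
Proof.
rewrite bboxE (leb_box (A := fun=> `[- M, M]%classic)) => [|i]; last exact: measurable_itv.
suff: (0 <= \prod_(i < n) lebesgue_measure `[(- M)%R, M]%classic < +oo)%E by case/andP.
apply: (big_ind (fun x => 0 <= x < +oo)%E) => [|x y /andP[x0 xoo] /andP[y0 yoo]|i _].
- by rewrite lee_fin ler01 ltry.
- by rewrite mule_ge0//= lte_mul_pinfty// ge0_fin_numE.
- by rewrite measure_ge0/=; apply: compact_finite_measure; exact: segment_compact.
Qed.

Lemma compact_bbox n M : compact (@bbox n M).
Proof.
by rewrite bboxE; apply: (@rV_compact _ _ (fun=> `[- M, M]%classic)) => i; exact: segment_compact.
Qed.

Section bounded_domain.
Variables (n : nat) (D : set 'rV[R]_n) (M : R).
Hypotheses (mD : measurable D) (DM : D `<=` bbox M).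

Lemma leb_bounded_lty : (leb R n D < +oo)%E.
Proof.
apply: le_lt_trans (leb_bbox_lty n M).
by apply: le_measure; rewrite ?inE//; exact: measurable_bbox.
Qed.

Lemma integrable_bounded_domain (f : 'rV[R]_n -> R) : continuous f ->
  (leb R n).-integrable D (EFin \o f).
Proof.
move=> cf; apply: measurable_bounded_integrable => //.
- exact: leb_bounded_lty.
- by apply: measurable_funTS; exact: continuous_measurable_rV.
have : compact (f @` @bbox n M).
  by apply: continuous_compact; [exact: continuous_subspaceT|exact: compact_bbox].
move/compact_bounded => [N [_ HN]]; exists N; split; first exact: num_real.
by move=> K NK x Dx; apply: HN NK _ _; exists x => //; exact: DM.
Qed.

(* The compact time interval around [t0] provides the dominating constant. *)
Lemma continuous_integral_param (F : R * 'rV[R]_n -> R) (a b t0 : R) :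
  (forall t x, a < t < b -> {for (t, x), continuous F}) -> a < t0 < b ->
  {for t0, continuous (fun t => \int[leb R n]_(x in D) F (t, x))}.
Proof.
move=> cF /andP[at0 t0b].
pose c := (a + t0) / 2; pose e := (t0 + b) / 2.
have ct0 : c < t0 by rewrite /c; lra.
have t0e : t0 < e by rewrite /e; lra.
have ceI t : t \in `[c, e] -> a < t < b.
  by rewrite in_itv/= /c /e => /andP[? ?]; apply/andP; split; lra.
have cFt t : t \in `[c, e] -> continuous (fun x => F (t, x)).
  move=> tI x; apply: (cvg_uncurry (FF := nbhs_filter x) (h := F) (cvg_cst t) cvg_id).
  exact/cF/ceI.
have : compact (F @` (`[c, e] `*` @bbox n M)).
  apply: continuous_compact; last first.
    by apply: compact_setX; [exact: segment_compact|exact: compact_bbox].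
  by apply: continuous_in_subspaceT => -[t x]; rewrite inE => -[/= tI _]; exact/cF/ceI.
move/compact_bounded => [N [_ HN]].
have HF t x : t \in `]c, e[ -> D x -> `|F (t, x)| <= N + 1.
  move=> tI Dx; apply: HN; first by rewrite ltrDl.
  by exists (t, x) => //; split; [exact: subset_itv_oo_cc|exact: DM].
have := @continuity_under_integral _ _ _ (leb R n) (fun t x => F (t, x)) D mD c e
   _ _ (fun=> N + 1) _ _ t0; apply.
- move=> t tI; apply: integrable_bounded_domain; exact/cFt/subset_itv_oo_cc.
- apply: aeW => x Dx t; rewrite inE => tI.
  apply: (cvg_uncurry (FF := nbhs_filter t) (h := F) cvg_id (cvg_cst x)).
  exact/cF/ceI/subset_itv_oo_cc.
- by apply: (integrable_bounded_domain (f := fun=> N + 1)) ; exact: cst_continuous.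
- by move=> t tI; apply: aeW => x Dx; exact: HF.
- by rewrite inE /= in_itv/= ct0 t0e.
Qed.

End bounded_domain.

Lemma cvg_rV {T : Type} n (F : set_system T) {FF : Filter F} (f : T -> 'rV[R]_n)
    (x : 'rV[R]_n) :
  (forall i, f t 0 i @[t --> F] --> x 0 i) -> f @ F --> x.
Proof.
move=> H; apply/cvg_ballP => e e0.
have : \forall t \near F, forall i, `|x 0 i - f t 0 i| < e.
  by apply: filter_forall => i; move/cvgrPdist_lt : (H i) => /(_ _ e0).
by apply: filterS => t Ht; exact: rV_ballP.
Qed.

Lemma continuous_rV_cons n : continuous (@rV_cons R n).
Proof.
move=> p; apply: cvg_rV => i; have [j ->|->] := unliftP ord0 i.
  rewrite rV_consES; under eq_fun do rewrite rV_consES.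
  apply: (cvg_comp snd (fun x : 'rV[R]_n => x 0 j) cvg_snd).
  exact: coord_continuous.
rewrite rV_consE0; under eq_fun do rewrite rV_consE0.
exact: cvg_fst.
Qed.

Lemma coord_add_delta n (w : 'rV[R]_n) (h : R) k i :
  (w + h *: delta_mx 0 k) 0 i = w 0 i + h * (i == k)%:R.
Proof. by rewrite !mxE eqxx. Qed.

Lemma rV_consD0 n (a : R) (v : 'rV[R]_n) (h : R) :
  rV_cons (a, v) + h *: delta_mx 0 ord0 = rV_cons (a + h, v).
Proof.
apply/rowP => i; rewrite coord_add_delta.
have [j ->|->] := unliftP ord0 i.
  by rewrite !rV_consES eq_sym (negbTE (neq_lift _ _)) mulr0 addr0.
by rewrite !rV_consE0 eqxx mulr1.
Qed.

Lemma rV_consDS n (a : R) (v : 'rV[R]_n) (h : R) j :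
  rV_cons (a, v) + h *: delta_mx 0 (lift ord0 j) = rV_cons (a, v + h *: delta_mx 0 j).
Proof.
apply/rowP => i; rewrite coord_add_delta.
have [k ->|->] := unliftP ord0 i.
  by rewrite !rV_consES coord_add_delta (inj_eq (@lift_inj _ _)).
by rewrite !rV_consE0 (negbTE (neq_lift _ _)) mulr0 addr0.
Qed.

Local Notation e_ n i := (@delta_mx R 1 n 0 i).

Lemma integrable_bounded_support n (f : 'rV[R]_n -> R) M : continuous f ->
  (forall x, ~ bbox M x -> f x = 0) -> (leb R n).-integrable setT (EFin \o f).
Proof.
move=> cf f0; have := integrable_bounded_domain (@measurable_bbox n M) (@subset_refl _ _) cf.
move/integrable_mkcond => /(_ (@measurable_bbox n M)).
apply: eq_integrable => // x _; rewrite patchE; case: ifPn => //.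
by rewrite notin_setE => nx; rewrite /= f0.
Qed.

Lemma partial_outside n (F : 'rV[R]_n -> R) i M :
  (forall x, ~ bbox M x -> F x = 0) -> forall x, ~ bbox M x -> partial i F x = 0.
Proof.
move=> F0 x nx.
have oC : open (~` @bbox n M).
  apply: closed_openC; apply: compact_closed; last exact: compact_bbox.
  exact: norm_hausdorff.
have : {near x, cst 0 =1 F}.
  have : \forall z \near x, (~` @bbox n M) z by exact: open_nbhs_nbhs.
  by apply: filterS => z /F0 ->.
move=> H; transitivity ('D_(e_ n i) (cst 0 : _ -> R) x); last exact: derive_cst.
exact/esym/near_eq_derive.
Qed.

Lemma integral_derivative0 (g g' : R -> R) (M : R) : 0 <= M ->
  (forall t : R, is_derive t 1 g (g' t)) -> continuous g' ->
  (forall t, M < `|t| -> g t = 0) -> (\int[lebesgue_measure]_t (g' t)%:E = 0)%E.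
Proof.
move=> M0 dg cg' g0.
have g'0 t : M < `|t| -> g' t = 0.
  move=> tM.
  have : {near t, cst 0 =1 g}.
    have : \forall z \near t, M < `|z| by apply: (cvgr_gt _ (@norm_continuous _ _ t)).
    by apply: filterS => z /g0 ->.
  move=> H; have [_ <-] := dg t.
  transitivity ('D_1 (cst 0 : R -> R) t); last exact: derive_cst.
  exact/esym/near_eq_derive.
(* The interval reaches beyond [M] because [g] is known to vanish only for absolute values strictly
   above [M]. *)
transitivity (\int[lebesgue_measure]_(t in `[(- (M + 1))%R, (M + 1)%R]) (g' t)%:E)%E.
  rewrite [RHS]integral_mkcond; apply: eq_integral => t _.
  rewrite patchE; case: ifPn => //; rewrite notin_setE /= in_itv/= => /negP H.
  by rewrite g'0// ltNge; apply/negP => tM; move/negP: H; apply; rewrite -ler_norml; lra.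
rewrite (@continuous_FTC2 _ g' g).
- have M1 : M < `|M + 1| by rewrite ger0_norm; lra.
  by rewrite !g0 ?subee// normrN.
- lra.
- exact: continuous_subspaceT.
- split; first by move=> t _; have [] := dg t.
    apply: cvg_at_right_filter; apply: differentiable_continuous.
    by apply/derivable1_diffP; have [] := dg (- (M + 1)).
  apply: cvg_at_left_filter; apply: differentiable_continuous.
  by apply/derivable1_diffP; have [] := dg (M + 1).
- by move=> t _; rewrite derive1E; have [] := dg t.
Qed.

(** By Fubini along [rV_cons]: a derivative in the first coordinate is integrated first in that
    coordinate, and any other one falls under the induction hypothesis for each fixed first
    coordinate. *)
Lemma integral_partial0 n (F : 'rV[R]_n -> R) i M : 0 <= M ->
  (forall z : 'rV[R]_n, derivable F z (e_ n i)) -> continuous (partial i F) ->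
  (forall x, ~ bbox M x -> F x = 0) -> (\int[leb R n]_x (partial i F x)%:E = 0)%E.
Proof.
move=> M0; elim: n F i => [|n IHn] F i dF cF F0; first by case: i dF cF.
have ip := integrable_bounded_support cF (partial_outside i F0).
have mp := measurable_int _ ip.
have iprod : (lebesgue_measure \x leb R n)%E.-integrable setT
    (fun p => (partial i F (rV_cons p))%:E).
  apply/integrableP; split.
    exact: (measurableT_comp mp (@measurable_rV_cons R n)).
  move/integrableP : ip => [_]; apply: le_lt_trans; rewrite le_eqVlt; apply/predU1l/esym.
  apply: (@ge0_integral_pushforward _ _ _ _ _ _ (@measurable_rV_cons R n)
    (lebesgue_measure \x leb R n)%E setT (fun x => `|(partial i F x)%:E|)%E).
  - exact: measurableT.
  - exact: measurableT_comp.
  - by move=> x _; rewrite abse_ge0.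
apply: (etrans (@integral_pushforward _ _ _ _ _ _ (@measurable_rV_cons R n)
  (lebesgue_measure \x leb R n)%E setT (EFin \o partial i F) mp iprod measurableT)).
rewrite preimage_setT.
have [j ij|i0] := unliftP ord0 i.
  rewrite -integral12_prod_meas1//; apply: integral0_eq => a _.
  rewrite /fubini_F; pose Fa v := F (rV_cons (a, v)).
  have lin (v : 'rV[R]_n) : (fun h : R => F (rV_cons (a, v) + h *: e_ n.+1 i)) =
                      (fun h : R => Fa (v + h *: e_ n j)).
    by apply/funext => h; rewrite ij rV_consDS.
  have dFa v : is_derive v (e_ n j) Fa (partial i F (rV_cons (a, v))).
    apply/is_derive_line0; rewrite -lin.
    by apply: (iffLR (is_derive_line0 _ _ _ _)); exact: is_derive_partial.
  have pE v : partial i F (rV_cons (a, v)) = partial j Fa v.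
    by rewrite /partial; have [_ ->] := dFa v.
  transitivity (\int[leb R n]_v (partial j Fa v)%:E)%E.
    by apply: eq_integral => v _; rewrite /= pE.
  apply: (IHn Fa j).
  - by move=> v; have [] := dFa v.
  - rewrite (_ : partial j Fa = fun v => partial i F (rV_cons (a, v))); last first.
      by apply/funext => v; rewrite pE.
    move=> v.
    apply: (cvg_uncurry (FF := nbhs_filter v) (h := fun p => partial i F (rV_cons p)) (cvg_cst a) cvg_id).
    by apply: continuous_comp; [exact: continuous_rV_cons|exact: cF].
  - move=> v nv; apply: F0 => H; apply: nv => k.
    by have := H (lift ord0 k); rewrite rV_consES.
rewrite -integral21_prod_meas1//; apply: integral0_eq => v _.
rewrite /fubini_G; apply: (@integral_derivative0 (fun a => F (rV_cons (a, v))) _ M) => //.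
- move=> t.
  have -> : (fun a => F (rV_cons (a, v))) = (fun h : R => F (rV_cons (0, v) + h *: e_ n.+1 i)).
    by apply/funext => h; rewrite i0 rV_consD0 add0r.
  have -> : rV_cons (t, v) = rV_cons (0, v) + t *: e_ n.+1 i by rewrite i0 rV_consD0 add0r.
  exact: is_derive_line_partial.
- move=> a.
  apply: (cvg_uncurry (FF := nbhs_filter a) (h := fun p => partial i F (rV_cons p)) cvg_id (cvg_cst v)).
  by apply: continuous_comp; [exact: continuous_rV_cons|exact: cF].
- move=> t tM; apply: F0 => /(_ ord0); rewrite rV_consE0 /=.
  by rewrite leNgt tM.
Qed.

End lebesgue_box.

(** * The inverse of the profile *)

Section euclidean_norm.
Variables (R : realType) (n : nat).
Implicit Types (x y : 'rV[R]_n).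

Lemma enorm_ge0 x : 0 <= enorm x. Proof. exact: sqrtr_ge0. Qed.

Lemma enorm_sq x : enorm x ^+ 2 = \sum_i x 0 i ^+ 2.
Proof. by rewrite sqr_sqrtr// sumr_ge0// => i _; exact: sqr_ge0. Qed.

Lemma coord_le_enorm x i : `|x 0 i| <= enorm x.
Proof.
rewrite -(@ler_pXn2r _ 2)// ?nnegrE ?enorm_ge0// enorm_sq real_normK ?num_real//.
by rewrite (bigD1 i)//= lerDl sumr_ge0// => j _; exact: sqr_ge0.
Qed.

Lemma enorm0 : enorm (0 : 'rV[R]_n) = 0.
Proof.
apply/eqP; rewrite -sqrf_eq0 enorm_sq big1// => i _.
by rewrite mxE expr0n.
Qed.

Lemma enorm_gt0 x : x != 0 -> 0 < enorm x.
Proof.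
move=> x0; rewrite lt_neqAle enorm_ge0 andbT eq_sym; apply: contra_neq x0 => e0.
apply/rowP => i; rewrite mxE; apply/eqP; rewrite -normr_le0 -e0.
exact: coord_le_enorm.
Qed.

Lemma enormN x : enorm (- x) = enorm x.
Proof. by congr Num.sqrt; apply: eq_bigr => i _; rewrite mxE sqrrN. Qed.

Lemma enorm_distC x y : enorm (x - y) = enorm (y - x).
Proof. by rewrite -enormN opprB. Qed.

Lemma enormZ (c : R) x : enorm (c *: x) = `|c| * enorm x.
Proof.
apply: (@pexpIrn _ 2) => //; rewrite ?nnegrE ?enorm_ge0 ?mulr_ge0 ?enorm_ge0//.
rewrite exprMn !enorm_sq real_normK ?num_real// mulr_sumr.
by apply: eq_bigr => i _; rewrite mxE exprMn.
Qed.

(** Expansion of (|x| - rho)^2 >= 0. The right-hand side is a smooth function touching the norm from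
    above where |x| = rho, so it can replace the norm when a first-order condition is read off at a
    maximum. *)
Lemma enorm_le_quadratic x (rho : R) : 0 < rho ->
  enorm x <= (\sum_i x 0 i ^+ 2 + rho ^+ 2) / (2 * rho).
Proof.
move=> r0; rewrite ler_pdivlMr ?mulr_gt0// -enorm_sq.
by have := sqr_ge0 (enorm x - rho); rewrite sqrrB; lra.
Qed.

Lemma dot_le_enorm x (p : 'I_n -> R) : \sum_i p i ^+ 2 <= 1 ->
  \sum_i x 0 i * p i <= enorm x.
Proof.
move=> p1; have [->|x0] := eqVneq x 0.
  by rewrite enorm0 big1// => i _; rewrite mxE mul0r.
have r0 := enorm_gt0 x0; set rho := enorm x in r0 *.
apply: (@le_trans _ _ (\sum_i (x 0 i ^+ 2 / rho + rho * p i ^+ 2) / 2)).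
  apply: ler_sum => i _; rewrite -subr_ge0.
  rewrite [leRHS](_ : _ = (x 0 i - rho * p i) ^+ 2 / (2 * rho)); last first.
    by field; rewrite gt_eqF.
  by rewrite divr_ge0 ?sqr_ge0// mulr_ge0// ltW.
rewrite -mulr_suml big_split/= -mulr_suml -mulr_sumr -enorm_sq -/rho expr2 mulfK ?gt_eqF//.
have : rho * (\sum_i p i ^+ 2) <= rho * 1 by rewrite ler_pM2l.
lra.
Qed.

Lemma continuous_coord i : continuous (fun x : 'rV[R]_n => x 0 i).
Proof. exact: coord_continuous. Qed.

Lemma continuous_enorm : continuous (@enorm R n).
Proof.
move=> x; apply: (@continuous_comp _ _ _ (fun x : 'rV[R]_n => \sum_i x 0 i ^+ 2) Num.sqrt).
  apply: continuous_sumf => i; apply: continuous_sqrf.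
  exact: continuous_coord.
exact: sqrt_continuous.
Qed.

End euclidean_norm.

Section inverse_profile.
Variables (R : realType) (eps : R).
Hypothesis eps0 : 0 < eps.

(** This is eps artanh s, with derivative eps / (1 - s^2). *)
Definition inverse_profile (s : R) : R := eps / 2 * (ln (1 + s) - ln (1 - s)).

Let pos_1D (s : R) : `|s| < 1 -> 0 < 1 + s.
Proof. by rewrite ltr_norml => /andP[? ?]; lra. Qed.

Let pos_1B (s : R) : `|s| < 1 -> 0 < 1 - s.
Proof. by rewrite ltr_norml => /andP[? ?]; lra. Qed.

Lemma one_sub_sq_gt0 (s : R) : `|s| < 1 -> 0 < 1 - s ^+ 2.
Proof.
move=> s1; rewrite (_ : 1 - s ^+ 2 = (1 - s) * (1 + s)); last by ring.
exact: mulr_gt0 (pos_1B s1) (pos_1D s1).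
Qed.

Lemma is_derive_inverse_profile (s : R) : `|s| < 1 ->
  is_derive s 1 inverse_profile (eps / (1 - s ^+ 2)).
Proof.
move=> s1; have p := pos_1D s1; have q := pos_1B s1.
have d1 : is_derive s 1 (fun s : R => ln (1 + s)) ((1 + s)^-1 * 1).
  apply: (@is_derive1_comp _ (@ln R) (fun s => 1 + s)); first exact: is_derive1_ln.
  by apply: is_derive_eq (add0r _).
have d2 : is_derive s 1 (fun s : R => ln (1 - s)) ((1 - s)^-1 * - 1).
  apply: (@is_derive1_comp _ (@ln R) (fun s => 1 - s)); first exact: is_derive1_ln.
  by apply: is_derive_eq (add0r _).
have := is_derive_cmulf (eps / 2) (is_derive_subf d1 d2).
rewrite (_ : eps / (1 - s ^+ 2) = eps / 2 * ((1 + s)^-1 * 1 - (1 - s)^-1 * - 1)) //.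
rewrite (_ : 1 - s ^+ 2 = (1 - s) * (1 + s)); last by ring.
by field; rewrite !lt0r_neq0.
Qed.

Lemma is_derive_inverse_profile' (s : R) : `|s| < 1 ->
  is_derive s 1 (fun s : R => eps / (1 - s ^+ 2)) (2 * eps * s / (1 - s ^+ 2) ^+ 2).
Proof.
move=> s1; have p := one_sub_sq_gt0 s1.
have d := is_derive_subf (is_derive_cst (1 : R) s 1) (is_derive_sqrf (is_derive_id s 1)).
have := is_derive_cmulf eps (@is_derive_invf _ _ (fun s : R => 1 - s ^+ 2) s 1 _ (lt0r_neq0 p) d).
rewrite (_ : 2 * eps * s / (1 - s ^+ 2) ^+ 2 =
  eps * (- (0 - 2 * s * 1) / (1 - s ^+ 2) ^+ 2)) //; by field; exact: lt0r_neq0.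
Qed.

Lemma inverse_profileN s : inverse_profile (- s) = - inverse_profile s.
Proof. by rewrite /inverse_profile opprK -mulrN opprB. Qed.

Lemma profile_lt1 (r : R) : `|profile eps r| < 1.
Proof.
rewrite /profile /tanh; set a := expR _; set b := expR _.
have a0 : 0 < a by exact: expR_gt0.
have b0 : 0 < b by exact: expR_gt0.
by rewrite ltr_norml ltr_pdivlMr ?ltr_pdivrMr ?addr_gt0//; apply/andP; split; lra.
Qed.

Lemma profileK (r : R) : inverse_profile (profile eps r) = r.
Proof.
rewrite /inverse_profile /profile /tanh; set a := expR (r / eps); set b := expR (- _).
have a0 : 0 < a by exact: expR_gt0.
have b0 : 0 < b by exact: expR_gt0.
have ab : a + b != 0 by rewrite gt_eqF ?addr_gt0.
rewrite (_ : 1 + _ = 2 * a / (a + b)); last by field.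
rewrite (_ : 1 - _ = 2 * b / (a + b)); last by field.
rewrite -ln_div ?posrE ?divr_gt0 ?mulr_gt0 ?addr_gt0//.
rewrite (_ : 2 * a / (a + b) / (2 * b / (a + b)) = a / b); last by field; rewrite ab gt_eqF.
rewrite ln_div ?posrE// !expRK; field.
exact: lt0r_neq0.
Qed.

(** The exponentiated form of the bound: it keeps [s] at an explicit distance below 1. *)
Lemma inverse_profile_le (s C : R) : `|s| < 1 -> inverse_profile s <= C ->
  (1 + s) * expR (- (2 * C / eps)) <= 1 - s.
Proof.
move=> s1; have p := pos_1D s1; have q := pos_1B s1.
rewrite /inverse_profile => H.
rewrite -ler_ln ?posrE ?mulr_gt0 ?expR_gt0// lnM ?posrE ?expR_gt0// expRK.
rewrite lerBlDr -lerBlDl ler_pdivlMr// mulrC.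
by move: H; lra.
Qed.

Lemma inverse_profile_mono (s c : R) : `|s| < 1 -> s <= c -> c < 1 ->
  inverse_profile s <= inverse_profile c.
Proof.
move=> s1 sc c1; have p := pos_1D s1; have q := pos_1B s1.
rewrite /inverse_profile ler_pM2l ?divr_gt0// lerB// ler_ln ?posrE//; lra.
Qed.

End inverse_profile.

(** * Regularity of the solution and the equation for the inverse profile *)

Lemma continuous_pair_at {T U V : topologicalType} (f : T -> U) (g : T -> V) p :
  {for p, continuous f} -> {for p, continuous g} ->
  {for p, continuous (fun q => (f q, g q))}.
Proof. by move=> cf cg; exact: cvg_pair. Qed.

Lemma continuous_uncurry_at {T U V W : topologicalType} (f : T -> U) (g : T -> V)
  (h : U * V -> W) p :
  {for p, continuous f} -> {for p, continuous g} -> {for (f p, g p), continuous h} ->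
  {for p, continuous (fun q => h (f q, g q))}.
Proof. by move=> cf cg ch; exact: (cvg_uncurry cf cg ch). Qed.

Lemma continuous_max0 (R : realType) (n : nat) (p : R * 'rV[R]_n) :
  {for p, continuous (fun q : R * 'rV[R]_n => Num.max 0 q.1)}.
Proof.
apply: (@continuous_comp _ _ _ fst (fun t : R => Num.max 0 t)); first exact: cvg_fst.
have h1 : {for p.1, continuous (fun _ : R => 0 : R^o)} by exact: cst_continuous.
have h2 : {for p.1, continuous (fun t : R => t : R^o)} by exact: cvg_id.
exact: continuous_max h1 h2.
Qed.

Section halfspace.
Variables (R : realType) (n : nat).
Implicit Types f : R * 'rV[R]_n -> R.

(** The map t to max(0, t) sends all of space-time into the closed half-space, so continuity
    relative to the half-space becomes plain continuity and compactness arguments can reach t =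
    0. *)
Lemma continuous_clamp f : {within [set p : R * 'rV[R]_n | 0 <= p.1], continuous f} ->
  continuous (fun p : R * 'rV[R]_n => f (Num.max 0 p.1, p.2)).
Proof.
move/subspace_continuousP => cf p.
have gp : 0 <= (Num.max 0 p.1, p.2).1 by rewrite /= le_max lexx.
apply: (cvg_comp (fun p : R * 'rV[R]_n => (Num.max 0 p.1, p.2)) f _ (cf _ gp)).
move=> P wP.
have cg : {for p, continuous (fun q : R * 'rV[R]_n => (Num.max 0 q.1, q.2))}.
  apply: (continuous_pair_at (f := fun q : R * 'rV[R]_n => Num.max 0 q.1) (g := snd)); last exact: cvg_snd.
  exact: continuous_max0.
have H : \forall q \near p, 0 <= (Num.max 0 q.1, q.2).1 -> P (Num.max 0 q.1, q.2) := cg _ wP.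
change (\forall q \near p, P (Num.max 0 q.1, q.2)).
by apply: filterS H => q; apply; rewrite /= le_max lexx.
Qed.

Lemma open_halfspace : open [set p : R * 'rV[R]_n | 0 < p.1].
Proof.
rewrite (_ : mkset _ = fst @^-1` [set t : R | 0 < t]) //.
by apply: open_comp; [move=> ? _; exact: cvg_fst|exact: open_gt].
Qed.

Lemma continuous_open_halfspace f : {within [set p : R * 'rV[R]_n | 0 < p.1], continuous f} ->
  forall t x, 0 < t -> {for (t, x), continuous f}.
Proof.
rewrite (continuous_open_subspace f open_halfspace) => cf t x t0.
by apply: cf; rewrite inE.
Qed.

End halfspace.

Section periodicity.
Variables (R : realType) (n : nat) (f : 'rV[R]_n -> R).
Hypothesis fper : Defs.periodic f.

Lemma periodic_int_shift (x : 'rV[R]_n) (k : 'I_n -> int) :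
  f (x + \row_i (k i)%:~R) = f x.
Proof.
have shift1 i (m : int) y : f (y + m%:~R *: delta_mx 0 i) = f y.
  have nat_shift (a : nat) z : f (z + a%:R *: delta_mx 0 i) = f z.
    elim: a z => [|a IHa] z; first by rewrite scale0r addr0.
    by rewrite -natr1 scalerDl scale1r addrA fper IHa.
  case: m => a; first exact: nat_shift.
  rewrite NegzE rmorphN /= scaleNr (_ : a.+1%:~R = a.+1%:R)//.
  by rewrite -[LHS](nat_shift a.+1) subrK.
rewrite [\row_i _]row_sum_delta.
elim: (index_enum _) x => [|i s IHs] x; first by rewrite big_nil addr0.
by rewrite big_cons addrA IHs mxE shift1.
Qed.

End periodicity.

Lemma int_shift_in_box (R : realType) (n : nat) (x : 'rV[R]_n) :
  exists k : 'I_n -> int, bbox 1 (x + \row_i (k i)%:~R).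
Proof.
exists (fun i => - Num.floor (x 0 i)) => i; rewrite !mxE rmorphN /=.
have := floor_itv (x 0 i); set m := Num.floor _ => /andP[m1 m2].
rewrite intrD1 in m2; rewrite ler_norml; apply/andP; split; lra.
Qed.

Section double_well.
Variable R : realType.

Lemma is_derive_W (s : R) : is_derive s 1 (@W R) (- (2 * s * (1 - s ^+ 2))).
Proof.
have d := is_derive_subf (is_derive_cst (1 : R) s 1) (is_derive_sqrf (is_derive_id s 1)).
have := is_derive_cmulf 2^-1 (is_derive_sqrf d).
rewrite (_ : (fun z => _) = @W R); last by apply/funext => z; rewrite /W mulrC.
by rewrite (_ : - (2 * s * (1 - s ^+ 2)) = 2^-1 * (2 * (cst 1 s - s ^+ 2) * (0 - 2 * s * 1))) //= /cst; field.
Qed.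

Lemma derive1_W (s : R) : derive1 (@W R) s = - (2 * s * (1 - s ^+ 2)).
Proof. by rewrite derive1E; have [_ ->] := is_derive_W s. Qed.

Lemma sqrt_2W (s : R) : `|s| <= 1 -> Num.sqrt (2 * W s) = 1 - s ^+ 2.
Proof.
move=> s1; rewrite /W mulrCA divff// mulr1 sqrtr_sqr ger0_norm// subr_ge0.
by rewrite -real_normK ?num_real// expr_le1.
Qed.

End double_well.

Lemma lambda_of_bounded (R : realType) (d : nat) (eps : R) (u : 'rV[R]_d -> R) :
  (forall x, `|u x| <= 1) ->
  lambda eps u = (- \int[leb R d]_(x in torus)
    ((1 - u x ^+ 2) * (eps * laplacian u x + 2 * u x * (1 - u x ^+ 2) / eps))) /
   (2 * \int[leb R d]_(x in torus) ((1 - u x ^+ 2) ^+ 2 / 2)).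
Proof.
move=> u1; rewrite /lambda; congr (- _ / _).
by apply: eq_Rintegral => x _; rewrite sqrt_2W// derive1_W mulNr opprK.
Qed.

Section solution.
Variables (R : realType) (n : nat) (eps : R) (u0 : 'rV[R]_n -> R) (u : R -> 'rV[R]_n -> R).
Hypotheses (eps0 : 0 < eps) (sol : allen_cahn_solution eps u0 u).
Local Notation e_ i := (@delta_mx R 1 n 0 i).

Lemma solution_periodic t : 0 <= t -> Defs.periodic (u t).
Proof. by case: sol => _ + _ _ => /(_ t). Qed.

Lemma continuous_clamped_solution :
  continuous (fun p : R * 'rV[R]_n => u (Num.max 0 p.1) p.2).
Proof. by case: sol => -[cu _ _ _] _ _ _; exact: (continuous_clamp cu). Qed.

Lemma continuous_clamped_partial i :
  continuous (fun p : R * 'rV[R]_n => partial i (u (Num.max 0 p.1)) p.2).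
Proof. by case: sol => -[_ /(_ i)[_ cu] _ _] _ _ _; exact: (continuous_clamp cu). Qed.

Let lt_le_halfspace : [set p : R * 'rV[R]_n | 0 < p.1] `<=` [set p | 0 <= p.1].
Proof. by move=> p /= /ltW. Qed.

Lemma continuous_solution t x : 0 < t ->
  {for (t, x), continuous (fun p : R * 'rV[R]_n => u p.1 p.2)}.
Proof.
case: sol => -[cu _ _ _] _ _ _ t0; apply: continuous_open_halfspace => //.
exact: (continuous_subspaceW lt_le_halfspace cu).
Qed.

Lemma continuous_partial i t x : 0 < t ->
  {for (t, x), continuous (fun p : R * 'rV[R]_n => partial i (u p.1) p.2)}.
Proof.
case: sol => -[_ /(_ i)[_ cu] _ _] _ _ _ t0; apply: continuous_open_halfspace => //.
exact: (continuous_subspaceW lt_le_halfspace cu).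
Qed.

Lemma continuous_partial2 i j t x : 0 < t ->
  {for (t, x), continuous (fun p : R * 'rV[R]_n => partial i (partial j (u p.1)) p.2)}.
Proof.
by case: sol => -[_ _ /(_ i j)[_ cu] _] _ _ _ t0; exact: continuous_open_halfspace.
Qed.

Lemma continuous_time_derivative t x : 0 < t ->
  {for (t, x), continuous (fun p : R * 'rV[R]_n => derive1 (u^~ p.2) p.1)}.
Proof.
by case: sol => -[_ _ _ [_ cu]] _ _ _ t0; apply: continuous_open_halfspace.
Qed.

Lemma continuous_slice (F : R * 'rV[R]_n -> R) t :
  (forall x, {for (t, x), continuous F}) -> continuous (fun x => F (t, x)).
Proof.
move=> cF x; exact: (cvg_uncurry (FF := nbhs_filter x) (h := F) (cvg_cst t) cvg_id (cF x)).
Qed.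

Lemma derivable_solution i t x : 0 <= t -> derivable (u t) x (e_ i).
Proof. by case: sol => -[_ /(_ i)[du _] _ _] _ _ _ t0; exact: du. Qed.

Lemma derivable_partial i j t x : 0 < t -> derivable (partial j (u t)) x (e_ i).
Proof. by case: sol => -[_ _ /(_ i j)[du _] _] _ _ _ t0; exact: du. Qed.

Lemma derivable_time t x : 0 < t -> derivable (u^~ x) t 1.
Proof. by case: sol => -[_ _ _ [du _]] _ _ _; exact: du. Qed.

Lemma partial_solution_comm i j t x : 0 < t ->
  partial i (partial j (u t)) x = partial j (partial i (u t)) x.
Proof.
move=> t0; apply: partial_comm => *.
- exact/derivable_solution/ltW.
- exact: derivable_partial.
- by apply: (continuous_slice (F := fun p => partial _ (partial _ (u p.1)) p.2)) => x'; exact: continuous_partial2.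
Qed.

Lemma equation_bounded t x : 0 < t -> (forall z, `|u t z| <= 1) ->
  derive1 (u^~ x) t = laplacian (u t) x + 2 * u t x * (1 - u t x ^+ 2) / eps ^+ 2
    + lambda eps (u t) / eps * (1 - u t x ^+ 2).
Proof.
case: sol => _ _ _ /[apply] /(_ x) + u1.
rewrite sqrt_2W// derive1_W => H.
have eN : eps != 0 by rewrite gt_eqF.
apply: (mulfI eN); rewrite H; field.
by rewrite eN.
Qed.

Local Notation A := (inverse_profile eps).

Lemma is_derive_time_inverse t x : 0 < t -> `|u t x| < 1 ->
  is_derive t 1 (fun s => A (u s x)) (eps / (1 - u t x ^+ 2) * derive1 (u^~ x) t).
Proof.
move=> t0 u1; apply: is_derive_chain; last exact: is_derive_inverse_profile.
by rewrite derive1E; apply: derivableP; exact: derivable_time.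
Qed.

Lemma is_derive_space_inverse t x i : 0 <= t -> `|u t x| < 1 ->
  is_derive x (e_ i) (fun z => A (u t z)) (eps / (1 - u t x ^+ 2) * partial i (u t) x).
Proof.
move=> t0 u1; apply: is_derive_chain; last exact: is_derive_inverse_profile.
by apply: is_derive_partial; exact: derivable_solution.
Qed.

Lemma partial_inverse t x i : 0 <= t -> `|u t x| < 1 ->
  partial i (fun z => A (u t z)) x = eps / (1 - u t x ^+ 2) * partial i (u t) x.
Proof. by move=> t0 u1; have [_] := is_derive_space_inverse i t0 u1. Qed.

Lemma is_derive_partial_inverse t x i : 0 <= t -> `|u t x| < 1 ->
  is_derive x (e_ i) (fun z => A (u t z)) (partial i (fun z => A (u t z)) x).
Proof. by move=> t0 u1; rewrite partial_inverse//; exact: is_derive_space_inverse. Qed.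

Lemma is_derive_space_inverse2 t x i : 0 < t -> (forall z, `|u t z| < 1) ->
  is_derive x (e_ i) (partial i (fun z => A (u t z)))
   (2 * eps * u t x / (1 - u t x ^+ 2) ^+ 2 * partial i (u t) x ^+ 2 +
    eps / (1 - u t x ^+ 2) * partial i (partial i (u t)) x).
Proof.
move=> t0 u1.
rewrite (_ : partial i (fun z => A (u t z)) =
   fun z => eps / (1 - u t z ^+ 2) * partial i (u t) z); last first.
  by apply/funext => z; rewrite partial_inverse// ltW.
rewrite expr2 mulrA; apply: is_derive_mulf; last first.
  by apply: is_derive_partial; exact: derivable_partial.
apply: (is_derive_chain (g := fun s => eps / (1 - s ^+ 2))).
  by apply: is_derive_partial; apply: derivable_solution; exact: ltW.
exact: is_derive_inverse_profile'.
Qed.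

(** The derivative eps / (1 - u^2) of the inverse profile is the reciprocal of the weight sqrt(2
    W(u)) / eps that multiplies [lambda], so the multiplier becomes a term constant in space. The
    reaction term carries the factor 1 - |grad r|^2, where [r] is the inverse profile of [u]. *)
Lemma equation_inverse t x : 0 < t -> (forall z, `|u t z| < 1) ->
  eps / (1 - u t x ^+ 2) * derive1 (u^~ x) t =
  \sum_i partial i (partial i (fun z => A (u t z))) x
  + 2 * u t x / eps * (1 - \sum_i partial i (fun z => A (u t z)) x ^+ 2)
  + lambda eps (u t).
Proof.
move=> t0 u1; have p := one_sub_sq_gt0 (u1 x).
rewrite equation_bounded//; last by move=> z; exact: ltW.
have -> : \sum_i partial i (partial i (fun z => A (u t z))) x =
  2 * eps * u t x / (1 - u t x ^+ 2) ^+ 2 * (\sum_i partial i (u t) x ^+ 2) +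
  eps / (1 - u t x ^+ 2) * laplacian (u t) x.
  rewrite /laplacian !mulr_sumr -big_split/=; apply: eq_bigr => i _.
  by have [_] := is_derive_space_inverse2 x i t0 u1.
have -> : \sum_i partial i (fun z => A (u t z)) x ^+ 2 =
  (eps / (1 - u t x ^+ 2)) ^+ 2 * \sum_i partial i (u t) x ^+ 2.
  rewrite mulr_sumr; apply: eq_bigr => i _.
  by rewrite partial_inverse ?exprMn// ltW.
field; rewrite !lt0r_neq0//.
Qed.

End solution.

(** * Gradient bound by doubling variables *)

Section first_order_conditions.
Variable R : realType.

Lemma is_derive_at_max (V : normedModType R) (f : V -> R) x v (df : R) :
  is_derive x v f df -> (forall z, f z <= f x) -> df = 0.
Proof.
move=> /is_derive_line0 Df fmax; apply/le_anti/andP; split; last first.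
  apply: (@left_derivative_at_max _ (fun h : R => f (x + h *: v)) (-1) 0) => //.
  by move=> t _; rewrite scale0r addr0.
rewrite -oppr_ge0.
apply: (@left_derivative_at_max _ (fun h : R => f (x + (- h) *: v)) (-1) 0) => //.
- have dN : is_derive (0 : R) 1 (fun h : R => - h) (-1) by exact: is_derive_oppf (is_derive_id _ _).
  rewrite -[- df]mulrN1; apply: (is_derive_chain (f := fun h : R => - h) (g := fun h : R => f (x + h *: v))) => //.
  by rewrite oppr0.
- by move=> t _; rewrite oppr0 scale0r addr0.
Qed.

Lemma is_derive_coord n (x : 'rV[R]_n) i j (y : 'rV[R]_n) :
  is_derive x (delta_mx 0 j) (fun z : 'rV[R]_n => (z - y) 0 i) (i == j)%:R.
Proof.
apply/is_derive_line0.
rewrite (_ : (fun h => _) = fun h : R => (x - y) 0 i + (i == j)%:R * h); last first.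
  by apply/funext => h; rewrite addrAC coord_add_delta mulrC.
rewrite -[(i == j)%:R in X in is_derive _ _ _ X]add0r -[X in 0 + X]mulr1.
by apply: is_derive_addf; apply: is_derive_cmulf; exact: is_derive_id.
Qed.

Lemma is_derive_sqdist n (x y : 'rV[R]_n) j :
  is_derive x (delta_mx 0 j) (fun z : 'rV[R]_n => \sum_i (z - y) 0 i ^+ 2)
    (2 * (x - y) 0 j).
Proof.
have H i := is_derive_sqrf (is_derive_coord x i j y).
have := is_derive_sumf (index_enum _) H.
rewrite (bigD1 j)//= eqxx mulr1 big1 ?addr0// => i /negbTE ->.
by rewrite mulr0.
Qed.

End first_order_conditions.

(** Here [a] and [b] stand for the two Laplacians, each 1 - 1 for 1 - |grad r|^2 at a point with
    unit gradient, [l] for the multiplier and [e] for the slope of the time penalty. *)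
Lemma comparison_contradiction {R : realFieldType} (a b c d l e : R) :
  a <= b -> 0 < e -> ~ 0 <= a + c * (1 - 1) + l - (b + d * (1 - 1) + l) - e * 1.
Proof. by rewrite subrr !mulr0; lra. Qed.

Lemma continuous_doubled1 (R : realType) (n : nat) (G : R * 'rV[R]_n -> R) (s : R)
  (x y : 'rV[R]_n) : {for (s, x), continuous G} ->
  {for (s, (x, y)), continuous (fun p : R * ('rV[R]_n * 'rV[R]_n) => G (p.1, p.2.1))}.
Proof.
move=> cG; set q := (s, (x, y)).
have c2 : {for q, continuous (fun p : R * ('rV[R]_n * 'rV[R]_n) => p.2.1)}.
  by apply: cvg_comp; [exact: cvg_snd|exact: cvg_fst].
have c1 : {for q, continuous (fun p : R * ('rV[R]_n * 'rV[R]_n) => p.1)} by exact: cvg_fst.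
exact: (continuous_uncurry_at c1 c2 cG).
Qed.

Lemma continuous_doubled2 (R : realType) (n : nat) (G : R * 'rV[R]_n -> R) (s : R)
  (x y : 'rV[R]_n) : {for (s, y), continuous G} ->
  {for (s, (x, y)), continuous (fun p : R * ('rV[R]_n * 'rV[R]_n) => G (p.1, p.2.2))}.
Proof.
move=> cG; set q := (s, (x, y)).
have c2 : {for q, continuous (fun p : R * ('rV[R]_n * 'rV[R]_n) => p.2.2)}.
  by apply: cvg_comp; [exact: cvg_snd|exact: cvg_snd].
have c1 : {for q, continuous (fun p : R * ('rV[R]_n * 'rV[R]_n) => p.1)} by exact: cvg_fst.
exact: (continuous_uncurry_at c1 c2 cG).
Qed.

Section lipschitz_bound.
Variables (R : realType) (n : nat) (eps : R) (u0 : 'rV[R]_n -> R) (u : R -> 'rV[R]_n -> R).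
Hypotheses (eps0 : 0 < eps) (sol : allen_cahn_solution eps u0 u).
Variable T : R.
Hypothesis u1 : forall t x, 0 <= t <= T -> `|u t x| < 1.
Local Notation e_ i := (@delta_mx R 1 n 0 i).
Local Notation A := (inverse_profile eps).

Let r t x := A (u t x).

Let continuous_r s z : 0 <= s <= T ->
  {for (s, z), continuous (fun p : R * 'rV[R]_n => r (Num.max 0 p.1) p.2)}.
Proof.
move=> sT; apply: (@continuous_comp _ _ _
  (fun p : R * 'rV[R]_n => u (Num.max 0 p.1) p.2) A); first exact: (continuous_clamped_solution sol).
have /andP[s0 _] := sT.
rewrite /= (max_r s0); apply: differentiable_continuous; apply/derivable1_diffP.
by have [] := is_derive_inverse_profile eps (u1 z sT).
Qed.

(** Periodicity moves every point into the unit box, and compactness of the time interval times the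
    box gives the bound. *)
Let r_bounded t : 0 <= t <= T -> exists B, 0 <= B /\ forall s z, 0 <= s <= t -> `|r s z| <= B.
Proof.
move=> /andP[t0 tT].
have : compact ((fun p : R * 'rV[R]_n => r (Num.max 0 p.1) p.2) @` (`[0, t] `*` @bbox R n 1)).
  apply: continuous_compact; last first.
    by apply: compact_setX; [exact: segment_compact|exact: compact_bbox].
  apply: continuous_in_subspaceT => -[s z]; rewrite inE => -[/=].
  by rewrite in_itv/= => /andP[s0 st] _; apply: continuous_r; rewrite s0 (le_trans st).
move/compact_bounded => [N [_ HN]].
exists (`|N| + 1); split=> [|s z sI]; first by rewrite addr_ge0.
have [k Hk] := int_shift_in_box z.
have /andP[s0 _] := sI.
rewrite (_ : r s z = r s (z + \row_i (k i)%:~R)); last first.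
  by rewrite /r (periodic_int_shift (solution_periodic sol s0)).
apply: HN; first by rewrite (le_lt_trans (ler_norm _))// ltrDl.
exists (s, z + \row_i (k i)%:~R); first by split=> //=; rewrite in_itv.
by rewrite /r /= max_r.
Qed.

Local Notation X := (R * ('rV[R]_n * 'rV[R]_n))%type.

Section doubling.
Variables (t delta : R).
Hypotheses (tT : 0 <= t <= T) (delta0 : 0 < delta).

Let Phi (s : R) (x y : 'rV[R]_n) := r s x - r s y - enorm (x - y) - delta * s.

(** Space is not compact, but [Phi] is unchanged when both points are translated by the same integer
    vector, and only points with [Phi] positive compete for the maximum. *)
Lemma doubling_max s1 x1 y1 : 0 <= s1 <= t -> 0 < Phi s1 x1 y1 ->
  exists t0 x0 y0, [/\ 0 <= t0 <= t, 0 < Phi t0 x0 y0 &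
    forall s x y, 0 <= s <= t -> Phi s x y <= Phi t0 x0 y0].
Proof.
move=> s1I P1.
have [B [B0 HB]] := r_bounded tT.
(* Positivity of [Phi] forces |x - y| <= 2 B; with [x] in the unit box this confines [y] to the
   larger one. *)
pose K := `[0, t]%classic `*` (@bbox R n 1 `*` @bbox R n (1 + 2 * B)).
have shiftK s x y : 0 <= s <= t -> 0 < Phi s x y ->
    exists x' y', K (s, (x', y')) /\ Phi s x y = Phi s x' y'.
  move=> sI Pxy; have [k Hk] := int_shift_in_box x.
  have /andP[s0 _] := sI.
  exists (x + \row_i (k i)%:~R), (y + \row_i (k i)%:~R); split; last first.
    rewrite /Phi /r !(periodic_int_shift (solution_periodic sol s0)).
    by rewrite opprD addrACA subrr addr0.
  split; first by rewrite /= in_itv.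
  split=> //= i.
  rewrite (_ : (y + _) 0 i = (x + \row_i (k i)%:~R) 0 i - (x - y) 0 i); last by rewrite !mxE; ring.
  rewrite (le_trans (ler_normB _ _))// lerD//.
  apply: (le_trans (coord_le_enorm _ _)).
  have := HB s x sI; have := HB s y sI; rewrite !ler_norml => /andP[? ?] /andP[? ?].
  have : 0 <= delta * s by rewrite mulr_ge0// ltW.
  move: Pxy; rewrite /Phi; lra.
have [x2 [y2 [K2 P2]]] := shiftK _ _ _ s1I P1.
pose F (p : X) := Phi (Num.max 0 p.1) p.2.1 p.2.2.
have FE s x y : 0 <= s -> F (s, (x, y)) = Phi s x y by move=> s0; rewrite /F /= max_r.
have K0 : K !=set0 by exists (s1, (x2, y2)).
have [||c] := @compact_EVT_max _ _ F K K0.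
- by apply: compact_setX; [exact: segment_compact|apply: compact_setX; exact: compact_bbox].
- apply: continuous_in_subspaceT => -[s [x y]]; rewrite inE => -[/=].
  rewrite in_itv/= => /andP[s0 st] _.
  have sT : 0 <= s <= T by rewrite s0 (le_trans st)//; case/andP: tT.
  pose q : X := (s, (x, y)).
  have c21 : {for q, continuous (fun p : X => p.2.1)} by apply: cvg_comp; [exact: cvg_snd|exact: cvg_fst].
  have c22 : {for q, continuous (fun p : X => p.2.2)} by apply: cvg_comp; [exact: cvg_snd|exact: cvg_snd].
  have cr1 : {for q, continuous (fun p : X => r (Num.max 0 p.1) p.2.1)}.
    exact: (@continuous_doubled1 _ _ (fun p => r (Num.max 0 p.1) p.2) s x y (@continuous_r s x sT)).
  have cr2 : {for q, continuous (fun p : X => r (Num.max 0 p.1) p.2.2)}.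
    exact: (@continuous_doubled2 _ _ (fun p => r (Num.max 0 p.1) p.2) s x y (@continuous_r s y sT)).
  have c3 : {for q, continuous (fun p : X => enorm (p.2.1 - p.2.2))}.
    exact: (continuous_comp (continuousB c21 c22) (@continuous_enorm _ _ _)).
  have c4 : {for q, continuous (fun p : X => delta * Num.max 0 p.1)}.
    have h1 : {for q, continuous (fun _ : X => 0 : R^o)} by exact: cst_continuous.
    have h2 : {for q, continuous (fun p : X => p.1 : R^o)} by exact: cvg_fst.
    have h3 : {for q, continuous (fun p : X => Num.max 0 p.1)} by exact: continuous_max h1 h2.
    have h4 : {for q, continuous (fun _ : X => delta)} by exact: cst_continuous.
    exact: (continuousM h4 h3).
  exact: (continuousB (continuousB (continuousB cr1 cr2) c3) c4).
case: c => t0 [x0 y0]; rewrite inE => -[/= t0I Kc] Hmax.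
rewrite in_itv/= in t0I; have /andP[t00 _] := t0I.
have Ppos : 0 < Phi t0 x0 y0.
  rewrite -(FE _ _ _ t00); apply: (lt_le_trans _ (Hmax (s1, (x2, y2)) _)).
    by rewrite FE; [rewrite -P2|case/andP: s1I].
  by rewrite inE.
exists t0, x0, y0; split=> // s x y sI.
have [Pxy|Pxy] := leP (Phi s x y) 0; first exact: le_trans Pxy (ltW Ppos).
have [x' [y' [K' ->]]] := shiftK _ _ _ sI Pxy.
rewrite -(FE _ _ _ t00) -FE; last by case/andP: sI.
by apply: Hmax; rewrite inE.
Qed.

End doubling.

(* At a positive maximum of [r(s,x) - r(s,y) - |x - y| - delta s] both gradients are
   the unit vector along [x - y], so the reaction terms vanish and the multiplier cancels. *)
Lemma lipschitz_inverse t x y : (forall x y, r 0 x - r 0 y <= enorm (x - y)) ->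
  0 <= t <= T -> r t x - r t y <= enorm (x - y).
Proof.
move=> lip0 tT; have /andP[t_ge0 tleT] := tT; rewrite leNgt; apply/negP => viol.
have t_gt0 : 0 < t.
  rewrite lt_neqAle t_ge0 andbT; apply/eqP => t0; move: viol; rewrite -t0.
  by rewrite ltNge lip0.
pose D := r t x - r t y - enorm (x - y).
have D0 : 0 < D by rewrite subr_gt0.
(* The penalty uses up half of the violation [D] by time [t], so [Phi] is still positive at the
   violating points. *)
pose delta := D / (2 * t).
have delta0 : 0 < delta by rewrite divr_gt0// mulr_gt0.
have dt : delta * t = D / 2 by rewrite /delta; field; exact: lt0r_neq0.
have [||s0 [x0 [y0 [sI Ppos Hmax]]]] := @doubling_max t delta tT delta0 t x y.
- by rewrite t_ge0 lexx.
- by rewrite dt -/D; lra.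
have /andP[s_ge0 st] := sI.
have s_gt0 : 0 < s0.
  rewrite lt_neqAle s_ge0 andbT; apply/eqP => s00; move: Ppos; rewrite -s00 mulr0 subr0.
  by rewrite ltNge subr_le0 lip0.
have s1 z : `|u s0 z| < 1 by apply: u1; rewrite s_ge0 (le_trans st).
have xy : x0 - y0 != 0.
  apply/eqP => xy0; move: Ppos; rewrite xy0 enorm0 (subr0_eq xy0) subrr subr0 sub0r.
  by rewrite oppr_gt0 ltNge mulr_ge0// ltW.
have rho0 := enorm_gt0 xy; pose rho := enorm (x0 - y0).
have rder j z : is_derive z (e_ j) (r s0) (partial j (r s0) z).
  exact: (is_derive_partial_inverse sol).
have rder2 j z : is_derive z (e_ j) (partial j (r s0)) (partial j (partial j (r s0)) z).
  by apply: is_derive_partial; have [] := is_derive_space_inverse2 sol z j s_gt0 s1.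
(* With [y0] fixed, the norm is replaced by its quadratic majorant, which has the same value at
   [x0]; the maximum persists and the function is differentiated in coordinates. *)
have gradx j : partial j (r s0) x0 = (x0 - y0) 0 j / rho.
  have D1 : is_derive x0 (e_ j) (fun z => r s0 z - (2 * rho)^-1 * (\sum_i (z - y0) 0 i ^+ 2 + rho ^+ 2))
     (partial j (r s0) x0 - (2 * rho)^-1 * (2 * (x0 - y0) 0 j + 0)).
    apply: (is_derive_subf (rder j x0)).
    exact: (is_derive_cmulf _ (is_derive_addf (is_derive_sqdist x0 y0 j) (is_derive_cst _ _ _))).
  have := is_derive_at_max D1 => H; apply/eqP; rewrite -subr_eq0; apply/eqP.
  rewrite -[RHS]H; first by congr (_ - _); field; exact: lt0r_neq0.
  move=> z; have := enorm_le_quadratic (z - y0) rho0; rewrite mulrC -/rho.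
  have := Hmax s0 z y0 sI; rewrite -!enorm_sq -/rho.
  rewrite (_ : (2 * rho)^-1 * (rho ^+ 2 + rho ^+ 2) = rho); last by field; exact: lt0r_neq0.
  lra.
(* Moving both points together keeps their difference, hence the norm, constant; the second-order
   conditions then compare the two Laplacians directly. *)
pose w z := r s0 z - r s0 (z + (y0 - x0)).
have wder (f : 'rV[R]_n -> R) j (z : 'rV[R]_n) (df : R) : is_derive (z + (y0 - x0)) (e_ j) f df ->
    is_derive z (e_ j) (fun z => f (z + (y0 - x0))) df.
  move=> /is_derive_line0 H; apply/is_derive_line0.
  by under eq_fun do rewrite addrAC.
have dw j z : is_derive z (e_ j) w (partial j (r s0) z - partial j (r s0) (z + (y0 - x0))).
  exact: (is_derive_subf (rder j z) (wder _ _ _ _ (rder j _))).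
have pw j : partial j w = fun z => partial j (r s0) z - partial j (r s0) (z + (y0 - x0)).
  by apply/funext => z; rewrite {1}/partial; have [_ ->] := dw j z.
have ddw j z : is_derive z (e_ j) (partial j w)
    (partial j (partial j (r s0)) z - partial j (partial j (r s0)) (z + (y0 - x0))).
  rewrite pw; exact: (is_derive_subf (rder2 j z) (wder _ _ _ _ (rder2 j _))).
have wmax z : w z <= w x0.
  have := Hmax s0 z (z + (y0 - x0)) sI.
  by rewrite /w subrKC opprD addNKr opprB; lra.
have hess j : partial j (r s0) x0 = partial j (r s0) y0 /\
    partial j (partial j (r s0)) x0 <= partial j (partial j (r s0)) y0.
  have [] := @partial_at_max _ _ w x0 j.
  - by move=> z; have [] := dw j z.
  - by have [] := ddw j x0.
  - exact: wmax.
  rewrite {2}/partial; have [_ ->] := ddw j x0; rewrite pw subrKC => /eqP.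
  by rewrite subr_eq0 subr_le0 => /eqP.
have dtime : is_derive s0 1 (fun s => r s x0 - r s y0 - delta * s)
   (eps / (1 - u s0 x0 ^+ 2) * derive1 (u^~ x0) s0 -
    eps / (1 - u s0 y0 ^+ 2) * derive1 (u^~ y0) s0 - delta * 1).
  apply: (is_derive_subf _ (is_derive_cmulf _ (is_derive_id _ _))).
  exact: (is_derive_subf (is_derive_time_inverse sol s_gt0 (s1 x0))
    (is_derive_time_inverse sol s_gt0 (s1 y0))).
have := left_derivative_at_max s_gt0 dtime => H.
have {}H : 0 <= eps / (1 - u s0 x0 ^+ 2) * derive1 (u^~ x0) s0 -
    eps / (1 - u s0 y0 ^+ 2) * derive1 (u^~ y0) s0 - delta * 1.
  apply: H => s /andP[s0' ss].
  have := Hmax s x0 y0; rewrite s0' (le_trans ss)// => /(_ isT); lra.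
move: H; rewrite !(equation_inverse eps0 sol)// -/r.
have unit z : z = x0 \/ z = y0 -> \sum_i partial i (r s0) z ^+ 2 = 1.
  move=> zE; rewrite (_ : \sum_i _ = \sum_i ((x0 - y0) 0 i / rho) ^+ 2).
    rewrite (eq_bigr (fun i => (x0 - y0) 0 i ^+ 2 * (rho ^-1) ^+ 2)); last by move=> i _; rewrite exprMn.
    by rewrite -mulr_suml -enorm_sq -exprMn mulfV ?expr1n//; exact: lt0r_neq0.
  apply: eq_bigr => i _; rewrite -gradx; case: zE => -> //.
  by have [-> _] := hess i.
rewrite unit; last by left.
rewrite unit; last by right.
apply: (comparison_contradiction _ delta0).
by apply: ler_sum => i _; have [] := hess i.
Qed.

End lipschitz_bound.

(** Caratheodory's form of the derivative. It turns differentiation under an integral into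
    continuity of the integral of a difference quotient. *)
Lemma is_derive_of_quotient (R : realType) (V J : R -> R) (t0 : R) :
  (\forall t \near t0, V t - V t0 = (t - t0) * J t) -> {for t0, continuous J} ->
  is_derive t0 1 V (J t0).
Proof.
move=> VJ cJ.
suff H : h^-1 *: (V (h%:A + t0) - V t0) @[h --> (0:R)^'] --> J t0.
  by split; [apply/cvg_ex; exists (J t0)|apply/cvg_lim].
have cs : (fun h : R => h + t0) @ (0:R)^' --> t0.
  rewrite -[X in _ --> X]add0r; apply: cvgD; last exact: cvg_cst.
  exact: nbhs_dnbhs.
have cJs : J (h + t0) @[h --> (0:R)^'] --> J t0 by exact: cvg_comp cs cJ.
apply: cvg_trans cJs; apply: near_eq_cvg.
have VJs : \forall h \near (0:R)^', V (h + t0) - V t0 = (h + t0 - t0) * J (h + t0) by exact: cs VJ.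
near=> h.
have h0 : h != 0 by near: h; exact: nbhs_dnbhs_neq.
rewrite [h%:A]mulr1 /GRing.scale /=.
have -> : V (h + t0) - V t0 = (h + t0 - t0) * J (h + t0) by near: h.
by rewrite addrK mulKf.
Unshelve. all: by end_near. Qed.

(** * Conservation of mass and the strict bound on the solution *)

Section torus.
Variables (R : realType) (n : nat).

Lemma torus_box : (torus : set 'rV[R]_n) = [set x | forall i, `[0, 1[%classic (x 0 i)].
Proof. by apply/seteqP; split=> x H i; have := H i; rewrite /= in_itv. Qed.

Lemma measurable_torus : measurable (torus : set 'rV[R]_n).
Proof. by rewrite torus_box; apply: (measurable_box (A := fun=> `[0, 1[%classic)) => i; exact: measurable_itv. Qed.

Lemma torus_bbox : torus `<=` @bbox R n 1.
Proof. by move=> x H i; have /andP[? ?] := H i; rewrite ler_norml; apply/andP; split; lra. Qed.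

Lemma leb_torus : leb R n torus = 1%E.
Proof.
rewrite torus_box (leb_box (A := fun=> `[0, 1[%classic)) => [|i]; last exact: measurable_itv.
by rewrite big1// => i _; rewrite lebesgue_measure_itv/= lte01 oppr0 adde0.
Qed.

(** On the compact box containing [D] the function has a positive minimum, and its constant value
    already integrates to something positive. *)
Lemma Rintegral_gt0 (D : set 'rV[R]_n) (M : R) (f : 'rV[R]_n -> R) :
  measurable D -> D `<=` bbox M -> (0 < leb R n D)%E -> continuous f ->
  (forall x, 0 < f x) -> 0 < \int[leb R n]_(x in D) f x.
Proof.
move=> mD DM D0 cf f0.
have Dfin := leb_bounded_lty mD DM.
have K0 : @bbox R n M !=set0.
  apply/set0P/negP => /eqP M0; move: D0; rewrite (_ : D = set0) ?measure0 ?ltxx//.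
  by apply/seteqP; split=> // x /DM; rewrite M0.
have [c _ cmin] := EVT_min_rV K0 (@compact_bbox R n M) (continuous_subspaceT cf).
have I0 : 0 < \int[leb R n]_(x in D) (f c).
  rewrite Rintegral_cst// mulr_gt0// fine_gt0// D0.
  by move: Dfin; rewrite ltey_eq => /orP[|/eqP] // ->.
apply: (lt_le_trans I0); apply: le_Rintegral => //.
- by apply: (integrable_bounded_domain mD DM (f := fun=> f c)); exact: cst_continuous.
- exact: (integrable_bounded_domain mD DM cf).
- by move=> x /DM xM; apply: cmin; rewrite inE.
Qed.

End torus.

Lemma gradient_lipschitz (R : realType) (n : nat) (f : 'rV[R]_n -> R) : Ck 1 f ->
  (forall x, enorm (grad f x) <= 1) -> forall x y, f x - f y <= enorm (x - y).
Proof.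
move=> [_ C1] gf x y.
have dl (t : R) : is_derive t 1 (fun h : R => f (y + h *: (x - y)))
    (\sum_i (x - y) 0 i * partial i f (y + t *: (x - y))).
  apply: (iffLR (is_derive_line _ _ _ _ _)); apply: C1_is_derive => [i z|i].
    by have [+ _] := C1 i; apply.
  by have [_] := C1 i.
have [t [_]] := MVT0 1 dl; rewrite scale1r scale0r addr0 subrKC mulr1 => ->.
apply: dot_le_enorm.
have := gf (y + t *: (x - y)).
rewrite -(@ler_pXn2r _ 2) ?nnegrE ?enorm_ge0// enorm_sq expr1n.
by under eq_bigr do rewrite mxE.
Qed.

Section range.
Variables (R : realType) (n : nat) (eps : R) (rbar : 'rV[R]_n -> R) (u : R -> 'rV[R]_n -> R).
Hypotheses (eps0 : 0 < eps) (C1r : Ck 1 rbar) (gr : forall x, enorm (grad rbar x) <= 1).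
Hypothesis sol : allen_cahn_solution eps (fun x => profile eps (rbar x)) u.
Local Notation e_ i := (@delta_mx R 1 n 0 i).
Local Notation A := (inverse_profile eps).

Lemma initial_value x : u 0 x = profile eps (rbar x).
Proof. by case: sol. Qed.

Lemma initial_lipschitz x y : A (u 0 x) - A (u 0 y) <= enorm (x - y).
Proof. by rewrite !initial_value !profileK//; exact: gradient_lipschitz. Qed.

Lemma integral_sub_sq_gt0 t : 0 < t -> (forall z, `|u t z| < 1) ->
  0 < \int[leb R n]_(x in torus) ((1 - u t x ^+ 2) ^+ 2 / 2).
Proof.
move=> t0 u1.
have cu : continuous (u t).
  by apply: (continuous_slice (F := fun p => u p.1 p.2)) => x; exact: (continuous_solution sol).
apply: (Rintegral_gt0 (@measurable_torus R n) (@torus_bbox R n)).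
- by rewrite leb_torus lte01.
- by apply: continuous_at_points => x; prove_continuous; exact: cu.
- by move=> x; rewrite divr_gt0// exprn_gt0// one_sub_sq_gt0.
Qed.

(** The integrand is the time derivative of u - u^3 / 3. After substituting the equation, [lambda]
    is precisely the quotient that makes the integral vanish. *)
Lemma mass_rate t : 0 < t -> (forall z, `|u t z| < 1) ->
  \int[leb R n]_(x in torus) (derive1 (u^~ x) t * (1 - u t x ^+ 2)) = 0.
Proof.
move=> t0 u1; have b0 := integral_sub_sq_gt0 t0 u1.
have cu : continuous (u t).
  by apply: (continuous_slice (F := fun p => u p.1 p.2)) => x; exact: (continuous_solution sol).
have cp : continuous (fun x => 1 - u t x ^+ 2).
  by apply: continuous_at_points => x; prove_continuous; exact: cu.
have cl : continuous (laplacian (u t)).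
  apply: continuous_at_points => x; apply: continuous_sumf => i.
  by apply: (continuous_slice (F := fun p => partial i (partial i (u p.1)) p.2)) => z; exact: (continuous_partial2 sol).
pose a x := (1 - u t x ^+ 2) * (eps * laplacian (u t) x + 2 * u t x * (1 - u t x ^+ 2) / eps).
pose b x := (1 - u t x ^+ 2) ^+ 2 / 2.
have ca : continuous a.
  apply: continuous_at_points => x; apply: continuous_mulf; first exact: cp.
  by prove_continuous; [exact: cl|exact: cu|exact: cu].
have cb : continuous b.
  by rewrite /b; apply: continuous_at_points => x; prove_continuous; exact: cu.
have ia := integrable_bounded_domain (@measurable_torus R n) (@torus_bbox R n) ca.
have ib := integrable_bounded_domain (@measurable_torus R n) (@torus_bbox R n) cb.
have eN := lt0r_neq0 eps0.
transitivity (\int[leb R n]_(x in torus) (eps^-1 * a x + (eps^-1 * (lambda eps (u t) * 2)) * b x)).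
  apply: eq_Rintegral => x _; rewrite (@equation_bounded _ _ _ _ _ eps0 sol t x t0) => [|z]; last exact/ltW.
  by rewrite /a /b; field.
have cc (c : R) (f : 'rV[R]_n -> R) : continuous f -> continuous (fun x => c * f x).
  by move=> cf; apply: continuous_at_points => x; prove_continuous; exact: cf.
have ic c f cf := integrable_bounded_domain (@measurable_torus R n) (@torus_bbox R n) (cc c f cf).
rewrite RintegralD//; [|exact: measurable_torus|exact: ic|exact: ic].
rewrite !RintegralZl//; [|exact: measurable_torus..].
rewrite lambda_of_bounded => [|z]; last exact: ltW.
rewrite -/(a _) -/(b _).
by field; rewrite eN/= gt_eqF.
Qed.

(* [2/3 - k (s - s^3/3)] for the two signs [k]: the conserved density, which vanishes
   exactly at [s = k]. *)
Definition mass_density (k s : R) := (1 - k * s) ^+ 2 * (2 + k * s) / 3.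

Let continuous_mass_density k : continuous (mass_density k).
Proof.
rewrite /mass_density; apply: continuous_at_points => s; prove_continuous; exact: cvg_id.
Qed.

Let mass k t := \int[leb R n]_(x in torus) mass_density k (u (Num.max 0 t) x).

Let continuous_mass k : continuous (mass k).
Proof.
move=> t.
have ti : t - 1 < t < t + 1 by apply/andP; split; lra.
apply: (continuous_integral_param (@measurable_torus R n) (@torus_bbox R n)
  (F := fun p => mass_density k (u (Num.max 0 p.1) p.2)) _ ti) => s x _.
apply: (@continuous_comp _ _ _ (fun p : R * 'rV[R]_n => u (Num.max 0 p.1) p.2)).
  exact: (continuous_clamped_solution sol).
exact: continuous_mass_density.
Qed.

(** The derivative vanishes on the open interval, and continuity of the mass carries the value to
    [T], the time at which the strict bound may fail. *)
Lemma mass_conserved k T : k = 1 \/ k = -1 -> 0 < T ->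
  (forall t x, 0 <= t < T -> `|u t x| < 1) -> mass k T = mass k 0.
Proof.
move=> kk T0 u1.
have dm t : t \in `]0, T[ -> is_derive t 1 (mass k) 0.
  rewrite in_itv/= => /andP[t0 tT].
  have ut z : `|u t z| < 1 by apply: u1; rewrite (ltW t0).
  (* The divided difference of [mass_density k], which for k^2 = 1 is 2/3 - k (s - s^3 / 3). *)
  pose P a b : R := - k * (1 - (a ^+ 2 + a * b + b ^+ 2) / 3).
  have PE a b : mass_density k a - mass_density k b = (a - b) * P a b.
    by rewrite /mass_density /P; case: kk => ->; field.
  pose Q (p : R * 'rV[R]_n) := diff_quotient u t p.1 p.2 * P (u p.1 p.2) (u t p.2).
  pose J s := \int[leb R n]_(x in torus) Q (s, x).
  have cu s x : 0 < s < T -> {for (s, x), continuous (fun p : R * 'rV[R]_n => u p.1 p.2)}.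
    by move=> /andP[s0 _]; exact: (continuous_solution sol).
  have cus : continuous (u t).
    by apply: (continuous_slice (F := fun p => u p.1 p.2)) => x; exact: (continuous_solution sol).
  have cQ s x : 0 < s < T -> {for (s, x), continuous Q}.
    move=> sI; apply: continuous_mulf.
      apply: (continuous_diff_quotient (a := 0) (b := T)) => //.
      + by move=> t' x' /andP[t'0 _]; exact: (derivable_time sol).
      + by move=> t' x' /andP[t'0 _]; exact: (continuous_time_derivative sol).
      + by rewrite t0 tT.
    have c1 : {for (s, x), continuous (fun p : R * 'rV[R]_n => u p.1 p.2)} by exact: cu.
    have c2 : {for (s, x), continuous (fun p : R * 'rV[R]_n => u t p.2)}.
      apply: (@continuous_comp _ _ _ snd (u t)); [exact: cvg_snd|exact: cus].
    by rewrite /P; prove_continuous.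
  have J0 : J t = 0.
    have := mass_rate t0 ut => H.
    transitivity (- k * \int[leb R n]_(x in torus) (derive1 (u^~ x) t * (1 - u t x ^+ 2))); last by rewrite H mulr0.
    rewrite -RintegralZl//.
    - apply: eq_Rintegral => x _; rewrite /Q /= /diff_quotient eqxx /P; by field.
    - exact: measurable_torus.
    - apply: (integrable_bounded_domain (@measurable_torus R n) (@torus_bbox R n)).
      apply: continuous_at_points => x; apply: continuous_mulf.
        apply: (continuous_slice (F := fun p => derive1 (u^~ p.2) p.1)) => z.
        exact: (continuous_time_derivative sol).
      by prove_continuous; exact: cus.
  rewrite -J0; apply: is_derive_of_quotient; last first.
    apply: (continuous_integral_param (@measurable_torus R n) (@torus_bbox R n) cQ).
    by rewrite t0 tT.
  have near_pos : \forall s \near t, 0 < s < T.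
    by apply: filterS2 (lt_nbhsr t0) (lt_nbhsl tT) => s -> ->.
  apply: filterS near_pos => s /andP[s0 sT].
  have cslice s' : 0 < s' -> (leb R n).-integrable torus (EFin \o (fun x => mass_density k (u (Num.max 0 s') x))).
    move=> s'0; apply: (integrable_bounded_domain (@measurable_torus R n) (@torus_bbox R n)).
    apply: (continuous_slice (F := fun p => mass_density k (u (Num.max 0 p.1) p.2))) => x.
    apply: (@continuous_comp _ _ _ (fun p : R * 'rV[R]_n => u (Num.max 0 p.1) p.2)).
      exact: (continuous_clamped_solution sol).
    exact: continuous_mass_density.
  rewrite /mass -RintegralB//; [|exact: measurable_torus|exact: cslice|exact: cslice].
  rewrite /J -RintegralZl//; last first.
  - apply: (integrable_bounded_domain (@measurable_torus R n) (@torus_bbox R n)).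
    by apply: continuous_slice => x; apply: cQ; rewrite s0 sT.
  - exact: measurable_torus.
  apply: eq_Rintegral => x _; rewrite !max_r ?ltW// PE /Q /= mulrA.
  by rewrite diff_quotientE.
have [|c _] := MVT T0 dm; first by apply: continuous_subspaceT; exact: continuous_mass.
by rewrite mul0r => /eqP; rewrite subr_eq0 => /eqP.
Qed.

Lemma nbhs_left_witness (P : R -> Prop) (T : R) : 0 < T -> (\forall s \near T, P s) ->
  exists2 s, 0 <= s < T & P s.
Proof.
move=> T0 [r /= r0 Hr].
pose s := T - Num.min (r / 2) T.
have m1 : Num.min (r / 2) T <= r / 2 by rewrite ge_min lexx.
have m2 : Num.min (r / 2) T <= T by rewrite ge_min lexx orbT.
have m3 : 0 < Num.min (r / 2) T by rewrite lt_min T0 divr_gt0.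
exists s; first by rewrite /s; apply/andP; split; lra.
by apply: Hr; rewrite /ball_ /= /s subKr gtr0_norm//; lra.
Qed.

(** As [v] tends to 1 its inverse profile becomes unbounded, whereas that of [w] would stay bounded
    if w(T) < 1. Their difference is at most [L], so this is impossible. *)
Lemma saturation_propagates (v w : R -> R) (T L : R) : 0 < T ->
  {for T, continuous v} -> {for T, continuous w} ->
  (forall s, 0 <= s < T -> `|v s| < 1) -> (forall s, 0 <= s < T -> `|w s| < 1) ->
  (forall s, 0 <= s < T -> A (v s) - A (w s) <= L) -> v T = 1 -> w T <= 1 -> w T = 1.
Proof.
move=> T0 cv cw v1 w1 vw vT wT1; apply/eqP; rewrite eq_le wT1 /= leNgt; apply/negP => wT.
pose c := (w T + 1) / 2.
(* While w < c, the inverse profile of [v] is at most L + A(c), which gives (1 + v) e <= 1 - v. This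
   fails as soon as v > 0 and 1 - v < e. *)
pose e := expR (- (2 * (L + A c) / eps)).
have e0 : 0 < e by exact: expR_gt0.
have wc : \forall s \near T, w s < c by apply: (cvgr_lt _ cw); rewrite /c; lra.
have ve : \forall s \near T, 1 - e < v s by apply: (cvgr_gt _ cv); rewrite vT; lra.
have v0 : \forall s \near T, 0 < v s by apply: (cvgr_gt _ cv); rewrite vT; lra.
have [s sI [ws vs vs0]] : exists2 s, 0 <= s < T & [/\ w s < c, 1 - e < v s & 0 < v s].
  by apply: nbhs_left_witness => //; near=> s; split; near: s.
have Aw : A (w s) <= A c.
  by apply: inverse_profile_mono => //; [exact: w1|exact: ltW|rewrite /c; lra].
have Av : A (v s) <= L + A c by have := vw s sI; lra.
have := inverse_profile_le eps0 (v1 s sI) Av; rewrite -/e.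
have : 0 < v s * e by rewrite mulr_gt0.
lra.
Unshelve. all: by end_near. Qed.

Let continuous_time x : continuous (fun s : R => u (Num.max 0 s) x).
Proof.
move=> s.
apply: (@continuous_uncurry_at _ _ _ _ id (fun=> x) (fun p : R * 'rV[R]_n => u (Num.max 0 p.1) p.2) s).
- exact: cvg_id.
- exact: cst_continuous.
- exact: (continuous_clamped_solution sol).
Qed.

(** The sign [k] treats both saturation values at once, the inverse profile being odd. Saturation
    everywhere would make the nonnegative mass for [k] vanish at [T], while it is positive at time
    0. *)
Let no_saturation k T xT : k = 1 \/ k = -1 -> 0 < T ->
  (forall t x, 0 <= t < T -> `|u t x| < 1) -> k * u T xT = 1 -> False.
Proof.
move=> kk T0 u1 uT.
have lip s y : 0 <= s < T -> A (k * u s xT) - A (k * u s y) <= enorm (xT - y).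
  move=> sI; have /andP[s0 sT] := sI.
  have us t x : 0 <= t <= s -> `|u t x| < 1.
    by move=> /andP[t0 ts]; apply: u1; rewrite t0 (le_lt_trans ts).
  have ss : 0 <= s <= s by rewrite s0 lexx.
  case: kk => ->; rewrite ?mul1r ?mulN1r.
    exact: (lipschitz_inverse eps0 sol us xT y initial_lipschitz ss).
  have := lipschitz_inverse eps0 sol us y xT initial_lipschitz ss.
  by rewrite enorm_distC !(inverse_profileN eps); lra.
have kabs a : `|k * a| = `|a| by case: kk => ->; rewrite ?mul1r ?mulN1r ?normrN.
have TT : Num.max 0 T = T by rewrite max_r// ltW.
have cv x : {for T, continuous (fun s : R => k * u (Num.max 0 s) x)}.
  by prove_continuous; exact: continuous_time.
have uT1 x : k * u T x <= 1.
  rewrite leNgt; apply/negP => H.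
  have near_gt : \forall s \near T, 1 < k * u (Num.max 0 s) x.
    by apply: (cvgr_gt _ (cv x)); rewrite TT.
  have [s sI] := nbhs_left_witness T0 near_gt.
  have /andP[s0 sT] := sI; rewrite max_r// => H1.
  by have := u1 s x sI; rewrite -kabs ltr_norml => /andP[_]; lra.
have all1 y : k * u T y = 1.
  have maxs s : 0 <= s < T -> Num.max 0 s = s by move=> /andP[s0 _]; rewrite max_r.
  have := @saturation_propagates (fun s : R => k * u (Num.max 0 s) xT)
    (fun s : R => k * u (Num.max 0 s) y) T (enorm (xT - y)) T0 (cv xT) (cv y).
  rewrite TT; apply => //.
  - by move=> s sI; rewrite maxs// kabs; exact: u1.
  - by move=> s sI; rewrite maxs// kabs; exact: u1.
  - by move=> s sI; rewrite maxs//; exact: lip.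
have := mass_conserved kk T0 u1.
have -> : mass k T = 0.
  rewrite /mass TT; rewrite (eq_Rintegral _ (g := fun=> 0)).
    by rewrite Rintegral_cst ?mul0r//; exact: measurable_torus.
  by move=> x _; rewrite /mass_density all1 subrr expr0n !mul0r.
suff : 0 < mass k 0 by move=> + /eqP; rewrite eq_sym => /gt_eqF ->.
rewrite /mass maxxx; apply: (Rintegral_gt0 (@measurable_torus R n) (@torus_bbox R n)).
- by rewrite leb_torus lte01.
- move=> x; apply: (continuous_comp (f := u 0) (g := mass_density k)); last exact: continuous_mass_density.
  have := (continuous_slice (F := fun p => u (Num.max 0 p.1) p.2) (t := 0)); rewrite /= maxxx; apply => z.
  exact: (continuous_clamped_solution sol).
- move=> x; have := u1 0 x; rewrite lexx T0 -kabs ltr_norml => /(_ isT)/andP[? ?].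
  by rewrite /mass_density divr_gt0// mulr_gt0// ?exprn_gt0//; lra.
Qed.

Lemma solution_lt1 t x : 0 <= t -> `|u t x| < 1.
Proof.
move=> t0; rewrite ltNge; apply/negP => viol.
pose G (p : R * 'rV[R]_n) := `|u (Num.max 0 p.1) p.2|.
have cG : continuous G.
  move=> p; apply: (@continuous_comp _ _ _ (fun p : R * 'rV[R]_n => u (Num.max 0 p.1) p.2)).
    exact: (continuous_clamped_solution sol).
  exact: norm_continuous.
(* By periodicity all failures are seen in the unit box. There they form a compact set, and the
   minimum of its time coordinate is the first time of failure. *)
pose K := (`[0, t] `*` @bbox R n 1) `&` (G @^-1` [set a | 1 <= a]).
have cK : compact K.
  apply: compact_closedI.
    by apply: compact_setX; [exact: segment_compact|exact: compact_bbox].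
  by apply: closed_comp; [move=> p _; exact: cG|exact: closed_ge].
have inK s z : 0 <= s <= t -> 1 <= `|u s z| -> exists z', K (s, z') /\ u s z' = u s z.
  move=> sI H; have [k Hk] := int_shift_in_box z; have /andP[s0 _] := sI.
  exists (z + \row_i (k i)%:~R); rewrite (periodic_int_shift (solution_periodic sol s0)).
  split=> //; split; first by split=> //=; rewrite in_itv.
  by rewrite /G /= max_r// (periodic_int_shift (solution_periodic sol s0)).
have [|z [Kz _]] := inK t x _ viol; first by rewrite t0 lexx.
have K0 : K !=set0 by exists (t, z).
have cfst : {within K, continuous (fst : R * 'rV[R]_n -> R)}.
  by apply: continuous_subspaceT => p; exact: cvg_fst.
have [[T xT]] := compact_EVT_min K0 cK cfst.
rewrite inE => -[[/= TI _] uT] Tmin; rewrite in_itv/= in TI; have /andP[T0 Tt] := TI.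
rewrite /G /= max_r// in uT.
have u1 s y : 0 <= s < T -> `|u s y| < 1.
  move=> /andP[s0 sT]; rewrite ltNge; apply/negP => H.
  have [|y' [Ky _]] := inK s y _ H; first by rewrite s0 (le_trans (ltW sT)).
  by have := Tmin (s, y'); rewrite inE => /(_ Ky) /=; rewrite leNgt sT.
have T_gt0 : 0 < T.
  rewrite lt_neqAle T0 andbT; apply/eqP => T00; move: uT; rewrite -T00 initial_value.
  by rewrite leNgt profile_lt1.
have TT : Num.max 0 T = T by rewrite max_r.
have uT1 : `|u T xT| <= 1.
  rewrite leNgt; apply/negP => H.
  have near_gt : \forall s \near T, 1 < `|u (Num.max 0 s) xT|.
    have cn : {for T, continuous (fun s : R => `|u (Num.max 0 s) xT|)}.
      apply: (@continuous_comp _ _ _ (fun s : R => u (Num.max 0 s) xT)).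
        exact: continuous_time.
      exact: norm_continuous.
    by apply: (cvgr_gt _ cn); rewrite TT.
  have [s sI] := nbhs_left_witness T_gt0 near_gt.
  have /andP[s0 sT] := sI; rewrite max_r// => H1.
  by have := u1 s xT sI; rewrite ltNge (ltW H1).
have uTE : `|u T xT| = 1 by apply/eqP; rewrite eq_le uT1.
have [uge0|ult0] := leP 0 (u T xT).
  by apply: (no_saturation (or_introl erefl) T_gt0 u1 (xT := xT)); rewrite mul1r -uTE ger0_norm.
by apply: (no_saturation (or_intror erefl) T_gt0 u1 (xT := xT)); rewrite mulN1r -uTE ltr0_norm.
Qed.

Lemma solution_lipschitz t x y : 0 <= t -> A (u t x) - A (u t y) <= enorm (x - y).
Proof.
move=> t0; apply: (lipschitz_inverse eps0 sol (T := t)); last by rewrite t0 lexx.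
  by move=> s z /andP[s0 _]; exact: solution_lt1.
exact: initial_lipschitz.
Qed.

(** The gradient of the inverse profile is eps / (1 - u^2) times grad u. The Lipschitz bound, tested
    in the direction [v] of this gradient itself, gives |v|^2 <= |v|, hence |v| <= 1. *)
Lemma discrepancy_le0 t x : 0 < t ->
  eps ^+ 2 * (\sum_i partial i (u t) x ^+ 2) <= (1 - u t x ^+ 2) ^+ 2.
Proof.
move=> t0; have ut z : `|u t z| < 1 by apply: solution_lt1; exact: ltW.
have p := one_sub_sq_gt0 (ut x).
pose r z := A (u t z).
pose v : 'rV[R]_n := \row_i partial i r x.
have dr z i : is_derive z (e_ i) r (partial i r z).
  by apply: (is_derive_partial_inverse sol) => //; exact: ltW.
have pr i z : partial i r z = eps / (1 - u t z ^+ 2) * partial i (u t) z.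
  by rewrite (partial_inverse sol)// ltW.
have cr i : continuous (partial i r).
  rewrite (_ : partial i r = fun z => eps / (1 - u t z ^+ 2) * partial i (u t) z); last first.
    by apply/funext => z; exact: pr.
  have cu : continuous (u t).
    by apply: (continuous_slice (F := fun p => u p.1 p.2)) => z; exact: (continuous_solution sol).
  apply: continuous_at_points => z; prove_continuous.
    apply: continuous_invf; first by apply: lt0r_neq0; exact: one_sub_sq_gt0.
    by prove_continuous; exact: cu.
  by apply: (continuous_slice (F := fun p => partial i (u p.1) p.2)) => z'; exact: (continuous_partial sol).
have dv : is_derive x v r (\sum_i v 0 i * partial i r x).
  by apply: C1_is_derive => // i z; have [] := dr z i.
have vv : \sum_i v 0 i * partial i r x = enorm v ^+ 2.
  by rewrite enorm_sq; apply: eq_bigr => i _; rewrite mxE expr2.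
have v1 : enorm v <= 1.
  (* Over h <= 0 this function is largest at 0 by the Lipschitz bound, so its left derivative there
     is nonnegative. *)
  have d0 : is_derive (0 : R) 1 (fun h : R => enorm v * h - r (x + h *: v)) (enorm v * 1 - enorm v ^+ 2).
    rewrite -vv; apply: (is_derive_subf (is_derive_cmulf (enorm v) (is_derive_id _ _))).
    exact: (iffLR (is_derive_line0 _ _ _ _)).
  have := left_derivative_at_max (ltrN10 R) d0; rewrite mulr1 => H.
  have {}H : 0 <= enorm v - enorm v ^+ 2.
    apply: H => h /andP[_ h0]; rewrite mulr0 scale0r addr0 sub0r.
    have := solution_lipschitz x (x + h *: v) (ltW t0); rewrite -/(r _) -/(r _).
    rewrite opprD addrA subrr sub0r enormN enormZ ler0_norm//; lra.
  have [v0|v0] := eqVneq (enorm v) 0; first by rewrite v0.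
  have vp : 0 < enorm v by rewrite lt_neqAle eq_sym v0 enorm_ge0.
  by rewrite -(ler_pM2l vp) mulr1 -expr2 -subr_ge0.
have : enorm v ^+ 2 <= 1 by rewrite expr_le1 ?enorm_ge0.
rewrite enorm_sq (eq_bigr (fun i => (eps / (1 - u t x ^+ 2)) ^+ 2 * partial i (u t) x ^+ 2)).
  by rewrite -mulr_sumr exprMn exprVn mulrAC ler_pdivrMr ?exprn_gt0// mul1r.
by move=> i _; rewrite mxE pr exprMn.
Qed.

End range.

Lemma sum_linear5 (R : comRingType) n (a1 a2 a3 a4 a5 : R) (f1 f2 f3 f4 f5 : 'I_n -> R) :
  \sum_i (a1 * f1 i + (a2 * f2 i + (a3 * f3 i + (a4 * f4 i + a5 * f5 i)))) =
  a1 * (\sum_i f1 i) + (a2 * (\sum_i f2 i) + (a3 * (\sum_i f3 i) + (a4 * (\sum_i f4 i) + a5 * (\sum_i f5 i)))).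
Proof. by rewrite !big_split !mulr_sumr. Qed.

(** * Time derivative of the weighted energy *)

Lemma Rintegral_divergence0 (R : realType) n (M : R) (F dF : 'I_n -> 'rV[R]_n -> R) : 0 <= M ->
  (forall i x, is_derive x (delta_mx 0 i) (F i) (dF i x)) ->
  (forall i, continuous (dF i)) -> (forall i x, ~ bbox M x -> F i x = 0) ->
  \int[leb R n]_(x in bbox M) (\sum_i dF i x) = 0.
Proof.
move=> M0 DF cF F0.
have pE i : partial i (F i) = dF i.
  by apply/funext => x; rewrite /partial; have [_ ->] := DF i x.
have one i : \int[leb R n]_(x in bbox M) dF i x = 0.
  rewrite -pE /Rintegral integral_mkcond.
  rewrite (_ : (_ \_ _) = fun x => (partial i (F i) x)%:E); last first.
    apply/funext => x; rewrite patchE; case: ifPn => //; rewrite notin_setE => nx.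
    by rewrite (partial_outside i (F0 i)).
  rewrite (@integral_partial0 _ _ (F i) i M)//.
  - by rewrite pE.
  - exact: F0.
have int_dF i : (leb R n).-integrable (bbox M) (EFin \o dF i).
  exact: (integrable_bounded_domain (@measurable_bbox R n M) (@subset_refl _ _)).
elim: (index_enum _) => [|i s IHs].
  under eq_Rintegral do rewrite big_nil.
  by rewrite Rintegral_cst ?mul0r//; exact: measurable_bbox.
under eq_Rintegral do rewrite big_cons.
rewrite RintegralD//; first by rewrite one IHs addr0.
- exact: measurable_bbox.
- apply: (integrable_bounded_domain (@measurable_bbox R n M) (@subset_refl _ _)
    (f := fun x => \sum_(j <- s) dF j x)).
  by apply: continuous_at_points => x; prove_continuous; exact: cF.
Qed.

Section weighted_energy.
Variables (R : realType) (n : nat) (eps : R) (u0 : 'rV[R]_n -> R) (u : R -> 'rV[R]_n -> R).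
Hypotheses (eps0 : 0 < eps) (sol : allen_cahn_solution eps u0 u).
Local Notation e_ i := (@delta_mx R 1 n 0 i).

(** The normalization [sigma^-1] is left out; it is a common factor of both sides of the final
    inequality. *)
Definition energy_density t x :=
  eps * (\sum_i partial i (u t) x ^+ 2) / 2 + (1 - u t x ^+ 2) ^+ 2 / 2 / eps.

Lemma energy_densityE t x :
  eps * enorm (grad (u t) x) ^+ 2 / 2 + W (u t x) / eps = energy_density t x.
Proof.
rewrite /energy_density /W enorm_sq; congr (_ * _ / _ + _).
by apply: eq_bigr => i _; rewrite mxE.
Qed.

Lemma energy_density_ge0 t x : 0 <= energy_density t x.
Proof.
have e0 := ltW eps0.
apply: addr_ge0; last by rewrite !divr_ge0// sqr_ge0.
by rewrite divr_ge0// mulr_ge0// sumr_ge0// => i _; exact: sqr_ge0.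
Qed.

Lemma continuous_energy_density t x : 0 < t ->
  {for (t, x), continuous (fun p : R * 'rV[R]_n => energy_density p.1 p.2)}.
Proof.
move=> t0; have cu := @continuous_solution _ _ _ _ _ sol t x t0.
have cp i := @continuous_partial _ _ _ _ _ sol i t x t0.
by rewrite /energy_density; prove_continuous; [exact: cp|exact: cu].
Qed.

(** This is eps Laplacian(u) - W'(u) / eps, the negative first variation of the energy. *)
Definition curvature_term t x := eps * laplacian (u t) x + 2 * u t x * (1 - u t x ^+ 2) / eps.

Variables (rho : R -> 'rV[R]_n -> R) (s M : R).
Hypothesis M0 : 0 <= M.
Hypothesis crho : forall t x, 0 < t < s -> {for (t, x), continuous (fun p : R * 'rV[R]_n => rho p.1 p.2)}.
Hypothesis drho : forall t x, 0 < t < s -> derivable (rho^~ x) t 1.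
Hypothesis cdrho : forall t x, 0 < t < s ->
  {for (t, x), continuous (fun p : R * 'rV[R]_n => derive1 (rho^~ p.2) p.1)}.
Hypothesis prho : forall t x i, 0 < t < s -> derivable (rho t) x (e_ i).
Hypothesis pprho : forall t x i j, 0 < t < s -> derivable (partial j (rho t)) x (e_ i).
Hypothesis cprho : forall t i, 0 < t < s -> continuous (partial i (rho t)).
Hypothesis cpprho : forall t i j, 0 < t < s -> continuous (partial i (partial j (rho t))).
Hypothesis rho_out : forall t x, 0 < t < s -> ~ bbox M x -> rho t x = 0.

Definition weighted_energy t := \int[leb R n]_(x in bbox M) (rho t x * energy_density t x).

Let g t x := \sum_k partial k (rho t) x * partial k (u t) x.

(* The divergence of [eps (grad rho . grad u) grad u - e grad rho]. *)
Definition stress_divergence t x := curvature_term t x * g t x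
  + eps * (\sum_j \sum_k partial j (partial k (rho t)) x * (partial j (u t) x * partial k (u t) x))
  - energy_density t x * laplacian (rho t) x.

(** The first two terms are the integrand of the time derivative of int rho e once the gradient has
    been moved off u_t. The last one integrates to zero and is subtracted to make a pointwise
    estimate possible. *)
Definition energy_rate t x := derive1 (rho^~ x) t * energy_density t x
  - derive1 (u^~ x) t * (rho t x * curvature_term t x + eps * g t x)
  - stress_divergence t x.

Let cus t : 0 < t -> continuous (u t).
Proof. by move=> t0; apply: (continuous_slice (F := fun p => u p.1 p.2)) => x; exact: (continuous_solution sol). Qed.

Let cpus t i : 0 < t -> continuous (partial i (u t)).
Proof. by move=> t0; apply: (continuous_slice (F := fun p => partial i (u p.1) p.2)) => x; exact: (continuous_partial sol). Qed.

Let cppus t i j : 0 < t -> continuous (partial i (partial j (u t))).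
Proof. by move=> t0; apply: (continuous_slice (F := fun p => partial i (partial j (u p.1)) p.2)) => x; exact: (continuous_partial2 sol). Qed.

Let crhos t : 0 < t < s -> continuous (rho t).
Proof. by move=> tI; apply: (continuous_slice (F := fun p => rho p.1 p.2)) => x; exact: crho. Qed.

Let integrable_bbox (f : 'rV[R]_n -> R) : continuous f -> (leb R n).-integrable (bbox M) (EFin \o f).
Proof. by move=> cf; exact: (integrable_bounded_domain (@measurable_bbox R n M) (@subset_refl _ _) cf). Qed.

Ltac solution_leaf := lazymatch goal with
  |- prop_for _ (inPhantom (forall x, continuous_at x ?F)) => lazymatch F with
  | (fun z => partial _ (partial _ (u _)) z) => exact: cppus
  | (fun z => partial _ (partial _ (rho _)) z) => exact: cpprho
  | (fun z => partial _ (u _) z) => exact: cpus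
  | (fun z => partial _ (rho _) z) => exact: cprho
  | (fun z => u _ z) => exact: cus
  | (fun z => rho _ z) => exact: crhos
  end end.

Lemma integral_stress_divergence t : 0 < t < s ->
  \int[leb R n]_(x in bbox M) stress_divergence t x = 0.
Proof.
move=> tI; have /andP[t0 ts] := tI.
have du i x : is_derive x (e_ i) (u t) (partial i (u t) x).
  by apply: is_derive_partial; apply: (derivable_solution sol); exact: ltW.
have ddu i j x : is_derive x (e_ i) (partial j (u t)) (partial i (partial j (u t)) x).
  by apply: is_derive_partial; exact: (derivable_partial sol).
have dr i x : is_derive x (e_ i) (rho t) (partial i (rho t) x).
  by apply: is_derive_partial; exact: prho.
have ddr i j x : is_derive x (e_ i) (partial j (rho t)) (partial i (partial j (rho t)) x).
  by apply: is_derive_partial; exact: pprho.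
have dg j x : is_derive x (e_ j) (g t) (\sum_k (partial j (partial k (rho t)) x * partial k (u t) x
     + partial k (rho t) x * partial j (partial k (u t)) x)).
  by apply: is_derive_sumf => k; exact: is_derive_mulf (ddr _ _ _) (ddu _ _ _).
pose de j x := eps * (\sum_k 2 * partial k (u t) x * partial j (partial k (u t)) x) / 2
   - 2 * u t x * (1 - u t x ^+ 2) / eps * partial j (u t) x.
have dens j x : is_derive x (e_ j) (energy_density t) (de j x).
  have d1 := is_derive_sumf (index_enum _) (fun k => is_derive_sqrf (ddu j k x)).
  have d2 : is_derive x (e_ j) (fun z => 1 - u t z ^+ 2) (0 - 2 * u t x * partial j (u t) x).
    exact: (is_derive_subf (is_derive_cst _ _ _) (is_derive_sqrf (du j x))).
  have d3 := is_derive_addf (is_derive_cmulf 2^-1 (is_derive_cmulf eps d1))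
    (is_derive_cmulf eps^-1 (is_derive_cmulf 2^-1 (is_derive_sqrf d2))).
  rewrite (_ : energy_density t = fun z => 2^-1 * (eps * (\sum_(i <- index_enum _) partial i (u t) z ^+ 2)) +
       eps^-1 * (2^-1 * (1 - u t z ^+ 2) ^+ 2)); last first.
    by apply/funext => z; rewrite /energy_density [_ / 2]mulrC [_ / 2]mulrC [_ / eps]mulrC.
  rewrite (_ : de j x = 2^-1 * (eps * (\sum_(i <- index_enum _) 2 * partial i (u t) x * partial j (partial i (u t)) x)) +
       eps^-1 * (2^-1 * (2 * (1 - u t x ^+ 2) * (0 - 2 * u t x * partial j (u t) x)))) //.
  rewrite /de; move: (\sum_(i <- _) _) => S; field.
  exact: lt0r_neq0.
pose F j x := eps * partial j (u t) x * g t x - energy_density t x * partial j (rho t) x.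
pose dF j x := eps * partial j (partial j (u t)) x * g t x +
   eps * partial j (u t) x * (\sum_k (partial j (partial k (rho t)) x * partial k (u t) x
     + partial k (rho t) x * partial j (partial k (u t)) x)) -
   (de j x * partial j (rho t) x + energy_density t x * partial j (partial j (rho t)) x).
have DF j x : is_derive x (e_ j) (F j) (dF j x).
  apply: is_derive_subf.
    exact: (is_derive_mulf (is_derive_cmulf eps (ddu j j x)) (dg j x)).
  exact: (is_derive_mulf (dens j x) (ddr j j x)).
rewrite -[RHS](@Rintegral_divergence0 _ _ M F dF M0 DF); first last.
- move=> i x nx; rewrite /F /g (partial_outside i (fun z => rho_out tI (x := z)) nx) mulr0 subr0.
  rewrite big1 ?mulr0// => k _.
  by rewrite (partial_outside k (fun z => rho_out tI (x := z)) nx) mul0r.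
- move=> i; apply: continuous_at_points => x; rewrite /dF /de /g /energy_density.
  prove_continuous; solution_leaf.
apply: eq_Rintegral => x _; rewrite /dF /stress_divergence /curvature_term.
have sym j k : partial j (partial k (u t)) x = partial k (partial j (u t)) x.
  exact: (partial_solution_comm sol).
(* The Hessian of [u] contracted with grad u and grad rho arises once from differentiating [g] and
   once from differentiating the energy density. By symmetry of the Hessian the two contributions
   cancel. *)
pose T1 := \sum_j \sum_k partial j (u t) x * partial k (rho t) x * partial j (partial k (u t)) x.
have E1 : \sum_j partial j (u t) x * (\sum_k (partial j (partial k (rho t)) x * partial k (u t) x
     + partial k (rho t) x * partial j (partial k (u t)) x)) =
   \sum_j \sum_k partial j (partial k (rho t)) x * (partial j (u t) x * partial k (u t) x) + T1.
  rewrite -big_split/=; apply: eq_bigr => j _; rewrite mulr_sumr -big_split/=.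
  apply: eq_bigr => k _; rewrite mulrDr; congr (_ + _); last by rewrite mulrA.
  exact: mulrCA.
have E2 : \sum_j (\sum_k partial k (u t) x * partial j (partial k (u t)) x) * partial j (rho t) x = T1.
  rewrite /T1 exchange_big/=; apply: eq_bigr => j _; rewrite mulr_suml.
  by apply: eq_bigr => k _; rewrite sym mulrAC.
rewrite [RHS](eq_bigr (fun j => eps * g t x * partial j (partial j (u t)) x +
  (eps * (partial j (u t) x * (\sum_k (partial j (partial k (rho t)) x * partial k (u t) x
     + partial k (rho t) x * partial j (partial k (u t)) x))) +
  (- eps * ((\sum_k partial k (u t) x * partial j (partial k (u t)) x) * partial j (rho t) x) +
  (2 * u t x * (1 - u t x ^+ 2) / eps * (partial j (rho t) x * partial j (u t) x) +
   - energy_density t x * partial j (partial j (rho t)) x))))); last first.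
  move=> j _; rewrite /de (_ : \sum_k 2 * _ * _ = 2 * (\sum_k partial k (u t) x * partial j (partial k (u t)) x)); last first.
    by rewrite mulr_sumr; apply: eq_bigr => k _; rewrite mulrA.
  move: (\sum_k partial k (u t) x * _) (\sum_k (_ + _)) (energy_density t x) (g t x) => a1 a2 a3 a4.
  move: (partial j (partial j (u t)) x) (partial j (u t) x) (partial j (rho t) x) (partial j (partial j (rho t)) x) (u t x) => b1 b2 b3 b4 b5.
  by field; exact: lt0r_neq0.
rewrite [RHS]sum_linear5 E1 E2; clear E1 E2; move: T1 => a0; rewrite -/(g t x) /laplacian.
have alg (l w h S e L : R) : (eps * l + 2 * w * (1 - w ^+ 2) / eps) * h + eps * S - e * L =
    eps * h * l + (eps * (S + a0) + (- eps * a0 + (2 * w * (1 - w ^+ 2) / eps * h + - e * L))).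
  by field; exact: lt0r_neq0.
exact: alg.
Qed.

Lemma continuous_energy_rate t : 0 < t < s -> continuous (energy_rate t).
Proof.
move=> tI; have /andP[t0 ts] := tI.
have cr : continuous (fun x => derive1 (rho^~ x) t).
  by apply: (continuous_slice (F := fun p => derive1 (rho^~ p.2) p.1)) => x; exact: cdrho.
have cu : continuous (fun x => derive1 (u^~ x) t).
  apply: (continuous_slice (F := fun p => derive1 (u^~ p.2) p.1)) => x.
  exact: (continuous_time_derivative sol).
apply: continuous_at_points => x.
rewrite /energy_rate /stress_divergence /curvature_term /g /energy_density /laplacian.
prove_continuous; lazymatch goal with
  |- prop_for _ (inPhantom (forall x, continuous_at x ?F)) => lazymatch F with
  | (fun z => derive1 (fun r => rho r z) _) => exact: cr
  | (fun z => derive1 (fun r => u r z) _) => exact: cu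
  | _ => solution_leaf
  end end.
Qed.

(** Integration by parts is done on increments, where no space derivative of u_t occurs: |grad u'|^2
    - |grad u|^2 is the product of grad(u' - u) and grad(u' + u), and the gradient is moved off u' -
    u. What is left is t' - t times a jointly continuous integrand. *)
Lemma is_derive_weighted_energy t : 0 < t < s ->
  is_derive t 1 weighted_energy (\int[leb R n]_(x in bbox M) energy_rate t x).
Proof.
move=> tI; have /andP[t0 ts] := tI.
(* The divided difference of [W]. *)
pose PW (a b : R) := - ((a + b) * (2 - a ^+ 2 - b ^+ 2)) / 2.
have PWE a b : (1 - a ^+ 2) ^+ 2 / 2 - (1 - b ^+ 2) ^+ 2 / 2 = (a - b) * PW a b.
  by rewrite /PW; field.
pose H (p : R * 'rV[R]_n) := \sum_i (partial i (rho t) p.2 * (partial i (u p.1) p.2 + partial i (u t) p.2)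
   + rho t p.2 * (partial i (partial i (u p.1)) p.2 + partial i (partial i (u t)) p.2)).
pose D (p : R * 'rV[R]_n) := diff_quotient rho t p.1 p.2 * energy_density p.1 p.2
  + rho t p.2 * (diff_quotient u t p.1 p.2 * PW (u p.1 p.2) (u t p.2)) / eps
  - eps / 2 * (diff_quotient u t p.1 p.2 * H p).
have csnd (f : 'rV[R]_n -> R) p : continuous f -> {for p, continuous (fun q : R * 'rV[R]_n => f q.2)}.
  by move=> cf; apply: (@continuous_comp _ _ _ snd f); [exact: cvg_snd|exact: cf].
have cD t' x : 0 < t' < s -> {for (t', x), continuous D}.
  move=> t'I; have /andP[t'0 _] := t'I.
  have cQr : {for (t', x), continuous (fun p : R * 'rV[R]_n => diff_quotient rho t p.1 p.2)}.
    exact: (@continuous_diff_quotient R _ rho 0 s crho drho cdrho t t' x tI t'I).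
  have cQu : {for (t', x), continuous (fun p : R * 'rV[R]_n => diff_quotient u t p.1 p.2)}.
    apply: (@continuous_diff_quotient R _ u 0 s _ _ _ t t' x tI t'I).
    - by move=> ? ? /andP[? _]; exact: (continuous_solution sol).
    - by move=> ? ? /andP[? _]; exact: (derivable_time sol).
    - by move=> ? ? /andP[? _]; exact: (continuous_time_derivative sol).
  have cu := @continuous_solution _ _ _ _ _ sol t' x t'0.
  have cp i := @continuous_partial _ _ _ _ _ sol i t' x t'0.
  have cpp i j := @continuous_partial2 _ _ _ _ _ sol i j t' x t'0.
  have ce := @continuous_energy_density t' x t'0.
  rewrite /D /H /PW; prove_continuous; lazymatch goal with
    |- prop_for _ (inPhantom (forall x, continuous_at x ?F)) => lazymatch F with
    | (fun z => partial _ (partial _ (u z.1)) z.2) => exact: cpp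
    | (fun z => partial _ (u z.1) z.2) => exact: cp
    | (fun z => u z.1 z.2) => exact: cu
    | (fun z => energy_density _ _) => exact: ce
    | (fun z => diff_quotient rho _ _ _) => exact: cQr
    | (fun z => diff_quotient u _ _ _) => exact: cQu
    | (fun z => partial ?i (partial ?j (u _)) z.2) => exact: (csnd (partial i (partial j (u t))) _ (@cppus t i j t0))
    | (fun z => partial ?i (u _) z.2) => exact: (csnd (partial i (u t)) _ (@cpus t i t0))
    | (fun z => partial ?i (rho _) z.2) => exact: (csnd (partial i (rho t)) _ (@cprho t i tI))
    | (fun z => u _ z.2) => exact: (csnd (u t) _ (@cus t t0))
    | (fun z => rho _ z.2) => exact: (csnd (rho t) _ (@crhos t tI))
    end end.
pose J t' := \int[leb R n]_(x in bbox M) D (t', x).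
have JE : \int[leb R n]_(x in bbox M) energy_rate t x = J t.
  have cDt : continuous (fun x => D (t, x)) by apply: continuous_slice => x; exact: cD.
  rewrite -[RHS]subr0 -(integral_stress_divergence tI) -RintegralB//.
  - apply: eq_Rintegral => x _; rewrite /energy_rate; congr (_ - _).
    rewrite /D /= /diff_quotient !eqxx.
    have -> : H (t, x) = 2 * (g t x + rho t x * laplacian (u t) x).
      rewrite /H /g /laplacian mulr_sumr -big_split mulr_sumr/=; apply: eq_bigr => i _; ring.
    rewrite /PW /curvature_term; field; exact: lt0r_neq0.
  - exact: measurable_bbox.
  - exact: integrable_bbox.
  - apply: integrable_bbox; apply: continuous_at_points => x.
    rewrite /stress_divergence /curvature_term /g /energy_density /laplacian.
    by prove_continuous; solution_leaf.
rewrite JE; apply: is_derive_of_quotient; last first.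
  exact: (continuous_integral_param (@measurable_bbox R n M) (@subset_refl _ _) cD tI).
have near_in : \forall t' \near t, 0 < t' < s.
  by apply: filterS2 (lt_nbhsr t0) (lt_nbhsl ts) => t' -> ->.
apply: filterS near_in => t' t'I; have /andP[t'0 _] := t'I.
(* The vector field of the integration by parts. Its divergence contains rho times the increment of
   |grad u|^2, and its integral vanishes because [rho] has bounded support. *)
pose F i x := rho t x * ((u t' x - u t x) * (partial i (u t') x + partial i (u t) x)).
pose dF i x := partial i (rho t) x * ((u t' x - u t x) * (partial i (u t') x + partial i (u t) x)) +
  rho t x * ((partial i (u t') x - partial i (u t) x) * (partial i (u t') x + partial i (u t) x) +
   (u t' x - u t x) * (partial i (partial i (u t')) x + partial i (partial i (u t)) x)).
have DF i x : is_derive x (e_ i) (F i) (dF i x).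
  have du r : 0 < r -> is_derive x (e_ i) (u r) (partial i (u r) x).
    by move=> r0; apply: is_derive_partial; apply: (derivable_solution sol); exact: ltW.
  have ddu r : 0 < r -> is_derive x (e_ i) (partial i (u r)) (partial i (partial i (u r)) x).
    by move=> r0; apply: is_derive_partial; exact: (derivable_partial sol).
  apply: is_derive_mulf; first by apply: is_derive_partial; exact: prho.
  exact: (is_derive_mulf (is_derive_subf (du t' t'0) (du t t0)) (is_derive_addf (ddu t' t'0) (ddu t t0))).
have cdF i : continuous (dF i).
  apply: continuous_at_points => x; rewrite /dF; prove_continuous; solution_leaf.
have I0 : \int[leb R n]_(x in bbox M) (\sum_i dF i x) = 0.
  apply: (Rintegral_divergence0 M0 DF cdF) => i x nx.
  by rewrite /F rho_out// mul0r.
have ire r : 0 < r < s -> (leb R n).-integrable (bbox M) (EFin \o (fun x => rho r x * energy_density r x)).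
  move=> rI; have /andP[r0 _] := rI; apply: integrable_bbox; apply: continuous_at_points => x.
  rewrite /energy_density; prove_continuous; solution_leaf.
have csum : continuous (fun x => eps / 2 * \sum_i dF i x).
  by apply: continuous_at_points => x; prove_continuous; exact: cdF.
have cDt' : continuous (fun x => (t' - t) * D (t', x)).
  apply: continuous_at_points => x; prove_continuous.
  by apply: (continuous_slice (F := D)) => z; exact: cD.
rewrite /weighted_energy -RintegralB//; [|exact: measurable_bbox|exact: ire|exact: ire].
transitivity (\int[leb R n]_(x in bbox M) ((t' - t) * D (t', x) + eps / 2 * \sum_i dF i x)).
  apply: eq_Rintegral => x _; rewrite /D /=.
  have -> : \sum_i dF i x = (u t' x - u t x) * H (t', x) +
     rho t x * (\sum_i partial i (u t') x ^+ 2 - \sum_i partial i (u t) x ^+ 2).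
    rewrite /H mulr_sumr -sumrB mulr_sumr -big_split/=; apply: eq_bigr => i _; rewrite /dF.
    have alg (p w r a b c : R) : p * (w * (a + b)) + r * ((a - b) * (a + b) + w * c) =
      w * (p * (a + b) + r * c) + r * (a ^+ 2 - b ^+ 2) by ring.
    exact: alg.
  have alg (h q1 q2 r r' w w' W1 W0 P a1 a0 b : R) : h * q1 = r' - r -> h * q2 = w' - w -> W1 - W0 = (w' - w) * P ->
      r' * (eps * a1 / 2 + W1 / eps) - r * (eps * a0 / 2 + W0 / eps) =
      h * (q1 * (eps * a1 / 2 + W1 / eps) + r * (q2 * P) / eps - eps / 2 * (q2 * b)) +
      eps / 2 * ((w' - w) * b + r * (a1 - a0)).
    move=> hr hw hW.
    transitivity ((h * q1) * (eps * a1 / 2 + W1 / eps) + r * ((h * q2) * P) / eps - eps / 2 * ((h * q2) * b) +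
      eps / 2 * ((w' - w) * b + r * (a1 - a0))).
      by rewrite hr hw -hW; field; exact: lt0r_neq0.
    by field; exact: lt0r_neq0.
  exact: (alg _ _ _ _ _ _ _ _ _ _ _ _ _ (diff_quotientE _ _ _ _) (diff_quotientE _ _ _ _) (PWE _ _)).
rewrite RintegralD//; [|exact: measurable_bbox|exact: integrable_bbox|exact: integrable_bbox].
have isum : (leb R n).-integrable (bbox M) (EFin \o (fun x => \sum_i dF i x)).
  by apply: integrable_bbox; apply: continuous_at_points => x; prove_continuous; exact: cdF.
rewrite (RintegralZl (f := fun x => \sum_i dF i x))//; last exact: measurable_bbox.
rewrite I0 mulr0 addr0 RintegralZl//; first exact: measurable_bbox.
by apply: integrable_bbox; apply: (continuous_slice (F := D)) => x; exact: cD.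
Qed.

End weighted_energy.

Lemma eq_is_derive (R : realType) (V : normedModType R) (f g : V -> R) (x v : V) (df dg : R) :
  is_derive x v f df -> f =1 g -> df = dg -> is_derive x v g dg.
Proof. by move=> D /funext <- <-. Qed.

Lemma continuous_near_eq (T U : topologicalType) (f g : T -> U) p :
  (\forall q \near p, f q = g q) -> {for p, continuous f} -> {for p, continuous g}.
Proof.
by move=> fg cf; rewrite /prop_for /continuous_at -(nbhs_singleton fg); apply: cvg_trans cf; exact: near_eq_cvg.
Qed.

Lemma is_derive_translate (R : realType) (V : normedModType R) (f : V -> R) (x y v : V) (df : R) :
  is_derive (x - y) v f df -> is_derive x v (fun z => f (z - y)) df.
Proof.
move=> /is_derive_line0 D; apply/is_derive_line0.
by rewrite (_ : (fun h => _) = fun h : R => f (x - y + h *: v))//; apply/funext => h; rewrite addrAC.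
Qed.

Lemma continuous_translate (R : realType) (V : normedModType R) (f : V -> R) (y : V) :
  continuous f -> continuous (fun z => f (z - y)).
Proof.
move=> cf z; apply: (@continuous_comp _ _ _ (fun z => z - y) f); last exact: cf.
by apply: cvgB; [exact: cvg_id|exact: cvg_cst].
Qed.

Lemma partial_locally_constant (R : realType) n (f : 'rV[R]_n -> R) (A : set 'rV[R]_n) (c : R) i x :
  open A -> (forall z, A z -> f z = c) -> A x -> partial i f x = 0.
Proof.
move=> oA fA Ax; rewrite /partial (@near_eq_derive _ _ _ f (cst c)) ?derive_cst//.
by apply: filterS (open_nbhs_nbhs (conj oA Ax)) => z /fA.
Qed.

Lemma bounded_of_bounded_support (R : realType) n (f : 'rV[R]_n -> R) (M : R) :
  continuous f -> (forall z, ~ bbox M z -> f z = 0) -> exists2 N : R, 0 <= N & forall z, `|f z| <= N.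
Proof.
move=> cf f0.
have : compact (f @` @bbox R n M).
  by apply: continuous_compact; [exact: continuous_subspaceT|exact: compact_bbox].
move/compact_bounded => [N [_ HN]]; exists (Num.max 0 (N + 1)).
  by rewrite le_max lexx.
move=> z; rewrite le_max; have [Bz|nz] := pselect (bbox M z); last by rewrite f0// normr0 lexx.
by rewrite (HN (N + 1)) ?orbT// ltrDl.
Qed.

Lemma le_double_sum (R : realFieldType) n (a : 'I_n -> 'I_n -> R) i j :
  (forall i j, 0 <= a i j) -> a i j <= \sum_i \sum_j a i j.
Proof.
move=> a0; rewrite (bigD1 i)//= (bigD1 j)//= -addrA lerDl addr_ge0//; first exact: sumr_ge0.
by apply: sumr_ge0 => k _; exact: sumr_ge0.
Qed.

(** * The localized heat kernel *)

Section cutoff.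
Variables (R : realType) (n : nat) (eta : 'rV[R]_n -> R).
Hypothesis heta : is_cutoff eta.
Local Notation e_ i := (@delta_mx R 1 n 0 i).

Let Ck2 : Ck 2 eta. Proof. by case: heta => + _ _ _ _; apply. Qed.

Lemma derivable_cutoff i z : derivable eta z (e_ i).
Proof. by case: Ck2 => _ /(_ i) [+ _]; apply. Qed.

Lemma derivable_partial_cutoff i j z : derivable (partial j eta) z (e_ i).
Proof. by case: Ck2 => _ /(_ j) [_ [_ /(_ i) [+ _]]]; apply. Qed.

Lemma continuous_cutoff : continuous eta.
Proof. by case: Ck2. Qed.

Lemma continuous_partial_cutoff i : continuous (partial i eta).
Proof. by case: Ck2 => _ /(_ i) [_ []]. Qed.

Lemma continuous_partial2_cutoff i j : continuous (partial i (partial j eta)).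
Proof. by case: Ck2 => _ /(_ j) [_ [_ /(_ i) []]]. Qed.

Lemma cutoff_ge0 z : 0 <= eta z.
Proof. by case: heta => _ _ _ _ /(_ z) /andP[]. Qed.

Lemma cutoff_le1 z : eta z <= 1.
Proof. by case: heta => _ _ _ _ /(_ z) /andP[]. Qed.

Let far z := 2^-1 <= enorm z -> (~` tsupport eta) z.
Let farP z : far z.
Proof.
move=> z2 tz; case: heta => _ [_ /(_ z tz)] + _ _ _.
by rewrite /eball /= subr0 ltNge z2.
Qed.

Let open_far : open (~` tsupport eta).
Proof. exact: closed_openC (@closed_closure _ _). Qed.

Let near1 : open (@eball R n 0 4^-1).
Proof.
rewrite (_ : eball 0 _ = @enorm R n @^-1` [set r | r < 4^-1]).
  by apply: open_comp; [move=> z _; exact: continuous_enorm|exact: open_lt].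
by apply/seteqP; split => z; rewrite /eball /= subr0.
Qed.

Let eta_far z : (~` tsupport eta) z -> eta z = 0.
Proof. by apply: contra_notP => /eqP ez; apply: subset_closure. Qed.

Lemma cutoff_far z : 2^-1 <= enorm z -> eta z = 0.
Proof. by move=> /farP /eta_far. Qed.

Lemma partial_cutoff_eq0 i z : enorm z < 4^-1 \/ 2^-1 <= enorm z -> partial i eta z = 0.
Proof.
move=> [z4|/farP z2]; last exact: (partial_locally_constant i open_far eta_far z2).
apply: (@partial_locally_constant _ _ _ _ 1 i z near1); last by rewrite /eball /= subr0.
by case: heta.
Qed.

Lemma partial2_cutoff_eq0 i j z : enorm z < 4^-1 \/ 2^-1 <= enorm z ->
  partial i (partial j eta) z = 0.
Proof.
move=> [z4|/farP z2].
  apply: (@partial_locally_constant _ _ _ _ 0 i z near1); last by rewrite /eball /= subr0.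
  by move=> w; rewrite /eball /= subr0 => w4; apply: partial_cutoff_eq0; left.
apply: (@partial_locally_constant _ _ _ _ 0 i z open_far) => // w ww.
exact: (partial_locally_constant j open_far eta_far ww).
Qed.

Lemma partial2_cutoff_bounded : exists2 N : R, 0 < N &
  forall i j z, `|partial i (partial j eta) z| <= N.
Proof.
have out z : ~ bbox 1 z -> eta z = 0.
  move=> nz; apply: cutoff_far; rewrite leNgt; apply/negP => z2; apply: nz => i.
  by apply: le_trans (coord_le_enorm _ _) _; lra.
have bd i j : exists2 N : R, 0 <= N & forall z, `|partial i (partial j eta) z| <= N.
  apply: (@bounded_of_bounded_support _ _ _ 1); first exact: continuous_partial2_cutoff.
  by apply: partial_outside; exact: partial_outside.
pose N i j := sval (cid2 (bd i j)).
have N0 i j : 0 <= N i j by rewrite /N; case: cid2.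
have NP i j z : `|partial i (partial j eta) z| <= N i j by rewrite /N; case: cid2.
exists (\sum_i \sum_j N i j + 1); first by rewrite ltr_wpDl// sumr_ge0// => i _; rewrite sumr_ge0.
move=> i j z; apply: le_trans (NP i j z) _.
apply: (@le_trans _ _ (\sum_i \sum_j N i j)); last by rewrite lerDl.
exact: le_double_sum.
Qed.

(** A nonnegative function with bounded second derivatives has its squared slope controlled by its
    value; this keeps |grad eta|^2 / eta bounded. *)
Lemma partial_cutoff_sq N i z : 0 < N -> (forall i j z, `|partial i (partial j eta) z| <= N) ->
  partial i eta z ^+ 2 <= 4 * N * eta z.
Proof.
move=> N0 HN; apply: gradient_bound => //.
- by move=> w; exact: derivable_cutoff.
- by move=> w; exact: derivable_partial_cutoff.
- exact: cutoff_ge0.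
Qed.

End cutoff.

Section kernel.
Variables (R : realType) (n : nat) (eta : 'rV[R]_n -> R) (y : 'rV[R]_n) (s : R).
Hypothesis heta : is_cutoff eta.
Local Notation e_ i := (@delta_mx R 1 n 0 i).
Local Notation k := ((n%:R - 1) / 2 : R).
Local Notation c t := ((2 * (s - t))^-1 : R).
Local Notation E x := (eta (x - y)).
Local Notation E1 i x := (partial i eta (x - y)).
Local Notation E2 i j x := (partial i (partial j eta) (x - y)).
Local Notation Q x := (\sum_i (x - y) 0 i ^+ 2).

(** The power in front of the Gaussian is moved into the exponent through [ln], so that every
    derivative is [gauss] times a polynomial in [c t] and x - y. It agrees with the factor in the
    heat kernel when t < s. *)
Definition gauss (t : R) (x : 'rV[R]_n) : R :=
  expR (- (k * ln (4 * pi * (s - t))) - 2^-1 * (c t * Q x)).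

Definition kernel t x := heat_kernel eta y s x t.

Lemma gauss_gt0 t x : 0 < gauss t x. Proof. exact: expR_gt0. Qed.

Lemma kernelE t x : t < s -> kernel t x = gauss t x * E x.
Proof.
move=> ts; rewrite /kernel /heat_kernel; congr (_ * _).
have p0 : 0 < 4 * pi * (s - t) by rewrite !mulr_gt0 ?subr_gt0 ?pi_gt0.
rewrite /powR gt_eqF// -expRN -expRD; congr expR.
rewrite enorm_sq; congr (_ - _).
by field; lra.
Qed.

Lemma is_derive_gauss_time t x : t < s ->
  is_derive t 1 (gauss^~ x) (gauss t x * (2 * k * c t - c t ^+ 2 * Q x)).
Proof.
move=> ts; have ts0 : 0 < s - t by rewrite subr_gt0.
have p0 : 0 < 4 * pi * (s - t) by rewrite !mulr_gt0 ?pi_gt0.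
have d1 : is_derive t 1 (fun r : R => s - r) (0 - 1).
  exact: (is_derive_subf (is_derive_cst _ _ _) (is_derive_id _ _)).
have d2 := is_derive_chain (is_derive_cmulf (4 * pi) d1) (is_derive1_ln p0).
have N0 : 2 * (s - t) != 0 by lra.
have d3 := is_derive_mulf (is_derive_invf (f := fun r : R => 2 * (s - r)) N0 (is_derive_cmulf 2 d1)) (is_derive_cst (Q x) t (1 : R)).
have d4 := is_derive_subf (is_derive_oppf (is_derive_cmulf k d2)) (is_derive_cmulf 2^-1 d3).
apply: (eq_is_derive (is_derive_chain d4 (is_derive_expR _))) => //; rewrite /gauss; congr (_ * _).
rewrite /cst; move: (Q x) (pi_gt0 R) => q; move: pi (n%:R) => P m P0.
by field; rewrite !gt_eqF.
Qed.

Lemma is_derive_gauss_space t x i :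
  is_derive x (e_ i) (gauss t) (gauss t x * (- (c t * (x - y) 0 i))).
Proof.
have d1 := is_derive_cmulf 2^-1 (is_derive_cmulf (c t) (is_derive_sqdist x y i)).
have d2 := is_derive_subf (is_derive_cst (- (k * ln (4 * pi * (s - t)))) x (e_ i)) d1.
apply: (eq_is_derive (is_derive_chain d2 (is_derive_expR _))) => //; rewrite /gauss; congr (_ * _).
by move: ((x - y) 0 i) (c t) => a b; field.
Qed.

Let dE i x : is_derive x (e_ i) (fun z => E z) (E1 i x).
Proof. by apply: is_derive_translate; apply: is_derive_partial; exact: derivable_cutoff. Qed.

Let dE1 i j x : is_derive x (e_ i) (fun z => E1 j z) (E2 i j x).
Proof. by apply: is_derive_translate; apply: is_derive_partial; exact: derivable_partial_cutoff. Qed.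

Definition kernel1 i t x := gauss t x * (E1 i x - c t * ((x - y) 0 i * E x)).

(** The closed form of the derivative of [kernel1 j] in direction [i], in the shape contracted by
    [hessian_form_sum] and traced by [hessian_trace_sum]. *)
Definition kernel2 i j t x := gauss t x * (E2 i j x - c t * ((x - y) 0 i * E1 j x)
  - c t * ((j == i)%:R * E x + (x - y) 0 j * E1 i x)
  + c t ^+ 2 * ((x - y) 0 i * (x - y) 0 j * E x)).

Lemma is_derive_kernel t x i : t < s -> is_derive x (e_ i) (kernel t) (kernel1 i t x).
Proof.
move=> ts; apply: (eq_is_derive (is_derive_mulf (is_derive_gauss_space t x i) (dE i x))) => [z|].
  by rewrite kernelE.
rewrite /kernel1.
by move: (gauss t x) (E x) (E1 i x) ((x - y) 0 i) (c t) => g a b d e; ring.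
Qed.

Lemma partial_kernel t i : t < s -> partial i (kernel t) = kernel1 i t.
Proof. by move=> ts; apply/funext => x; rewrite /partial; have [_ ->] := is_derive_kernel x i ts. Qed.

Lemma is_derive_kernel1 t x i j : is_derive x (e_ i) (kernel1 j t) (kernel2 i j t x).
Proof.
apply: (eq_is_derive (is_derive_mulf (is_derive_gauss_space t x i)
  (is_derive_subf (dE1 i j x) (is_derive_cmulf (c t) (is_derive_mulf (is_derive_coord x j i y) (dE i x)))))) => //.
rewrite /kernel2.
move: (gauss t x) (E x) (E1 i x) (E1 j x) (E2 i j x) ((x - y) 0 i) ((x - y) 0 j) (c t) (_%:R) => g a b b' h d d' e q.
ring.
Qed.

Lemma partial2_kernel t i j : t < s -> partial i (partial j (kernel t)) = kernel2 i j t.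
Proof.
by move=> ts; rewrite partial_kernel//; apply/funext => x; rewrite {1}/partial; have [_ ->] := is_derive_kernel1 t x i j.
Qed.

Lemma is_derive_kernel_time t x : t < s ->
  is_derive t 1 (kernel^~ x) (gauss t x * (2 * k * c t - c t ^+ 2 * Q x) * E x).
Proof.
move=> ts; have := is_derive_mulf (is_derive_gauss_time x ts) (is_derive_cst (E x) t (1 : R)).
rewrite mulr0 addr0 => D; apply: near_eq_is_derive D.
by apply: filterS (lt_nbhsl ts) => r rs; rewrite kernelE.
Qed.

Let continuous_sub_coord i (p : R * 'rV[R]_n) :
  {for p, continuous (fun q : R * 'rV[R]_n => (q.2 - y) 0 i)}.
Proof.
apply: (@continuous_comp _ _ _ (fun q : R * 'rV[R]_n => q.2 - y) (fun z : 'rV[R]_n => z 0 i)).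
  by apply: cvgB; [exact: cvg_snd|exact: cvg_cst].
exact: continuous_coord.
Qed.

Let continuous_c (p : R * 'rV[R]_n) : p.1 < s ->
  {for p, continuous (fun q : R * 'rV[R]_n => c q.1)}.
Proof.
move=> ps; apply: continuous_invf; first by rewrite gt_eqF// mulr_gt0// subr_gt0.
by prove_continuous; exact: cvg_fst.
Qed.

Lemma continuous_gauss (p : R * 'rV[R]_n) : p.1 < s ->
  {for p, continuous (fun q : R * 'rV[R]_n => gauss q.1 q.2)}.
Proof.
move=> ps; apply: (@continuous_comp _ _ _ (fun q : R * 'rV[R]_n =>
   - (k * ln (4 * pi * (s - q.1))) - 2^-1 * (c q.1 * Q q.2)) expR); last exact: continuous_expR.
prove_continuous; [|exact: continuous_c|exact: continuous_sub_coord].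
apply: (@continuous_comp _ _ _ (fun q : R * 'rV[R]_n => 4 * pi * (s - q.1)) (@ln R)).
  by prove_continuous; exact: cvg_fst.
by apply: continuous_ln; rewrite !mulr_gt0 ?subr_gt0 ?pi_gt0.
Qed.

Let continuous_E (p : R * 'rV[R]_n) : {for p, continuous (fun q : R * 'rV[R]_n => E q.2)}.
Proof.
apply: (@continuous_comp _ _ _ snd (fun z : 'rV[R]_n => E z)); first exact: cvg_snd.
by apply: continuous_translate; exact: continuous_cutoff.
Qed.

Lemma continuous_kernel (p : R * 'rV[R]_n) : p.1 < s ->
  {for p, continuous (fun q : R * 'rV[R]_n => kernel q.1 q.2)}.
Proof.
move=> ps; apply: (continuous_near_eq (f := fun q : R * 'rV[R]_n => gauss q.1 q.2 * E q.2)).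
  have : \forall q \near p, q.1 < s by apply: (cvg_fst (lt_nbhsl ps)).
  by apply: filterS => q qs; rewrite kernelE.
by prove_continuous; [exact: continuous_gauss|exact: continuous_E].
Qed.

Lemma continuous_kernel_time (p : R * 'rV[R]_n) : p.1 < s ->
  {for p, continuous (fun q : R * 'rV[R]_n => derive1 (kernel^~ q.2) q.1)}.
Proof.
move=> ps; apply: (continuous_near_eq (f := fun q : R * 'rV[R]_n =>
    gauss q.1 q.2 * (2 * k * c q.1 - c q.1 ^+ 2 * Q q.2) * E q.2)).
  have : \forall q \near p, q.1 < s by apply: (cvg_fst (lt_nbhsl ps)).
  by apply: filterS => q qs; rewrite derive1E; have [_ ->] := is_derive_kernel_time q.2 qs.
prove_continuous.
- exact: continuous_gauss.
- exact: continuous_c.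
- exact: continuous_c.
- exact: continuous_sub_coord.
- exact: continuous_E.
Qed.

Let continuous_gauss_slice t : continuous (gauss t).
Proof.
move=> x; apply: (@continuous_comp _ _ _ (fun q : 'rV[R]_n =>
   - (k * ln (4 * pi * (s - t))) - 2^-1 * (c t * Q q)) expR); last exact: continuous_expR.
prove_continuous.
by move: x; apply: (continuous_translate (f := fun z : 'rV[R]_n => z 0 _)); exact: continuous_coord.
Qed.

Lemma continuous_partial_kernel t i : t < s -> continuous (partial i (kernel t)).
Proof.
move=> ts; rewrite partial_kernel//; apply: continuous_at_points => x; rewrite /kernel1.
prove_continuous.
- exact: continuous_gauss_slice.
- by move: x; apply: continuous_translate; exact: continuous_partial_cutoff.
- by move: x; apply: (continuous_translate (f := fun z : 'rV[R]_n => z 0 i)); exact: continuous_coord.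
- by move: x; apply: continuous_translate; exact: continuous_cutoff.
Qed.

Lemma continuous_partial2_kernel t i j : t < s -> continuous (partial i (partial j (kernel t))).
Proof.
move=> ts; rewrite partial2_kernel//; apply: continuous_at_points => x; rewrite /kernel2.
have cz l : {for x, continuous (fun z : 'rV[R]_n => (z - y) 0 l)}.
  by move: x; apply: (continuous_translate (f := fun z : 'rV[R]_n => z 0 l)); exact: continuous_coord.
have ce : {for x, continuous (fun z : 'rV[R]_n => E z)}.
  by move: x {cz}; apply: continuous_translate; exact: continuous_cutoff.
have ce1 l : {for x, continuous (fun z : 'rV[R]_n => E1 l z)}.
  by move: x {cz ce}; apply: continuous_translate; exact: continuous_partial_cutoff.
have ce2 : {for x, continuous (fun z : 'rV[R]_n => E2 i j z)}.
  by move: x {cz ce ce1}; apply: continuous_translate; exact: continuous_partial2_cutoff.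
prove_continuous; [exact: continuous_gauss_slice|exact: ce2|exact: cz|exact: ce1|exact: ce|exact: cz|exact: ce1|exact: cz|exact: cz|exact: ce].
Qed.

Lemma kernel_far t x : t < s -> 2^-1 <= enorm (x - y) -> kernel t x = 0.
Proof. by move=> ts xy; rewrite kernelE// (cutoff_far heta)// mulr0. Qed.

Lemma kernel_ge0 t x : t < s -> 0 <= kernel t x.
Proof. by move=> ts; rewrite kernelE// mulr_ge0 ?(ltW (gauss_gt0 _ _))// cutoff_ge0. Qed.

End kernel.

(** * Pointwise bound on the energy rate *)

Lemma Cauchy_Schwarz_sum (R : realFieldType) n (a b : 'I_n -> R) :
  (\sum_i a i * b i) ^+ 2 <= (\sum_i a i ^+ 2) * (\sum_i b i ^+ 2).
Proof.
have : 0 <= \sum_i \sum_j (a i * b j - a j * b i) ^+ 2.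
  by apply: sumr_ge0 => i _; apply: sumr_ge0 => j _; exact: sqr_ge0.
suff -> : \sum_i \sum_j (a i * b j - a j * b i) ^+ 2 =
    2 * ((\sum_i a i ^+ 2) * (\sum_i b i ^+ 2) - (\sum_i a i * b i) ^+ 2).
  by rewrite pmulr_rge0// subr_ge0.
rewrite expr2 !mulr_suml -sumrB mulr_sumr.
transitivity (\sum_i \sum_j (a i ^+ 2 * b j ^+ 2 - a i * b i * (a j * b j)) +
   \sum_i \sum_j (a j ^+ 2 * b i ^+ 2 - a i * b i * (a j * b j))).
  rewrite -big_split; apply: eq_bigr => i _; rewrite -big_split; apply: eq_bigr => j _ /=; ring.
rewrite [X in _ + X]exchange_big -big_split; apply: eq_bigr => i _ /=.
rewrite !mulr_sumr -sumrB mulr_sumr -big_split; apply: eq_bigr => j _ /=; ring.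
Qed.

Lemma quadratic_form_le (R : realFieldType) n (H : 'I_n -> 'I_n -> R) (p : 'I_n -> R) (N : R) :
  (forall i j, `|H i j| <= N) ->
  - (\sum_i \sum_j H i j * (p i * p j)) <= n%:R * N * \sum_i p i ^+ 2.
Proof.
move=> HN; rewrite -sumrN.
apply: (@le_trans _ _ (\sum_i \sum_j N * ((p i ^+ 2 + p j ^+ 2) / 2))).
  apply: ler_sum => i _; rewrite -sumrN; apply: ler_sum => j _.
  have := HN i j; rewrite ler_norml => /andP[h1 h2].
  move: (H i j) (p i) (p j) h1 h2 => h a b h1 h2; have := sqr_ge0 (a + b); have := sqr_ge0 (a - b).
  nra.
rewrite le_eqVlt; apply/orP; left; apply/eqP.
transitivity (\sum_(i < n) (n%:R * (N / 2 * p i ^+ 2) + N / 2 * \sum_j p j ^+ 2)).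
  apply: eq_bigr => i _; rewrite mulr_sumr.
  rewrite (eq_bigr (fun j => N / 2 * p i ^+ 2 + N / 2 * p j ^+ 2)); last by move=> j _; ring.
  by rewrite big_split sumr_const card_ord mulr_natl.
rewrite big_split sumr_const card_ord -mulr_natl /= -!mulr_sumr; by field.
Qed.

(** In the application [K] is the Gaussian, [c] is 1 / (2 (s - t)), [z] is x - y, [p] is grad u, and
    [E], [b], [H] are the cut-off, its gradient and its Hessian. *)
Lemma hessian_form_sum (R : comNzRingType) n (H : 'I_n -> 'I_n -> R) (z b p : 'I_n -> R) (K c E : R) :
  \sum_i \sum_j (K * (H i j - c * (z i * b j) - c * ((j == i)%:R * E + z j * b i)
     + c ^+ 2 * (z i * z j * E))) * (p i * p j) =
  K * (\sum_i \sum_j H i j * (p i * p j) - 2 * c * (\sum_i z i * p i) * (\sum_i b i * p i)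
    - c * E * (\sum_i p i ^+ 2) + c ^+ 2 * (\sum_i z i * p i) ^+ 2 * E).
Proof.
have prod (f g : 'I_n -> R) : (\sum_i f i) * (\sum_i g i) = \sum_i \sum_j f i * g j.
  by rewrite mulr_suml; apply: eq_bigr => i _; rewrite mulr_sumr.
have diag : \sum_i \sum_j (j == i)%:R * (p i * p j) = \sum_i p i ^+ 2.
  apply: eq_bigr => i _; rewrite (bigD1 i)//= eqxx mul1r big1 ?addr0// => j /negbTE ->.
  by rewrite mul0r.
transitivity (K * \sum_i \sum_j H i j * (p i * p j) - K * c * (\sum_i \sum_j (z i * p i) * (b j * p j))
   - K * c * E * (\sum_i \sum_j (j == i)%:R * (p i * p j))
   - K * c * (\sum_i \sum_j (b i * p i) * (z j * p j)) + K * c ^+ 2 * E * (\sum_i \sum_j (z i * p i) * (z j * p j))).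
  rewrite !mulr_sumr -!sumrB -big_split; apply: eq_bigr => i _.
  rewrite !mulr_sumr -!sumrB -big_split; apply: eq_bigr => j _ /=; ring.
by rewrite diag -!prod; ring.
Qed.

Lemma hessian_trace_sum (R : comNzRingType) n (H : 'I_n -> 'I_n -> R) (z b : 'I_n -> R) (K c E : R) :
  \sum_i (K * (H i i - c * (z i * b i) - c * ((i == i)%:R * E + z i * b i)
     + c ^+ 2 * (z i * z i * E))) =
  K * (\sum_i H i i - 2 * c * (\sum_i z i * b i) - c * n%:R * E + c ^+ 2 * (\sum_i z i ^+ 2) * E).
Proof.
have -> : c * n%:R * E = \sum_(i < n) c * E by rewrite sumr_const card_ord -mulr_natl; ring.
rewrite ![c ^+ 2 * _ * E]mulrAC !mulr_sumr -!sumrB -big_split/= mulr_sumr.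
by apply: eq_bigr => i _; rewrite eqxx mul1r; ring.
Qed.

(* [m] stands for the quotient [a / E], so that no division by the cut-off is needed. *)
Lemma rate_le (R : realFieldType) (n : nat) (K c E e eps lam w v f m zp zb P Q L HH : R) :
  0 < eps -> 0 <= K -> 0 <= c -> 0 <= E -> 0 <= P -> eps * v = f + lam * w ->
  e = eps * P / 2 + w ^+ 2 / 2 / eps -> eps ^+ 2 * P <= w ^+ 2 ->
  K * (2 * ((n%:R - 1) / 2) * c - c ^+ 2 * Q) * E * e
  - v * (K * E * f + eps * (K * (m * E - c * zp * E)))
  - (f * (K * (m * E - c * zp * E)) + eps * (K * (HH - 2 * c * zp * (m * E) - c * E * P + c ^+ 2 * zp ^+ 2 * E))
     - e * (K * (L - 2 * c * zb - c * n%:R * E + c ^+ 2 * Q * E)))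
  <= lam ^+ 2 / 2 * (K * E * e) + K * (e * (L - 2 * c * zb) + eps * (E * m ^+ 2 - HH)).
Proof.
move=> eps0 K0 c0 E0 P0 vE eE disc.
have {}vE : f = eps * v - lam * w by rewrite vE addrK.
rewrite -subr_ge0.
(* The gap is a sum of three nonnegative terms: the completed square in the time derivative [v], the
   gradient part of lam^2 / 2 times [e], and a multiple of w^2 - eps^2 P. In the last one, the
   coefficients (n - 1) c - c^2 Q and - n c + c^2 Q of [e] add up to - c. *)
have -> : lam ^+ 2 / 2 * (K * E * e) + K * (e * (L - 2 * c * zb) + eps * (E * m ^+ 2 - HH)) -
  (K * (2 * ((n%:R - 1) / 2) * c - c ^+ 2 * Q) * E * e
  - v * (K * E * f + eps * (K * (m * E - c * zp * E)))
  - (f * (K * (m * E - c * zp * E)) + eps * (K * (HH - 2 * c * zp * (m * E) - c * E * P + c ^+ 2 * zp ^+ 2 * E))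
     - e * (K * (L - 2 * c * zb - c * n%:R * E + c ^+ 2 * Q * E)))) =
  K * E * ((2 * eps * (v + m - c * zp) - lam * w) ^+ 2 / (4 * eps) + lam ^+ 2 * (eps * P) / 4 +
    c * ((w ^+ 2 - eps ^+ 2 * P) / (2 * eps))).
  by rewrite vE eE; field; exact: lt0r_neq0.
have e4 : 0 < 4 * eps by rewrite mulr_gt0.
have e2 : 0 < 2 * eps by rewrite mulr_gt0.
rewrite mulr_ge0 ?mulr_ge0// addr_ge0 ?addr_ge0//.
- by rewrite divr_ge0 ?sqr_ge0// ltW.
- by rewrite divr_ge0// mulr_ge0 ?sqr_ge0// mulr_ge0// ltW.
- by rewrite mulr_ge0// divr_ge0 ?(ltW e2)// subr_ge0.
Qed.

(** With m = 1 / (128 tau), the Gaussian exponent is at least 2 m. One m pays for the prefactor and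
    for 1 + 1 / tau, which together are at most the power n + 1 of 1 + 1 / tau; the other m is
    kept. *)
Lemma gauss_tail (R : realType) n (k tau q : R) : 0 < tau -> 16^-1 <= q -> 0 <= k <= n%:R ->
  expR (- (k * ln (4 * pi * tau)) - 2^-1 * ((2 * tau)^-1 * q)) * (1 + tau^-1) <=
  (128 * n.+1%:R) ^+ n.+1 * expR (- (128 * tau)^-1).
Proof.
move=> t0 q16 /andP[k0 kn].
pose m := (128 * tau)^-1; pose X := 1 + tau^-1.
have m0 : 0 < m by rewrite invr_gt0 mulr_gt0.
have XE : X = 1 + 128 * m by rewrite /X /m; field; exact: lt0r_neq0.
have X1 : 1 <= X by rewrite XE; nra.
have X0 : 0 < X by apply: lt_le_trans X1.
have p0 : 0 < 4 * pi * tau by rewrite !mulr_gt0 ?pi_gt0.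
have lnX : - ln (4 * pi * tau) <= ln X.
  rewrite -lnV ?posrE// ler_ln ?posrE ?invr_gt0//.
  apply: (@le_trans _ _ tau^-1); last by rewrite /X; lra.
  rewrite lef_pV2 ?posrE//; have := pi_ge2 R; nra.
have lnX0 : 0 <= ln X by rewrite ln_ge0.
have qm : 2 * m <= 2^-1 * ((2 * tau)^-1 * q).
  have -> : 2^-1 * ((2 * tau)^-1 * q) = 32 * m * q by rewrite /m; field; exact: lt0r_neq0.
  nra.
apply: (@le_trans _ _ (X ^+ n * expR (- (2 * m)) * X)).
  apply: ler_wpM2r; first exact: ltW.
  rewrite -[X in X ^+ n]lnK ?posrE// -expRM_natl -expRD ler_expR lerD//; last by lra.
  have h1 : - (k * ln (4 * pi * tau)) <= k * ln X by rewrite -mulrN; exact: ler_wpM2l.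
  by apply: le_trans h1 _; exact: ler_wpM2r.
(* The exponent is divided by n + 1 so that the power n + 1 costs exactly exp(m). The bound is 1 + x
   <= exp(x), with X = 1 + 128 m. *)
have X2 : X <= 128 * n.+1%:R * expR (m / n.+1%:R).
  have n1 : 1 <= n.+1%:R :> R by rewrite ler1n.
  apply: (@le_trans _ _ (128 * n.+1%:R * (1 + m / n.+1%:R))).
    rewrite XE mulrDr mulr1 (_ : 128 * _ * (m / _) = 128 * m); first by lra.
    by field; rewrite addrC natr1.
  by rewrite ler_wpM2l ?mulr_ge0// expR_ge1Dx.
have X3 : X ^+ n.+1 <= (128 * n.+1%:R) ^+ n.+1 * expR m.
  apply: (@le_trans _ _ ((128 * n.+1%:R * expR (m / n.+1%:R)) ^+ n.+1)).
    by apply: lerXn2r; rewrite ?nnegrE ?(ltW X0)// !mulr_ge0 ?expR_ge0.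
  by rewrite exprMn -expRM_natl [_ * (m / _)]mulrC divfK ?pnatr_eq0.
rewrite mulrAC -exprSr; apply: (@le_trans _ _ ((128 * n.+1%:R) ^+ n.+1 * expR m * expR (- (2 * m)))).
  by apply: ler_wpM2r; [exact: expR_ge0|].
by rewrite -mulrA -expRD (_ : m - 2 * m = - m)//; ring.
Qed.

Section energy_rate_bound.
Variables (R : realType) (n : nat) (eta : 'rV[R]_n -> R).
Hypotheses (n0 : (0 < n)%N) (heta : is_cutoff eta).

Lemma energy_rate_bound : exists2 c5 : R, 0 < c5 &
  forall (eps : R) (rbar : 'rV[R]_n -> R) (u : R -> 'rV[R]_n -> R),
  0 < eps -> Ck 1 rbar -> (forall x, enorm (grad rbar x) <= 1) ->
  allen_cahn_solution eps (fun x => profile eps (rbar x)) u ->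
  forall y s t x, 0 < t -> t < s ->
  energy_rate eps u (kernel eta y s) t x <=
    lambda eps (u t) ^+ 2 / 2 * (kernel eta y s t x * energy_density eps u t x) +
    c5 * (expR (- (128 * (s - t))^-1) * (if enorm (x - y) < 2^-1 then energy_density eps u t x else 0)).
Proof.
have [N N0 HN] := partial2_cutoff_bounded heta.
pose B := 4 * N + 1.
(* In [C0], one n N comes from the Laplacian of the cut-off, ten from the gradient terms (4 n N + n
   N, doubled by eps |grad u|^2 <= 2 e), and n B from x - y paired with the gradient of the cut-off;
   [C1] is the constant of the Gaussian tail. *)
pose C0 := n%:R * (11 * N + B); pose C1 := (128 * n.+1%:R : R) ^+ n.+1.
have n1 : 1 <= n%:R :> R by rewrite ler1n.
have B0 : 0 < B by rewrite /B; lra.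
have C00 : 0 < C0 by rewrite /C0 mulr_gt0 ?addr_gt0 ?mulr_gt0//; lra.
have C10 : 0 < C1 by rewrite /C1 exprn_gt0// mulr_gt0// ltr0n.
exists (C0 * C1) => [|eps rbar u eps0 C1r gr sol y s t x t0 ts]; first exact: mulr_gt0.
pose K := gauss y s t x; pose c := (2 * (s - t))^-1; pose E := eta (x - y).
pose z i := (x - y) 0 i; pose b i := partial i eta (x - y).
pose H i j := partial i (partial j eta) (x - y); pose p i := partial i (u t) x.
pose e := energy_density eps u t x; pose w := 1 - u t x ^+ 2.
pose a := \sum_i b i * p i; pose m := a / E; pose P := \sum_i p i ^+ 2.
have ts0 : 0 < s - t by rewrite subr_gt0.
have K0 : 0 < K by exact: gauss_gt0.
have c0 : 0 < c by rewrite invr_gt0 mulr_gt0.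
have E0 : 0 <= E by exact: cutoff_ge0.
have E1 : E <= 1 by exact: cutoff_le1.
have e0 : 0 <= e by exact: energy_density_ge0.
have P0 : 0 <= P by apply: sumr_ge0 => i _; exact: sqr_ge0.
have b2 i : b i ^+ 2 <= 4 * N * E by exact: (partial_cutoff_sq heta _ _ N0 HN).
have a2 : a ^+ 2 <= n%:R * (4 * N * E) * P.
  apply: le_trans (Cauchy_Schwarz_sum _ _) _; apply: ler_wpM2r => //.
  apply: le_trans (ler_sum _ (fun i _ => b2 i)) _.
  by rewrite sumr_const card_ord (mulr_natl (4 * N * E)).
(* Where the cut-off vanishes, the quotient [m] is 0 by convention, and the bound [a2] forces [a] to
   be 0 as well. *)
have aE : a = m * E.
  rewrite /m; have [E_0|E_N0] := eqVneq E 0; last by rewrite divfK.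
  move: a2; rewrite E_0 !mulr0 mul0r => a2.
  by apply/eqP; rewrite -sqrf_eq0 eq_le a2 sqr_ge0.
have ut1 q : `|u t q| < 1 by apply: (solution_lt1 eps0 C1r gr sol); exact: ltW.
have disc : eps ^+ 2 * P <= w ^+ 2 by exact: (discrepancy_le0 eps0 C1r gr sol).
have eE : e = eps * P / 2 + w ^+ 2 / 2 / eps by [].
have eqn : eps * derive1 (u^~ x) t = curvature_term eps u t x + lambda eps (u t) * w.
  rewrite (equation_bounded eps0 sol x t0 (fun q => ltW (ut1 q))) /curvature_term /w.
  by move: (laplacian _ _) (lambda _ _) (u t x) => q1 q2 q3; field; exact: lt0r_neq0.
have := rate_le n m (\sum_i z i * p i) (\sum_i z i * b i) (\sum_i z i ^+ 2)
  (\sum_i H i i) (\sum_i \sum_j H i j * (p i * p j)) eps0 (ltW K0) (ltW c0) E0 P0 eqn eE disc.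
set lhs := (X in X <= _ -> _).
have -> : lhs = energy_rate eps u (kernel eta y s) t x.
  rewrite /energy_rate /stress_divergence derive1E.
  have [_ ->] := is_derive_kernel_time eta y x ts.
  have -> : laplacian (kernel eta y s t) x = K * (\sum_i H i i - 2 * c * (\sum_i z i * b i) - c * n%:R * E + c ^+ 2 * (\sum_i z i ^+ 2) * E).
    rewrite -hessian_trace_sum /laplacian; apply: eq_bigr => i _.
    by rewrite (partial2_kernel y heta i i ts).
  have -> : \sum_j \sum_k partial j (partial k (kernel eta y s t)) x * (partial j (u t) x * partial k (u t) x) =
    K * (\sum_i \sum_j H i j * (p i * p j) - 2 * c * (\sum_i z i * p i) * (m * E) - c * E * P + c ^+ 2 * (\sum_i z i * p i) ^+ 2 * E).
    rewrite -aE -hessian_form_sum; apply: eq_bigr => i _; apply: eq_bigr => j _.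
    by rewrite (partial2_kernel y heta i j ts).
  have -> : \sum_k partial k (kernel eta y s t) x * partial k (u t) x = K * (m * E - c * (\sum_i z i * p i) * E).
    rewrite -aE [c * _ * E]mulrAC mulr_sumr /a -sumrB mulr_sumr; apply: eq_bigr => i _.
    rewrite (partial_kernel y heta i ts) /kernel1 -/K -/c -/(p i) -/(b i) -/(z i) -/E.
    by move: (p i) (b i) (z i) => p1 b1 z1; ring.
  by rewrite (kernelE _ _ _ ts).
move=> le1; apply: le_trans le1 _; rewrite (kernelE _ _ _ ts); apply: lerD; first by [].
(* Off the annulus the cut-off is locally constant or zero, so every error term contains a vanishing
   derivative of it. *)
have vanish : enorm (x - y) < 4^-1 \/ 2^-1 <= enorm (x - y) ->
    e * (\sum_i H i i - 2 * c * (\sum_i z i * b i)) + eps * (E * m ^+ 2 - \sum_i \sum_j H i j * (p i * p j)) = 0.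
  move=> far; have b_0 i : b i = 0 by exact: partial_cutoff_eq0.
  have H_0 i j : H i j = 0 by exact: partial2_cutoff_eq0.
  have -> : m = 0 by rewrite /m /a big1 ?mul0r// => i _; rewrite b_0 mul0r.
  rewrite big1; last by move=> i _; exact: H_0.
  rewrite big1; last by move=> i _; rewrite b_0 mulr0.
  rewrite big1; first by rewrite expr0n !mulr0 !subr0 !mulr0 addr0.
  by move=> i _; rewrite big1// => j _; rewrite H_0 mul0r.
have rhs0 : 0 <= C0 * C1 * (expR (- (128 * (s - t))^-1) * e).
  by apply: mulr_ge0; apply: mulr_ge0 => //; first [exact: ltW|exact: expR_ge0].
case: ifPn => xy; last by rewrite vanish ?mulr0//; right; rewrite leNgt.
have [x4|x4] := ltP (enorm (x - y)) 4^-1; first by rewrite vanish ?mulr0//; left.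
have L_le : \sum_i H i i <= n%:R * N.
  apply: le_trans (ler_sum _ (fun i _ => le_trans (ler_norm _) (HN i i (x - y)))) _.
  by rewrite sumr_const card_ord (mulr_natl N).
have zb_le : - (\sum_i z i * b i) <= n%:R * B.
  rewrite -sumrN; apply: (@le_trans _ _ (\sum_(i < n) B)); last first.
    by rewrite sumr_const card_ord (mulr_natl B).
  apply: ler_sum => i _; have := le_trans (coord_le_enorm (x - y) i) (ltW xy).
  rewrite ler_norml -/(z i) => /andP[z1 z2]; have := b2 i; rewrite /B in B0 *.
  move: (z i) (b i) z1 z2 => zi bi z1 z2 bi2.
  have bi3 : bi ^+ 2 <= (4 * N + 1) ^+ 2 by nra.
  have : `|bi| <= 4 * N + 1 by rewrite -(@ler_pXn2r _ 2) ?nnegrE ?(ltW B0)// -normrX ger0_norm ?sqr_ge0.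
  rewrite ler_norml => /andP[b3 b4]; nra.
have m_le : E * m ^+ 2 <= n%:R * (4 * N) * P.
  have [E_0|E_N0] := eqVneq E 0; first by rewrite E_0 mul0r !mulr_ge0// ltW.
  have Egt : 0 < E by rewrite lt_neqAle eq_sym E_N0.
  rewrite -(ler_pM2l Egt); apply: le_trans (le_trans _ a2) _; first by rewrite aE; nra.
  by rewrite le_eqVlt; apply/orP; left; apply/eqP; ring.
have HH_le : - (\sum_i \sum_j H i j * (p i * p j)) <= n%:R * N * P.
  by apply: quadratic_form_le => i j; exact: HN.
have eP : eps * P <= 2 * e.
  rewrite eE; have : 0 <= w ^+ 2 / 2 / eps by rewrite !divr_ge0 ?sqr_ge0// ltW.
  by lra.
have c2 : 2 * c = (s - t)^-1 by rewrite /c invfM mulrA divff ?mul1r.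
have tail := gauss_tail (n := n) (k := (n%:R - 1) / 2) (q := \sum_i z i ^+ 2) ts0.
have {}tail : K * (1 + 2 * c) <= C1 * expR (- (128 * (s - t))^-1).
  rewrite c2; apply: tail; last by lra.
  rewrite -enorm_sq; have := enorm_ge0 (x - y); move: (enorm _) x4 => r r4 r0; nra.
apply: (@le_trans _ _ (K * (e * (C0 * (1 + 2 * c))))).
  apply: ler_wpM2l; first exact: ltW.
  apply: (@le_trans _ _ (e * (n%:R * N + 2 * c * (n%:R * B)) + eps * (n%:R * (4 * N) * P + n%:R * N * P))).
    apply: lerD; first (apply: ler_wpM2l => //; apply: lerD => //).
      by rewrite -mulrN; apply: ler_wpM2l => //; rewrite mulr_ge0// ltW.
    by apply: ler_wpM2l; [exact: ltW|apply: lerD].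
  have -> : eps * (n%:R * (4 * N) * P + n%:R * N * P) = 5 * n%:R * N * (eps * P) by ring.
  have h1 : 5 * n%:R * N * (eps * P) <= 5 * n%:R * N * (2 * e).
    by apply: ler_wpM2l => //; rewrite !mulr_ge0// ltW.
  apply: le_trans (lerD (lexx _) h1) _; rewrite -subr_ge0.
  have -> : e * (C0 * (1 + 2 * c)) - (e * (n%:R * N + 2 * c * (n%:R * B)) + 5 * n%:R * N * (2 * e)) =
     e * n%:R * (B + 22 * N * c) by rewrite /C0; ring.
  by rewrite !mulr_ge0// addr_ge0 ?(ltW B0)// !mulr_ge0// ltW.
rewrite (_ : K * _ = C0 * e * (K * (1 + 2 * c))); last by ring.
have alg (q1 q2 q3 q4 : R) : q1 * q2 * (q3 * q4) = q1 * q4 * (q2 * q3) by ring.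
rewrite [leRHS]alg -/e.
by apply: ler_wpM2l => //; rewrite mulr_ge0// ltW.
Qed.
End energy_rate_bound.

(** * Integration with respect to the energy measure *)

Section density.
Context d (T : measurableType d) (R : realType).
Variables (mu : {measure set T -> \bar R}) (c : R) (w : T -> R).
Hypotheses (c0 : 0 <= c) (w0 : forall x, 0 <= w x) (mw : measurable_fun setT w).
Local Open Scope ereal_scope.

(** The set function [energy_measure] has this form; here it receives the structure of a measure, so
    that monotone convergence applies to integrals against it. *)
Definition density_measure (A : set T) : \bar R := c%:E * \int[mu]_(x in A) (w x)%:E.

Let density0 : density_measure set0 = 0.
Proof. by rewrite /density_measure integral_set0 mule0. Qed.

Let density_ge0 A : 0 <= density_measure A.
Proof. by rewrite /density_measure mule_ge0 ?lee_fin//; apply: integral_ge0 => x _; rewrite lee_fin. Qed.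

Let density_sigma_additive : semi_sigma_additive density_measure.
Proof.
move=> /= F mF tF mUF; apply: cvg_toP.
  apply: ereal_nondecreasing_is_cvgn => m n mn.
  by apply: lee_sum_nneg_natr => // k _ _; exact: density_ge0.
rewrite /density_measure ge0_integral_bigcup//=; last 2 first.
- by apply: measurable_funTS; exact: measurableT_comp.
- by move=> x _; rewrite lee_fin.
by rewrite nneseriesZl// => n _; apply: integral_ge0 => x _; rewrite lee_fin.
Qed.

HB.instance Definition _ := isMeasure.Build _ _ _ density_measure
  density0 density_ge0 density_sigma_additive.

Let integral_density_indic E : measurable E ->
  \int[density_measure]_x (\1_E x)%:E = c%:E * \int[mu]_x ((\1_E x)%:E * (w x)%:E).
Proof.
move=> mE; rewrite integral_indic//= setIT /density_measure integral_mkcond.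
congr (_ * _); apply: eq_integral => x _; rewrite patchE indicE.
by case: ifPn; rewrite ?mul1e ?mul0e.
Qed.

Import HBNNSimple.

Let integral_density_nnsfun (f : {nnsfun T >-> R}) :
  \int[density_measure]_x (f x)%:E = c%:E * \int[mu]_x ((f x)%:E * (w x)%:E).
Proof.
under [LHS]eq_integral do rewrite fimfunE -fsumEFin//.
rewrite [LHS]ge0_integral_fsum//; last 2 first.
  - by move=> r; exact/measurable_EFinP/measurableT_comp.
  - by move=> n x _; rewrite EFinM nnfun_muleindic_ge0.
have mwf : measurable_fun setT (fun x => (w x)%:E) by exact: measurableT_comp.
rewrite -[RHS]ge0_integralZl//; last 2 first.
  - by apply: emeasurable_funM => //; exact/measurable_EFinP.
  - by move=> x _; rewrite mule_ge0 ?lee_fin.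
under [RHS]eq_integral.
  move=> x xD; rewrite fimfunE -fsumEFin// ge0_mule_fsuml; last first.
    by move=> r; rewrite EFinM nnfun_muleindic_ge0.
  rewrite ge0_mule_fsumr; last first.
    by move=> r; apply: mule_ge0; [rewrite EFinM; exact: nnfun_muleindic_ge0|rewrite lee_fin].
  over.
rewrite [RHS]ge0_integral_fsum//; last 2 first.
  - move=> r; apply: emeasurable_funM => //; apply: emeasurable_funM => //.
    by apply/measurable_EFinP; exact: measurableT_comp.
  - move=> n x _; apply: mule_ge0; first by rewrite lee_fin.
    by apply: mule_ge0; [rewrite EFinM; exact: nnfun_muleindic_ge0|rewrite lee_fin].
apply: eq_fsbigr => r _; rewrite ge0_integralZl//.
- rewrite integralZl_indic_nnsfun//= integral_density_indic// muleCA.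
  have mi : measurable_fun setT (fun x => (\1_(f @^-1` [set r]) x : R)%:E).
    exact/measurable_EFinP/measurable_indic.
  have [r0|r0] := leP (0 : R)%R r; last first.
    rewrite [X in \1_X](_ : f @^-1` [set r] = set0); last exact: preimage_nnfun0.
    rewrite indic0 [X in _ * (_ * X)]integral0_eq ?[X in _ = _ * X]integral0_eq ?mule0//.
      by move=> x _; rewrite mulr0 mul0e.
    by move=> x _; rewrite mul0e.
  congr (_ * _); rewrite -ge0_integralZl ?lee_fin//; last 2 first.
  - exact: emeasurable_funM.
  - by move=> x _; rewrite mule_ge0 ?lee_fin.
  under [RHS]eq_integral do rewrite EFinM -muleA.
  by [].
- apply: emeasurable_funM => //; apply/measurable_EFinP; exact: measurableT_comp.
- move=> x _; apply: mule_ge0; first by rewrite EFinM; exact: nnfun_muleindic_ge0.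
  by rewrite lee_fin.
Qed.

(** The identity holds for indicators by definition, extends to simple functions by linearity, and
    passes to increasing limits on both sides. *)
Lemma ge0_integral_density (f : T -> R) : measurable_fun setT f -> (forall x, (0 <= f x)%R) ->
  \int[density_measure]_x (f x)%:E = c%:E * \int[mu]_x (f x * w x)%:E.
Proof.
move=> mf f0; have mfe : measurable_fun setT (EFin \o f) by exact/measurable_EFinP.
have mwf : measurable_fun setT (fun x => (w x)%:E) by exact: measurableT_comp.
have fe0 x : setT x -> 0 <= (EFin \o f) x by rewrite lee_fin.
pose g_ := nnsfun_approx measurableT mfe.
have mg n : measurable_fun setT (fun x => (g_ n x)%:E) by exact/measurable_EFinP.
have g_cvg x : (g_ n x)%:E @[n --> \oo] --> (f x)%:E by exact: (cvg_nnsfun_approx measurableT mfe fe0).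
have nd x : {homo (fun n => (g_ n x)%:E) : a b / (a <= b)%N >-> a <= b}.
  by move=> a b ab; rewrite lee_fin; exact/lefP/nd_nnsfun_approx.
transitivity (lim (\int[density_measure]_x (g_ n x)%:E @[n --> \oo])).
  rewrite -monotone_convergence//=.
  - by apply: eq_integral => x _; apply/esym/cvg_lim => //=; exact: g_cvg.
  - by move=> n x _; rewrite lee_fin.
under eq_fun do rewrite integral_density_nnsfun.
rewrite (_ : \int[mu]_x _ = lim (\int[mu]_x ((g_ n x)%:E * (w x)%:E) @[n --> \oo])); last first.
  rewrite -monotone_convergence//=.
  - apply: eq_integral => x _; apply/esym/cvg_lim => //=; rewrite EFinM.
    by apply: cvgeMr => //; exact: g_cvg.
  - by move=> n; exact: emeasurable_funM.
  - by move=> n x _; rewrite mule_ge0 ?lee_fin.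
  - by move=> x _ a b ab; rewrite lee_wpmul2r ?lee_fin//; have := nd x a b ab; rewrite lee_fin.
rewrite -limeMl//; apply/ereal_nondecreasing_is_cvgn => a b ab; apply: ge0_le_integral => //=.
- by move=> x _; rewrite mule_ge0 ?lee_fin.
- exact: emeasurable_funM.
- exact: emeasurable_funM.
- by move=> x _; rewrite lee_wpmul2r ?lee_fin//; have := nd x a b ab; rewrite lee_fin.
Qed.

End density.

Section ball.
Variables (R : realType) (n : nat) (y : 'rV[R]_n) (r : R).

Lemma open_eball : open (eball y r).
Proof.
rewrite (_ : eball y _ = (fun x => enorm (x - y)) @^-1` [set a | a < r])//.
apply: open_comp; last exact: open_lt.
by move=> x _; apply: (continuous_translate (f := @enorm R n)); exact: continuous_enorm.
Qed.

Lemma eball_bbox : eball y r `<=` bbox (enorm y + r).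
Proof.
move=> x /ltW xy i; rewrite -[x](subrK y) mxE addrC (le_trans (ler_normD _ _))//.
by rewrite lerD// ?coord_le_enorm// (le_trans (coord_le_enorm _ _)).
Qed.

Lemma leb_eball_gt0 : 0 < r -> (0 < leb R n (eball y r))%E.
Proof.
(* The ball contains the cube of half-side [h], since n h^2 < r^2. Dividing by n + 1 keeps this
   strict and covers n = 0. *)
move=> r0; pose h := r / n.+1%:R.
have h0 : 0 < h by rewrite divr_gt0.
pose A i := `[y 0 i - h, y 0 i + h]%classic.
have mA i : measurable (A i) by exact: measurable_itv.
apply: (@lt_le_trans _ _ (leb R n [set x | forall i, A i (x 0 i)])); last first.
  apply: le_measure; rewrite ?inE//; first exact: measurable_box.
    exact: open_measurable_rV open_eball.
  move=> x Ax; rewrite /eball /= -(@ltr_pXn2r _ 2)// ?nnegrE ?enorm_ge0 ?(ltW r0)// enorm_sq.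
  apply: (@le_lt_trans _ _ (\sum_(i < n) h ^+ 2)).
    apply: ler_sum => i _; have := Ax i; rewrite /A /= in_itv/= !mxE => /andP[? ?].
    by rewrite -ler_sqrt ?sqr_ge0// !sqrtr_sqr (ger0_norm (ltW h0)) ler_norml; lra.
  rewrite sumr_const card_ord -mulr_natr /h.
  have n1 : 0 < n.+1%:R :> R by rewrite ltr0n.
  rewrite expr_div_n mulrAC ltr_pdivrMr ?exprn_gt0//.
  rewrite ltr_pM2l ?exprn_gt0//; rewrite -natrX ltr_nat; exact: (@leq_pexp2l n.+1 1 2).
rewrite leb_box//; apply: (big_ind (fun a => 0 < a)%E) => // [a b|i _]; first exact: mule_gt0.
rewrite /A lebesgue_measure_itv/= lte_fin ifT; last by lra.
by rewrite -EFinB lte_fin; lra.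
Qed.

End ball.

(** * Gronwall's inequality *)

Section gronwall.
Variable R : realType.
Local Notation mu := (@lebesgue_measure R).

Lemma integrable_segment (f : R -> R) (a b : R) :
  (forall t, a <= t <= b -> {for t, continuous f}) -> mu.-integrable `[a, b] (EFin \o f).
Proof.
move=> cf; apply: continuous_compact_integrable; first exact: segment_compact.
by apply: continuous_in_subspaceT => t /set_mem; rewrite /= in_itv; exact: cf.
Qed.

Lemma primitive_of_continuous (f : R -> R) (l u a b : R) : l < a -> b < u ->
  (forall t, l < t < u -> {for t, continuous f}) ->
  exists F : R -> R, (forall t, a <= t <= b -> is_derive t 1 F (f t)) /\
    (forall t, a <= t <= b -> F t - F a = \int[mu]_(r in `[a, t]) f r).
Proof.
(* The primitive starts strictly left of [a] and the domain ends strictly right of [b], so the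
   derivative is two-sided at both endpoints of [a, b]. *)
move=> la bu cf; pose l' := (l + a) / 2; pose u' := (b + u) / 2.
have lt1 : l < l' by rewrite /l'; lra.
have lt2 : l' < a by rewrite /l'; lra.
have lt3 : b < u' by rewrite /u'; lra.
have lt4 : u' < u by rewrite /u'; lra.
have int t : t < u -> mu.-integrable `[l', t] (EFin \o f).
  move=> tu; apply: integrable_segment => r /andP[r1 r2]; apply: cf.
  by rewrite (lt_le_trans lt1 r1) (le_lt_trans r2 tu).
exists (fun x => \int[mu]_(r in `[l', x]) f r); split=> t /andP[at_ tb].
  have [||||D1 D2] := @continuous_FTC1_closed R f l' t u'.
  - exact: le_lt_trans lt3.
  - exact: int.
  - exact: lt_le_trans at_.
  - by apply: cf; rewrite (lt_le_trans la at_) (le_lt_trans tb bu).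
  - by split; [exact: D1|rewrite -derive1E].
rewrite (@Rintegral_itvB _ f (BLeft l') (BRight t) a); last 3 first.
- by apply: int; exact: le_lt_trans bu.
- by rewrite bnd_simp ltW.
- by rewrite bnd_simp.
rewrite Rintegral_itv_obnd_cbnd//.
apply: integrableS (int t (le_lt_trans tb bu)) => //.
by move=> r; rewrite /= !in_itv/= => /andP[r1 ->]; rewrite andbT ltW// (lt_trans lt2).
Qed.

(** [E] discounted by the integral of [k], minus the undiscounted integral of [g], is nonincreasing:
    the discount factor is at most 1 and [g] is nonnegative, so the discounted source is dominated
    by [g]. *)
Lemma gronwall (E E' k g : R -> R) (l a b u : R) : l < a -> a <= b -> b < u ->
  (forall t, a <= t <= b -> is_derive t 1 E (E' t)) ->
  (forall t, l < t < u -> {for t, continuous k}) -> (forall t, l < t < u -> {for t, continuous g}) ->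
  (forall t, a <= t <= b -> 0 <= k t) -> (forall t, a <= t <= b -> 0 <= g t) ->
  (forall t, a <= t <= b -> E' t <= k t * E t + g t) ->
  E b <= (E a + \int[mu]_(t in `[a, b]) g t) * expR (\int[mu]_(t in `[a, b]) k t).
Proof.
move=> la ab bu dE ck cg k0 g0 EE.
have [K [dK KE]] := primitive_of_continuous la bu ck.
have [G [dG GE]] := primitive_of_continuous la bu cg.
have bI : a <= b <= b by rewrite ab lexx.
rewrite -(GE b bI) -(KE b bI).
pose h t := expR (- (K t - K a)) * E t - G t.
pose dh t := expR (- (K t - K a)) * (- (k t - 0)) * E t + expR (- (K t - K a)) * E' t - g t.
have hD t : a <= t <= b -> is_derive t 1 h (dh t).
  move=> tI; apply: is_derive_subf (dG t tI); apply: is_derive_mulf (dE t tI).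
  exact: (is_derive_chain (is_derive_oppf (is_derive_subf (dK t tI) (is_derive_cst _ _ _))) (is_derive_expR _)).
have [|c [cI hE]] := @MVT_between _ h dh a b.
  by move=> t; rewrite (min_idPl ab) (max_idPr ab); exact: hD.
rewrite (min_idPl ab) (max_idPr ab) in cI.
have Kc : 0 <= K c - K a.
  rewrite KE//; apply: Rintegral_ge0 => t /=; rewrite in_itv/= => /andP[t1 t2].
  by apply: k0; rewrite t1 (le_trans t2)//; case/andP: cI.
have dhc : dh c <= 0.
  have := EE c cI; have := g0 c cI; rewrite /dh subr0.
  have : expR (- (K c - K a)) <= 1 by rewrite -expR0 ler_expR oppr_le0.
  have := expR_gt0 (- (K c - K a)); move: (expR _) (k c) (E c) (E' c) (g c) => x k1 e e' g1.
  nra.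
have hba : h b <= h a.
  by rewrite -subr_le0 hE mulr_le0_ge0// subr_ge0.
rewrite /h [K a - K a]subrr oppr0 expR0 mul1r in hba.
rewrite -ler_pdivrMr ?expR_gt0// -expRN mulrC.
move: hba; move: (expR _ * _) (E a) (G a) (G b) => x1 x2 x3 x4; lra.
Qed.

Lemma Rintegral_segment_gt0 (f : R -> R) (l u a b : R) : l < a -> a < b -> b < u ->
  (forall t, l < t < u -> {for t, continuous f}) -> (forall t, l < t < u -> 0 < f t) ->
  0 < \int[mu]_(t in `[a, b]) f t.
Proof.
move=> la ab bu cf f0; have [F [dF FE]] := primitive_of_continuous la bu cf.
rewrite -FE ?lexx ?(ltW ab)//.
have [|c [cI ->]] := @MVT_between _ F f a b.
  by move=> t; rewrite (min_idPl (ltW ab)) (max_idPr (ltW ab)); exact: dF.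
rewrite (min_idPl (ltW ab)) (max_idPr (ltW ab)) in cI; have /andP[c1 c2] := cI.
by rewrite mulr_gt0 ?subr_gt0// f0// (lt_le_trans la c1) (le_lt_trans c2 bu).
Qed.

(** The left endpoint is split off as a measurable singleton, which accommodates integrands that are
    only known to be continuous after the initial time. *)
Lemma measurable_segment (f : R -> R) (a b : R) : a <= b ->
  (forall t, a < t <= b -> {for t, continuous f}) -> measurable_fun `[a, b] f.
Proof.
move=> ab cf; rewrite -(@setU1itv _ _ (BRight b) a false) ?bnd_simp//; apply/measurable_funU => //.
split; first exact: measurable_fun_set1.
apply: subspace_continuous_measurable_fun => //; apply: continuous_in_subspaceT => t /set_mem.
by rewrite /= in_itv; exact: cf.
Qed.

Lemma EFin_Rintegral_segment (f : R -> R) (a b : R) :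
  (forall t, a <= t <= b -> {for t, continuous f}) ->
  (\int[mu]_(t in `[a, b]) f t)%:E = (\int[mu]_(t in `[a, b]) (f t)%:E)%E.
Proof.
by move=> cf; rewrite /Rintegral fineK//; apply: integrable_fin_num => //; exact: integrable_segment.
Qed.

(* The bound on the subintervals [[a, b]] avoids any regularity of [k] and [g] at [t1]. *)
Lemma gronwall_limit (E k g : R -> R) (t1 b u e : R) : t1 < b -> b < u ->
  (forall t, t1 < t < u -> {for t, continuous k}) -> (forall t, t1 < t < u -> {for t, continuous g}) ->
  (forall t, 0 <= k t) -> (forall t, t1 < t < u -> 0 < g t) -> (forall t, t1 <= t <= b -> 0 <= g t) ->
  {for t1, continuous E} -> 0 <= E t1 -> 0 < e ->
  (forall a, t1 < a < b ->
    E b <= (E a + e * \int[mu]_(t in `[a, b]) g t) * expR (\int[mu]_(t in `[a, b]) k t)) ->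
  ((E b)%:E <= ((E t1)%:E + e%:E * \int[mu]_(t in `[t1, b]) (g t)%:E) *
     expeR (\int[mu]_(t in `[t1, b]) (k t)%:E))%E.
Proof.
move=> t1b bu ck cg k0 g0 g0' cE E0 e0 H.
have sub a : t1 < a -> `[a, b]%classic `<=` `[t1, b]%classic.
  by move=> ta t; rewrite /= !in_itv/= => /andP[t1' ->]; rewrite andbT (le_trans (ltW ta)).
have in_u a t : t1 < a -> a <= t <= b -> t1 < t < u.
  by move=> ta /andP[? ?]; rewrite (lt_le_trans ta)//= (le_lt_trans _ bu).
have mono (f : R -> R) a : (forall t, t1 < t < u -> {for t, continuous f}) ->
    (forall t, t1 <= t <= b -> 0 <= f t) -> t1 < a ->
    ((\int[mu]_(t in `[a, b]) f t)%:E <= \int[mu]_(t in `[t1, b]) (f t)%:E)%E.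
  move=> cf f0 ta; rewrite EFin_Rintegral_segment; last by move=> t /(in_u _ _ ta); exact: cf.
  apply: ge0_subset_integral => //; last exact: sub.
    apply/measurable_EFinP; apply: measurable_segment; first exact: ltW.
    by move=> t /andP[? ?]; apply: cf; apply/andP; split => //; exact: le_lt_trans bu.
pose m := (t1 + b) / 2.
have m1 : t1 < m by rewrite /m; lra.
have m2 : m < b by rewrite /m; lra.
(* In the extended reals 0 times +oo is 0, so when the integral of [k] is infinite the first factor
   must be strictly positive for the right-hand side to be +oo. *)
have P0 : (0 < \int[mu]_(t in `[t1, b]) (g t)%:E)%E.
  apply: lt_le_trans (mono g m cg g0' m1); rewrite lte_fin.
  exact: (Rintegral_segment_gt0 m1 m2 bu cg g0).
have Pm a := mono g a cg g0'.
have Qm a := mono k a ck (fun t _ => k0 t).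
have Q0 : (0 <= \int[mu]_(t in `[t1, b]) (k t)%:E)%E by apply: integral_ge0 => t _; rewrite lee_fin.
move: (\int[mu]_(t in `[t1, b]) (g t)%:E)%E (\int[mu]_(t in `[t1, b]) (k t)%:E)%E Pm Qm P0 Q0.
move=> P Q Pm Qm P0 Q0.
have S0 : (0 < (E t1)%:E + e%:E * P)%E by apply: lt_le_trans (leeDr _ _); rewrite ?lee_fin// mule_gt0.
case: Q Q0 Qm => [q q0 Qm|_ _|//]; last by rewrite /= gt0_muley// leey.
case: P P0 S0 Pm => [p p0 _ Pm|_ S0 _|//]; last first.
  by rewrite (gt0_muley (x := e%:E))// ?lte_fin// addey// gt0_mulye ?leey// lte_fin expR_gt0.
rewrite -[X in (_ <= X)%E]/(((E t1 + e * p) * expR q)%:E) lee_fin leNgt; apply/negP => lt1.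
pose X := expR q; have X0 : 0 < X by exact: expR_gt0.
(* The initial value that would give equality. If the claim failed, [E] would be below [c] at [t1],
   hence at some later [a], and the inequality on [a, b] would fail. *)
pose c := E b / X - e * p.
have cE1 : E t1 < c by rewrite /c ltrBrDr ltr_pdivlMr.
have near_c : \forall a \near t1^'+, E a < c.
  exact: (cvg_at_right_filter cE (lt_nbhsl cE1)).
have [a [Ea [ta ab]]] : exists a, E a < c /\ (t1 < a /\ a < b).
  apply: (@filter_ex _ t1^'+); apply: filterI near_c _.
  by apply: filterI; [exact: nbhs_right_gt|exact: nbhs_right_lt].
have /= := H a; rewrite ta ab => /(_ isT); apply/negP; rewrite -ltNge.
have := Pm a ta; have := Qm a ta; rewrite !lee_fin => qa pa.
have ia0 : 0 <= \int[mu]_(t in `[a, b]) g t.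
  apply: Rintegral_ge0 => t; rewrite /= in_itv/= => tI; apply: ltW; apply: g0; exact: (in_u a).
have XaX : expR (\int[mu]_(t in `[a, b]) k t) <= X by rewrite ler_expR.
have Xa0 := expR_gt0 (\int[mu]_(t in `[a, b]) k t).
have Eb0 : 0 < E b.
  apply: le_lt_trans lt1; apply: mulr_ge0; last exact: expR_ge0.
  by rewrite addr_ge0// mulr_ge0 ?ltW.
have hc : (E a + e * p) * X < E b by rewrite -ltr_pdivlMr// -ltrBrDr.
have [neg|pos] := leP (E a + e * \int[mu]_(t in `[a, b]) g t) 0.
  by apply: le_lt_trans Eb0; rewrite mulr_le0_ge0// ltW.
have hI : E a + e * \int[mu]_(t in `[a, b]) g t <= E a + e * p by rewrite lerD2l ler_pM2l.
exact: le_lt_trans (ler_pM (ltW pos) (ltW Xa0) hI XaX) hc.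
Qed.

End gronwall.

(** * Application to the weighted energy of the solution *)

Section monotonicity.
Variables (R : realType) (n : nat) (eta : 'rV[R]_n -> R) (eps : R) (rbar : 'rV[R]_n -> R)
  (u : R -> 'rV[R]_n -> R).
Hypotheses (heta : is_cutoff eta) (eps0 : 0 < eps) (C1r : Ck 1 rbar)
  (gr : forall x, enorm (grad rbar x) <= 1)
  (sol : allen_cahn_solution eps (fun x => profile eps (rbar x)) u).
Variables (y : 'rV[R]_n) (s : R).
Local Notation M := (enorm y + 2^-1).
Local Notation e := (energy_density eps u).
Local Notation rho := (kernel eta y s).
Local Notation E := (weighted_energy eps u rho M).

Definition ball_energy t := \int[leb R n]_(x in eball y 2^-1) e t x.

Let M0 : 0 <= M. Proof. by rewrite addr_ge0 ?enorm_ge0. Qed.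

Let ut1 t x : 0 <= t -> `|u t x| < 1. Proof. exact: (solution_lt1 eps0 C1r gr sol). Qed.

Lemma continuous_clamped_energy_density :
  continuous (fun p : R * 'rV[R]_n => e (Num.max 0 p.1) p.2).
Proof.
apply: continuous_at_points => p; rewrite /energy_density; prove_continuous.
- exact: (continuous_clamped_partial sol).
- exact: (continuous_clamped_solution sol).
Qed.

Lemma continuous_energy_density_slice t : 0 <= t -> continuous (e t).
Proof.
move=> t0; rewrite -{1}(max_idPr t0).
by apply: (continuous_slice (F := fun p => e (Num.max 0 p.1) p.2)) => x; exact: continuous_clamped_energy_density.
Qed.

Lemma kernel_out t x : t < s -> ~ bbox M x -> rho t x = 0.
Proof.
move=> ts nx; apply: (kernel_far heta ts); rewrite leNgt; apply/negP => xy.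
by apply: nx; exact: eball_bbox xy.
Qed.

Lemma continuous_kernel_slice t : t < s -> continuous (rho t).
Proof.
by move=> ts; apply: (continuous_slice (F := fun p => rho p.1 p.2)) => x; exact: continuous_kernel.
Qed.

(** The energy density involves only [u] and its first space derivatives, which are continuous up to
    t = 0; this gives the limit a -> t1 even for t1 = 0. *)
Lemma continuous_clamped_weighted_energy t : 0 < s -> t < s ->
  {for t, continuous (fun r : R => E (Num.max 0 r))}.
Proof.
move=> s0 ts; have tI : t - 1 < t < s by rewrite ts andbT; lra.
apply: (continuous_integral_param (@measurable_bbox R n M) (@subset_refl _ _)
  (F := fun p => rho (Num.max 0 p.1) p.2 * e (Num.max 0 p.1) p.2) _ tI) => r x /andP[_ rs].
prove_continuous; last exact: continuous_clamped_energy_density.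
apply: (continuous_uncurry_at (f := fun q : R * 'rV[R]_n => Num.max 0 q.1) (g := snd) (h := fun q => rho q.1 q.2)).
- exact: continuous_max0.
- exact: cvg_snd.
- by apply: (continuous_kernel heta); rewrite /= gt_max s0.
Qed.

Lemma is_derive_kernel_energy t : 0 < t < s ->
  is_derive t 1 E (\int[leb R n]_(x in bbox M) energy_rate eps u rho t x) /\
  continuous (energy_rate eps u rho t).
Proof.
have lts r : 0 < r < s -> r < s by case/andP.
have h1 r (x : 'rV[R]_n) : 0 < r < s -> {for (r, x), continuous (fun p : R * 'rV[R]_n => rho p.1 p.2)}.
  by move=> /lts rs; exact: continuous_kernel.
have h2 r x : 0 < r < s -> derivable (rho^~ x) r 1.
  by move=> /lts rs; have [] := is_derive_kernel_time eta y x rs.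
have h3 r (x : 'rV[R]_n) : 0 < r < s -> {for (r, x), continuous (fun p : R * 'rV[R]_n => derive1 (rho^~ p.2) p.1)}.
  by move=> /lts rs; exact: continuous_kernel_time.
have h4 r x i : 0 < r < s -> derivable (rho r) x (delta_mx 0 i).
  by move=> /lts rs; have [] := is_derive_kernel y heta x i rs.
have h5 r x i j : 0 < r < s -> derivable (partial j (rho r)) x (delta_mx 0 i).
  by move=> /lts rs; rewrite (partial_kernel y heta j rs); have [] := is_derive_kernel1 y s heta r x i j.
have h6 r i : 0 < r < s -> continuous (partial i (rho r)).
  by move=> /lts rs; exact: continuous_partial_kernel.
have h7 r i j : 0 < r < s -> continuous (partial i (partial j (rho r))).
  by move=> /lts rs; exact: continuous_partial2_kernel.
have h8 r x : 0 < r < s -> ~ bbox M x -> rho r x = 0.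
  by move=> /lts rs; exact: kernel_out.
move=> tI; split.
- exact: (is_derive_weighted_energy eps0 sol M0 h1 h2 h3 h4 h5 h6 h7 h8 tI).
- exact: (continuous_energy_rate sol h1 h3 h6 h7 tI).
Qed.

Lemma ball_energy_ge0 t : 0 <= ball_energy t.
Proof. by apply: Rintegral_ge0 => x _; exact: energy_density_ge0. Qed.

Let mball : measurable (eball y 2^-1).
Proof. by apply: open_measurable_rV; exact: open_eball. Qed.

(** The potential term is positive because |u| < 1. Strictness serves the case of an infinite
    integral of [lambda] squared in [gronwall_limit]. *)
Lemma ball_energy_gt0 t : 0 < t -> 0 < ball_energy t.
Proof.
move=> t0; apply: (Rintegral_gt0 mball (@eball_bbox _ _ _ _)).
- exact: leb_eball_gt0.
- exact: continuous_energy_density_slice (ltW t0).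
- move=> x; apply: ltr_wpDl.
    by rewrite divr_ge0// mulr_ge0 ?(ltW eps0)// sumr_ge0// => i _; exact: sqr_ge0.
  by rewrite !divr_gt0// exprn_gt0// one_sub_sq_gt0// ut1// ltW.
Qed.

Lemma continuous_ball_energy t : 0 < t -> {for t, continuous ball_energy}.
Proof.
move=> t0; have tI : 0 < t < t + 1 by rewrite t0 ltrDl ltr01.
apply: (continuous_integral_param mball (@eball_bbox _ _ _ _) (F := fun p => e p.1 p.2) _ tI).
by move=> r x /andP[r0 _]; exact: (continuous_energy_density sol).
Qed.

Lemma continuous_discounted_ball_energy t : 0 < t < s ->
  {for t, continuous (fun r => expR (- (128 * (s - r))^-1) * ball_energy r)}.
Proof.
move=> /andP[t0 ts]; prove_continuous; last exact: continuous_ball_energy.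
apply: (@continuous_comp _ _ _ (fun r => - (128 * (s - r))^-1) expR); last exact: continuous_expR.
prove_continuous; apply: (continuous_invf (f := fun r => 128 * (s - r))).
  by rewrite gt_eqF// mulr_gt0// subr_gt0.
by prove_continuous; exact: cvg_id.
Qed.

(** The denominator is positive by the strict bound |u| < 1. The numerator contains second space
    derivatives, which are controlled for positive times. *)
Lemma continuous_lambda t : 0 < t -> {for t, continuous (fun r => lambda eps (u r))}.
Proof.
move=> t0; have tI : 0 < t < t + 1 by rewrite t0 ltrDl ltr01.
pose N (p : R * 'rV[R]_n) := (1 - u p.1 p.2 ^+ 2) *
  (eps * laplacian (u p.1) p.2 + 2 * u p.1 p.2 * (1 - u p.1 p.2 ^+ 2) / eps).
pose D (p : R * 'rV[R]_n) := (1 - u p.1 p.2 ^+ 2) ^+ 2 / 2.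
apply: (continuous_near_eq (f := fun r => - \int[leb R n]_(x in torus) N (r, x) *
    (2 * \int[leb R n]_(x in torus) D (r, x))^-1)).
  apply: filterS (lt_nbhsr t0) => r r0.
  by rewrite lambda_of_bounded ?mulNr// => x; apply: ltW; apply: ut1; exact: ltW.
have cN r x : 0 < r < t + 1 -> {for (r, x), continuous N}.
  move=> /andP[r0 _]; rewrite /N /laplacian; prove_continuous.
  - exact: (continuous_solution sol).
  - exact: (continuous_partial2 sol).
  - exact: (continuous_solution sol).
  - exact: (continuous_solution sol).
have cD r x : 0 < r < t + 1 -> {for (r, x), continuous D}.
  by move=> /andP[r0 _]; rewrite /D; prove_continuous; exact: (continuous_solution sol).
have cIN := continuous_integral_param (@measurable_torus R n) (@torus_bbox R n) cN tI.
have cID := continuous_integral_param (@measurable_torus R n) (@torus_bbox R n) cD tI.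
prove_continuous; first exact: cIN.
apply: (continuous_invf (f := fun r => 2 * \int[leb R n]_(x in torus) D (r, x))).
  rewrite gt_eqF// mulr_gt0//; apply: (integral_sub_sq_gt0 sol t0) => z.
  by apply: ut1; exact: ltW.
by prove_continuous; exact: cID.
Qed.

Lemma weighted_energy_ge0 t : t < s -> 0 <= E t.
Proof.
by move=> ts; apply: Rintegral_ge0 => x _; rewrite mulr_ge0 ?kernel_ge0 ?energy_density_ge0.
Qed.

Let measurable_density t : 0 <= t -> measurable_fun setT (e t).
Proof.
by move=> t0; apply: continuous_measurable_rV; exact: continuous_energy_density_slice.
Qed.

Let energy_measure_density t : energy_measure eps (u t) = density_measure (leb R n) (sigma R)^-1 (e t).
Proof.
apply/funext => A; congr (_ * _)%E; apply: eq_integral => x _.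
by rewrite energy_densityE.
Qed.

Lemma energy_measure_ball t : 0 <= t ->
  energy_measure eps (u t) (eball y 2^-1) = ((sigma R)^-1%:E * (ball_energy t)%:E)%E.
Proof.
move=> t0; rewrite energy_measure_density /density_measure /ball_energy /Rintegral fineK//.
apply: integrable_fin_num => //.
exact: (integrable_bounded_domain mball (@eball_bbox _ _ _ _) (continuous_energy_density_slice t0)).
Qed.

(** The kernel vanishes outside the box, so the extended integral over the whole space is a finite
    integral over a compact set, to which the differentiation result applies. *)
Lemma integral_heat_kernel t : 0 <= t -> t < s ->
  (\int[energy_measure eps (u t)]_x (heat_kernel eta y s x t)%:E = (sigma R)^-1%:E * (E t)%:E)%E.
Proof.
move=> t0 ts; have cr := continuous_kernel_slice ts; have ce := continuous_energy_density_slice t0.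
have sg : 0 <= (sigma R)^-1 by rewrite invr_ge0 Rintegral_ge0// => x _; exact: sqrtr_ge0.
rewrite energy_measure_density.
have mr : measurable_fun setT (rho t) by exact: continuous_measurable_rV.
have r0 x : 0 <= rho t x by exact: kernel_ge0.
etransitivity; first exact: (ge0_integral_density (leb R n) sg (energy_density_ge0 u eps0 t) (measurable_density t0) mr r0).
congr (_ * _)%E; rewrite /weighted_energy /Rintegral fineK; last first.
  apply: integrable_fin_num; first exact: measurable_bbox.
  apply: (integrable_bounded_domain (@measurable_bbox R n M) (@subset_refl _ _) (f := fun x => rho t x * e t x)).
  by apply: continuous_at_points => x; prove_continuous; [exact: cr|exact: ce].
rewrite [RHS]integral_mkcond; apply: eq_integral => x _; rewrite patchE.
by case: ifPn => //; rewrite notin_setE => /(kernel_out ts) ->; rewrite mul0r.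
Qed.

Variable c5 : R.
Hypothesis c50 : 0 < c5.
Hypothesis rate : forall t x, 0 < t -> t < s -> energy_rate eps u rho t x <=
  lambda eps (u t) ^+ 2 / 2 * (rho t x * e t x) +
  c5 * (expR (- (128 * (s - t))^-1) * (if enorm (x - y) < 2^-1 then e t x else 0)).

Lemma integral_energy_rate_le t : 0 < t < s ->
  \int[leb R n]_(x in bbox M) energy_rate eps u rho t x <=
  `|lambda eps (u t)| ^+ 2 * E t + c5 * (expR (- (128 * (s - t))^-1) * ball_energy t).
Proof.
move=> tI; have /andP[t0 ts] := tI; have [_ cr] := is_derive_kernel_energy tI.
have ce := continuous_energy_density_slice (ltW t0).
have mB := @measurable_bbox R n M.
have ib (f : 'rV[R]_n -> R) : continuous f -> (leb R n).-integrable (bbox M) (EFin \o f).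
  by move=> cf; exact: (integrable_bounded_domain mB (@subset_refl _ _) cf).
pose b x := if enorm (x - y) < 2^-1 then e t x else 0.
have bE : b = e t \_ (eball y 2^-1).
  apply/funext => x; rewrite patchE /b; case: ifPn => [xy|xy]; first by rewrite mem_set.
  by rewrite memNset// => xy'; case/negP: xy.
have iball : (leb R n).-integrable (eball y 2^-1) (EFin \o e t).
  exact: (integrable_bounded_domain mball (@eball_bbox _ _ _ _) ce).
have ibb : (leb R n).-integrable (bbox M) (EFin \o b).
  apply: (@integrableS _ _ _ _ setT) => //.
  have /(integrable_mkcond _ mball) := iball; apply: eq_integrable => // x _.
  by rewrite patchE /= bE patchE; case: ifP.
have Ib : \int[leb R n]_(x in bbox M) b x = ball_energy t.
  rewrite Rintegral_mkcond /ball_energy [RHS]Rintegral_mkcond; apply: eq_Rintegral => x _.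
  rewrite bE !patchE; case: ifPn => // /negP nx; case: ifPn => // xb.
  by case: nx; rewrite inE; apply: eball_bbox; rewrite inE in xb.
have cre : continuous (fun x => rho t x * e t x).
  by apply: continuous_at_points => x; prove_continuous; [exact: continuous_kernel_slice|exact: ce].
pose c1 := lambda eps (u t) ^+ 2 / 2; pose c2 := c5 * expR (- (128 * (s - t))^-1).
have i1 : (leb R n).-integrable (bbox M) (EFin \o (fun x => c1 * (rho t x * e t x))).
  by apply: (@integrableZl _ _ _ _ _ mB c1 (EFin \o (fun x => rho t x * e t x))); exact: ib.
have i2 : (leb R n).-integrable (bbox M) (EFin \o (fun x => c2 * b x)).
  exact: (@integrableZl _ _ _ _ _ mB c2 (EFin \o b)).
apply: (@le_trans _ _ (\int[leb R n]_(x in bbox M) (c1 * (rho t x * e t x) + c2 * b x))).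
  apply: le_Rintegral => //; first exact: ib.
    exact: (@integrableD _ _ _ _ _ mB _ _ i1 i2).
  by move=> x _; rewrite /c2 -mulrA; exact: rate.
rewrite RintegralD// RintegralZl//; last exact: ib.
rewrite RintegralZl// Ib mulrA -/c2 lerD2r; apply: ler_wpM2r; first exact: weighted_energy_ge0.
(* The factor one half in front of the squared multiplier is given away here. *)
by rewrite real_normK ?num_real// /c1; have := sqr_ge0 (lambda eps (u t)); lra.
Qed.

Lemma weighted_energy_monotone t1 t2 : 0 <= t1 -> t1 < t2 -> t2 < s ->
  ((E t2)%:E <= ((E t1)%:E + c5%:E *
      \int[lebesgue_measure]_(t in `[t1, t2]) (expR (- (128 * (s - t))^-1) * ball_energy t)%:E) *
    expeR (\int[lebesgue_measure]_(t in `[t1, t2]) (`|lambda eps (u t)| ^+ 2)%:E))%E.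
Proof.
move=> t10 t12 t2s; have s0 : 0 < s by apply: le_lt_trans t10 (lt_trans t12 t2s).
pose gam t := expR (- (128 * (s - t))^-1) * ball_energy t.
pose k t := `|lambda eps (u t)| ^+ 2.
have ck t : 0 < t < s -> {for t, continuous k}.
  move=> /andP[t0 _]; rewrite (_ : k = fun t => lambda eps (u t) ^+ 2).
    by prove_continuous; exact: continuous_lambda.
  by apply/funext => r; rewrite /k real_normK ?num_real.
have cg t : 0 < t < s -> {for t, continuous gam} by exact: continuous_discounted_ball_energy.
have sub t : t1 < t < s -> 0 < t < s by move=> /andP[h ->]; rewrite andbT (le_lt_trans t10).
(* Both times are written as maxima with 0, the form in which the weighted energy is continuous at
   t1 = 0. *)
rewrite -[in X in (X%:E <= _)%E](max_idPr (ltW (le_lt_trans t10 t12))) -[in X in (_ <= (X%:E + _) * _)%E](max_idPr t10).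
apply: (gronwall_limit (E := fun t => E (Num.max 0 t)) (k := k) (g := gam) t12 t2s).
- by move=> t /sub; exact: ck.
- by move=> t /sub; exact: cg.
- by move=> t; exact: sqr_ge0.
- by move=> t /sub/andP[t0 _]; rewrite mulr_gt0 ?expR_gt0 ?ball_energy_gt0.
- by move=> t _; rewrite mulr_ge0 ?expR_ge0 ?ball_energy_ge0.
- by apply: continuous_clamped_weighted_energy => //; exact: lt_trans t2s.
- by rewrite /= (max_idPr t10); apply: weighted_energy_ge0; exact: lt_trans t2s.
- by [].
move=> a /andP[t1a at2]; have a0 : 0 < a by exact: le_lt_trans t1a.
rewrite /= (max_idPr (ltW a0)) (max_idPr (ltW (lt_trans a0 at2))).
have -> : c5 * \int[lebesgue_measure]_(t in `[a, t2]) gam t = \int[lebesgue_measure]_(t in `[a, t2]) (c5 * gam t).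
  rewrite RintegralZl//; apply: integrable_segment => t /andP[h1 h2]; apply: cg.
  by rewrite (lt_le_trans a0 h1) (le_lt_trans h2).
have inI t : a <= t <= t2 -> 0 < t < s.
  by move=> /andP[h1 h2]; rewrite (lt_le_trans a0 h1) (le_lt_trans h2).
apply: (@gronwall _ E (fun t => \int[leb R n]_(x in bbox M) energy_rate eps u rho t x) k (fun t => c5 * gam t) 0 a t2 s) => //.
- exact: ltW.
- by move=> t /inI tI; have [] := is_derive_kernel_energy tI.
- by move=> t tI; prove_continuous; exact: cg.
- by move=> t _; exact: sqr_ge0.
- by move=> t _; rewrite mulr_ge0 ?(ltW c50)// mulr_ge0 ?expR_ge0 ?ball_energy_ge0.
- by move=> t /inI tI; exact: integral_energy_rate_le.
Qed.

End monotonicity.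

Theorem proposition3p7 (R : realType) (d : nat) (hd : (2 <= d)%N)
    (eta : 'rV[R]_d -> R) (heta : is_cutoff eta) :
  exists c5 : R, 0 < c5 /\
    forall (U0 : set 'rV[R]_d) (D0 : R) (U : nat -> set 'rV[R]_d)
      (eps : nat -> R) (rbar : nat -> 'rV[R]_d -> R)
      (phi : nat -> R -> 'rV[R]_d -> R),
    initial_set U0 D0 U ->
    scale_sequence eps ->
    (forall i, smoothed_dist (U i) (eps i) (rbar i)) ->
    (forall i, allen_cahn_solution (eps i)
       (fun x => profile (eps i) (rbar i x)) (phi i)) ->
    forall (i : nat) (y : 'rV[R]_d) (t1 t2 s : R),
      0 <= t1 -> t1 < t2 -> t2 < s ->
      (\int[energy_measure (eps i) (phi i t2)]_x (heat_kernel eta y s x t2)%:E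
       <= (\int[energy_measure (eps i) (phi i t1)]_x
             (heat_kernel eta y s x t1)%:E
           + c5%:E * \int[lebesgue_measure]_(t in `[t1, t2]%classic)
               ((expR (- (128 * (s - t))^-1))%:E
                * energy_measure (eps i) (phi i t) (eball y 2^-1)))
          * expeR (\int[lebesgue_measure]_(t in `[t1, t2]%classic)
                     (`|lambda (eps i) (phi i t)| ^+ 2)%:E))%E.
Proof.
(* The constant is fixed here, when only the dimension and the cut-off have been introduced. *)
have [c5 c50 rate] := energy_rate_bound (ltnW hd) heta.
exists c5; split=> // U0 D0 U eps rbar phi _ [epsI _ _] smooth_r sols i y t1 t2 s t10 t12 t2s.
have /andP[eps0 _] := epsI i; have sol := sols i.
have [[C2r _] gr _ _] := smooth_r i.
have C1r : Ck 1 (rbar i).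
  by case: C2r => cr dr; split=> // j; have [dj [cj _]] := dr j.
have rate_i t x := rate _ _ _ eps0 C1r gr sol y s t x.
have main := weighted_energy_monotone heta eps0 C1r gr sol c50 rate_i t10 t12 t2s.
have t1s := lt_trans t12 t2s; have t20 := ltW (le_lt_trans t10 t12).
rewrite !(integral_heat_kernel heta eps0 sol y)//.
pose gam t := expR (- (128 * (s - t))^-1) * ball_energy (eps i) (phi i) y t.
have sg : 0 <= (sigma R)^-1 by rewrite invr_ge0 Rintegral_ge0// => x _; exact: sqrtr_ge0.
have gam0 t : 0 <= gam t by rewrite mulr_ge0 ?expR_ge0 ?ball_energy_ge0.
have -> : (\int[lebesgue_measure]_(t in `[t1, t2])
    ((expR (- (128 * (s - t))^-1))%:E * energy_measure (eps i) (phi i t) (eball y 2^-1)) =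
    (sigma R)^-1%:E * \int[lebesgue_measure]_(t in `[t1, t2]) (gam t)%:E)%E.
  rewrite -ge0_integralZl//; last 2 first.
  - apply/measurable_EFinP; apply: measurable_segment; first exact: ltW.
    move=> t /andP[tl tr]; apply: (continuous_discounted_ball_energy sol).
    by rewrite (le_lt_trans t10 tl) (le_lt_trans tr t2s).
  - by move=> t _; rewrite lee_fin.
  apply: eq_integral => t; rewrite inE /= in_itv/= => /andP[tl _].
  by rewrite (energy_measure_ball sol y (le_trans t10 tl)) /gam EFinM muleCA.
(* The common factor [sigma^-1] is collected in front of the bracket; being nonnegative, it
   multiplies the unnormalized inequality. *)
rewrite muleCA -ge0_muleDr ?lee_fin; last 2 first.
- exact: weighted_energy_ge0.
- by rewrite mule_ge0 ?lee_fin ?(ltW c50)//; apply: integral_ge0 => t _; rewrite lee_fin.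
by rewrite -muleA lee_wpmul2l// lee_fin.
Qed.
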